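(* Let $d\ge2$ and $\gamma,\lambda>0$. For the vertex intensity we have $$\lambda^{d-1}\,\xi_0(\gamma,\lambda)=\frac{\gamma}{d-1}\,\bigl(1-\mathbb{E}V_\gamma\bigr).$$
   Context: $\mathbb{H}^d$ is hyperbolic space (curvature $-1$) in the upper halfspace model $\mathbb{R}^{d-1}\times(0,\infty)$ with points $(v,y)$ and volume measure $d\mathrm{vol}_{\mathbb{H}^d}=y^{-d}\,dv\,dy$. Let $\eta_\gamma$ be a Poisson point process on $\mathbb{H}^d$ with intensity measure $\gamma\,\mathrm{vol}_{\mathbb{H}^d}$, $B_\lambda^\infty=\{(v,y):y\ge\lambda\}$, $\eta_{\gamma,\lambda}=\eta_\gamma\cap B_\lambda^\infty$, and let $K_{\gamma,\lambda}=\operatorname{conv}(\eta_{\gamma,\lambda})$ be the geodesic convex hull (the smallest geodesically convex set containing $\eta_{\gamma,\lambda}$). $\mathcal{D}_{\gamma,\lambda}$ is the (almost surely locally finite, simplicial, stationary) random tessellation of $\mathbb{R}^{d-1}$ consisting of all simplices $[v_1,\dots,v_d]$ (Euclidean convex hulls) such that $(v_1,y_1),\dots,(v_d,y_d)$ are pairwise distinct points of $\eta_{\gamma,\lambda}$, $v_1,\dots,v_d$ are affinely independent, and the unique half-ball $\{(v,y)\in\mathbb{R}^{d-1}\times(0,\infty):\|v-w\|^2+y^2\le r^2\}$ whose bounding hemisphere contains these $d$ points has no point of $\eta_{\gamma,\lambda}$ in its interior. Its vertex intensity is $$\xi_0(\gamma,\lambda):=\frac{1}{\mathrm{vol}_{\mathbb{R}^{d-1}}(W)}\,\mathbb{E}\,\#\{\text{vertices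 of }\mathcal{D}_{\gamma,\lambda}\text{ in }W\}$$ for any bounded Borel set $W\subset\mathbb{R}^{d-1}$ with $0<\mathrm{vol}_{\mathbb{R}^{d-1}}(W)<\infty$ (independent of $W$). With $C_\lambda(W)=W\times[\lambda,\infty)$ put $V_{\gamma,\lambda}(W)=\mathrm{vol}_{\mathbb{H}^d}(K_{\gamma,\lambda}\cap C_\lambda(W))/\mathrm{vol}_{\mathbb{H}^d}(C_\lambda(W))$ and $\mathbb{E}V_\gamma:=\mathbb{E}V_{\gamma,\lambda}(W)$, a quantity that is independent of $W$ and $\lambda$. *)

(* Defs.v *)
From HB Require Import structures.
From mathcomp Require Import all_boot all_order all_algebra.
From mathcomp Require Import all_classical all_reals all_analysis.
From mathcomp Require Import measurable_realfun.

Set Implicit Arguments.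
Unset Strict Implicit.
Unset Printing Implicit Defensive.

Import Order.TTheory GRing.Theory Num.Theory.
Import numFieldNormedType.Exports.

Local Open Scope classical_set_scope.
Local Open Scope ring_scope.

(* The sigma-algebra on row vectors is generated by the coordinate maps, as for
   [n.-tuple R] in the library; it is the Borel sigma-algebra of R^n. *)

Section measurable_rV.
Context {R : realType} {n : nat}.

Let coord (i : 'I_n) (v : 'rV[R]_n) : R := v 0 i.

Let rV_set0 : g_sigma_preimage coord set0.
Proof. exact: sigma_algebra0. Qed.

Let rV_setC A : g_sigma_preimage coord A -> g_sigma_preimage coord (~` A).
Proof. exact: sigma_algebraC. Qed.

Let rV_bigcup (F : _^nat) : (forall i, g_sigma_preimage coord (F i)) ->
  g_sigma_preimage coord (\bigcup_i (F i)).
Proof. exact: sigma_algebra_bigcup. Qed.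

HB.instance Definition _ := @isMeasurable.Build default_measure_display
  'rV[R]_n (g_sigma_preimage coord) rV_set0 rV_setC rV_bigcup.

Lemma measurable_coord_rV (i : 'I_n) :
  measurable_fun [set: 'rV[R]_n] (fun v : 'rV[R]_n => v 0 i).
Proof.
move=> _ Y mY; rewrite setTI; apply: sub_sigma_algebra => /=.
rewrite -bigcup_seq/=; exists i => /=; first by rewrite mem_index_enum.
by exists Y => //; rewrite setTI.
Qed.

Lemma measurable_fun_rV d (T : measurableType d) (f : T -> 'rV[R]_n) :
  (forall i, measurable_fun [set: T] (fun x => f x 0 i)) ->
  measurable_fun [set: T] f.
Proof.
move=> mf _ A mA; rewrite setTI.
suff : g_sigma_preimage coord `<=` [set B | measurable (f @^-1` B)] by exact.
apply: smallest_sub.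
  split=> /=.
  - by rewrite preimage_set0.
  - by move=> B mB; rewrite setTD preimage_setC; exact: measurableC.
  - by move=> F mF; rewrite preimage_bigcup; exact: bigcup_measurable.
rewrite -bigcup_seq/=; apply: bigcup_sub => i _ _ [B mB <-] /=.
rewrite setTI.
by have := mf i measurableT B mB; rewrite setTI.
Qed.

End measurable_rV.

Section sigma_finite_product.
Local Open Scope ereal_scope.
Context d1 d2 (T1 : measurableType d1) (T2 : measurableType d2) (R : realType).
Variables (m1 : {sigma_finite_measure set T1 -> \bar R})
          (m2 : {sigma_finite_measure set T2 -> \bar R}).

Lemma sigma_finite_product : sigma_finite setT (m1 \x m2).
Proof.
have /sigma_finiteP[F [TF ndF Foo]] := sigma_finiteT m1.
have /sigma_finiteP[G [TG ndG Goo]] := sigma_finiteT m2.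
exists (fun n => F n `*` G n).
  rewrite -setXTT TF TG predeqE => -[x y]; split.
    move=> [/= [n _ Fnx] [k _ Gky]]; exists (maxn n k) => //; split.
    - by move: x Fnx; exact/subsetPset/ndF/leq_maxl.
    - by move: y Gky; exact/subsetPset/ndG/leq_maxr.
  by move=> [n _ []/= ? ?]; split; exists n.
move=> k; have [? ?] := Foo k; have [? ?] := Goo k.
split; first exact: measurableX.
by rewrite product_measure1E// lte_mul_pinfty// ge0_fin_numE.
Qed.

End sigma_finite_product.

(* [lebesgue_measure] has for domain [measurableTypeR R], whose display differs
   from that of [R]; [lebesgue_R] is the same set function on [R]. *)
Section lebesgue_R.
Context {R : realType}.
Local Open Scope ereal_scope.

Definition lebesgue_R : set R -> \bar R := @lebesgue_measure R.

Let lebesgue_R0 : lebesgue_R set0 = 0.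
Proof. exact: (measure0 (@lebesgue_measure R)). Qed.

Let lebesgue_R_ge0 A : 0 <= lebesgue_R A.
Proof. exact: (measure_ge0 (@lebesgue_measure R)). Qed.

Let lebesgue_R_sigma_additive : semi_sigma_additive lebesgue_R.
Proof. exact: (@measure_semi_sigma_additive _ _ _ (@lebesgue_measure R)). Qed.

HB.instance Definition _ := isMeasure.Build _ R R lebesgue_R
  lebesgue_R0 lebesgue_R_ge0 lebesgue_R_sigma_additive.

Let lebesgue_R_sigma_finite : sigma_finite setT lebesgue_R.
Proof.
have [F TF mF] := sigma_finiteT (@lebesgue_measure R).
by exists F.
Qed.

HB.instance Definition _ := Measure_isSigmaFinite.Build _ R R lebesgue_R
  lebesgue_R_sigma_finite.

End lebesgue_R.

Section cons_rV.
Context {R : realType} {n : nat}.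
Local Open Scope ereal_scope.

Definition cons_rV (p : R * 'rV[R]_n) : 'rV[R]_n.+1 :=
  (\row_i oapp (fun j => p.2 0 j) p.1 (unlift ord0 i))%R.

Lemma measurable_cons_rV : measurable_fun [set: R * 'rV[R]_n] cons_rV.
Proof.
apply: measurable_fun_rV => i.
case: (unliftP ord0 i) => [j|] ->.
- rewrite (_ : (fun x => _) = (fun v : 'rV[R]_n => v 0 j)%R \o snd).
    by apply: measurableT_comp; [exact: measurable_coord_rV|exact: measurable_snd].
  by apply/funext => x; rewrite mxE liftK.
- rewrite (_ : (fun x => _) = fst); first exact: measurable_fst.
  by apply/funext => x; rewrite mxE unlift_none.
Qed.

Variable m : {sigma_finite_measure set 'rV[R]_n -> \bar R}.

(* The product of the Lebesgue measure with [m], carried over to R^(n+1). *)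
Definition cons_measure : set 'rV[R]_n.+1 -> \bar R :=
  pushforward (lebesgue_R \x m) cons_rV.

Let cons_measure0 : cons_measure set0 = 0.
Proof. by rewrite /cons_measure /pushforward preimage_set0; exact: (measure0 (lebesgue_R \x m)). Qed.

Let cons_measure_ge0 A : 0 <= cons_measure A.
Proof. exact: (measure_ge0 (lebesgue_R \x m)). Qed.

Let cons_measure_sigma_additive : semi_sigma_additive cons_measure.
Proof.
move=> F mF tF mUF; rewrite /cons_measure /pushforward preimage_bigcup.
have mcons A : measurable A -> measurable (cons_rV @^-1` A).
  by move=> mA; rewrite -[X in measurable X]setTI; exact: measurable_cons_rV.
apply: (@measure_semi_sigma_additive _ _ _ (lebesgue_R \x m)).
- by move=> k; exact: mcons.
- apply/trivIsetP => /= i j _ _ ij; rewrite -preimage_setI.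
  by move/trivIsetP : tF => /(_ _ _ _ _ ij) ->//; rewrite preimage_set0.
- by rewrite -preimage_bigcup; exact: mcons.
Qed.

HB.instance Definition _ := isMeasure.Build _ _ _ cons_measure
  cons_measure0 cons_measure_ge0 cons_measure_sigma_additive.

Let cons_measure_sigma_finite : sigma_finite setT cons_measure.
Proof.
have [F TF mF] := sigma_finite_product (@lebesgue_R R) m.
pose tl (v : 'rV[R]_n.+1) : R * 'rV[R]_n :=
  (v 0 ord0, \row_j v 0 (lift ord0 j))%R.
have mtl : measurable_fun setT tl.
  apply: measurable_fun_pair; first exact: measurable_coord_rV.
  apply: measurable_fun_rV => j.
  rewrite (_ : (fun x => _) = (fun v : 'rV[R]_n.+1 => v 0 (lift ord0 j)))%R.
    exact: measurable_coord_rV.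
  by apply/funext => x; rewrite mxE.
have tlK p : tl (cons_rV p) = p.
  case: p => x v; rewrite /tl /cons_rV mxE unlift_none /=; congr pair.
  by apply/rowP => j; rewrite !mxE liftK.
exists (fun k => tl @^-1` F k).
  by rewrite -preimage_bigcup -TF preimage_setT.
move=> k; have [mFk Fkoo] := mF k; split.
  by rewrite -[X in measurable X]setTI; exact: mtl.
rewrite /cons_measure /pushforward -comp_preimage (_ : tl \o _ = id).
  by rewrite preimage_id.
by apply/funext => p; exact: tlK.
Qed.

HB.instance Definition _ := Measure_isSigmaFinite.Build _ _ _ cons_measure
  cons_measure_sigma_finite.

End cons_rV.

Section lebesgue_rV.
Context {R : realType}.

Fixpoint lebesgue_rV (n : nat) : {sigma_finite_measure set 'rV[R]_n -> \bar R} :=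
  if n is n'.+1 then cons_measure (lebesgue_rV n') else \d_(0 : 'rV[R]_0).

End lebesgue_rV.

(* In the sequel n = d - 1, where d is the dimension of hyperbolic space; a point
   (v, y) of the upper halfspace is a pair in ['rV[R]_n * R]. The norm of
   ['rV[R]_n] in the library is the sup norm, hence the explicit Euclidean
   square norm below. *)
Section hyperbolic_space.
Context {R : realType}.

Definition sqnorm2 n (v : 'rV[R]_n) : R := \sum_(i < n) v 0 i ^+ 2.

Definition halfspace {n} : set ('rV[R]_n * R) := [set p | 0 < p.2].

Definition arcosh (x : R) : R := ln (x + Num.sqrt (x ^+ 2 - 1)).

Definition hyp_dist n (p q : 'rV[R]_n * R) : R :=
  arcosh (1 + (sqnorm2 (p.1 - q.1) + (p.2 - q.2) ^+ 2) / (2 * p.2 * q.2)).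

Definition hyp_vol n (A : set ('rV[R]_n * R)) : \bar R :=
  (\int[lebesgue_rV n \x lebesgue_R]_(p in A `&` halfspace)
     (p.2 ^- n.+1)%:E)%E.

(* c restricted to [0, L] is a unit-speed geodesic segment. *)
Definition is_geodesic n (L : R) (c : R -> 'rV[R]_n * R) : Prop :=
  {in `[0, L] &, forall s t : R,
    [/\ halfspace (c s), halfspace (c t) & hyp_dist (c s) (c t) = `|s - t|]}.

Definition geodesically_convex n (C : set ('rV[R]_n * R)) : Prop :=
  C `<=` halfspace /\
  forall (L : R) (c : R -> 'rV[R]_n * R), 0 <= L -> is_geodesic L c ->
    C (c 0) -> C (c L) -> {in `[0, L], forall t : R, C (c t)}.

Definition geodesic_hull n (A : set ('rV[R]_n * R)) :
    set ('rV[R]_n * R) :=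
  smallest (@geodesically_convex n) A.

Definition horoball {n} (lambda : R) : set ('rV[R]_n * R) :=
  [set p | lambda <= p.2].

Definition cylinder n (lambda : R) (W : set 'rV[R]_n) :
    set ('rV[R]_n * R) :=
  W `*` `[lambda, +oo[.

End hyperbolic_space.

Section tessellation.
Context {R : realType}.

Definition affinely_independent m n (v : 'I_m -> 'rV[R]_n) : Prop :=
  forall a : 'I_m -> R, \sum_i a i = 0 -> \sum_i a i *: v i = 0 ->
    forall i, a i = 0.

Definition convex_hull n (A : set 'rV[R]_n) : set 'rV[R]_n :=
  smallest (@convex_set R 'rV[R]_n) A.

(* For a simplex, the extreme points are the vertices. *)
Definition extreme_point n (S : set 'rV[R]_n) (v : 'rV[R]_n) : Prop :=
  S v /\ forall (a b : 'rV[R]_n) (t : R), S a -> S b -> 0 < t < 1 ->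
    v = t *: a + (1 - t) *: b -> a = b.

(* X plays the role of eta_(gamma, lambda). The centre w and radius r are
   unique, because the d = n + 1 points x i have affinely independent projections to
   R^n. *)
Definition tessellation n (X : set ('rV[R]_n * R)) : set (set 'rV[R]_n) :=
  [set S | exists x : 'I_n.+1 -> 'rV[R]_n * R,
    [/\ injective x,
        (forall i, X (x i)),
        affinely_independent (fun i => (x i).1),
        (exists (w : 'rV[R]_n) (r : R),
          [/\ 0 < r,
              (forall i, sqnorm2 ((x i).1 - w) + (x i).2 ^+ 2 = r ^+ 2) &
              (forall p, X p -> ~ (sqnorm2 (p.1 - w) + p.2 ^+ 2 < r ^+ 2))]) &
        S = convex_hull (range (fun i => (x i).1))]].

Definition vertices n (D : set (set 'rV[R]_n)) : set 'rV[R]_n :=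
  [set v | exists2 S, D S & extreme_point S v].

End tessellation.

Section point_process.
Context {R : realType} {disp : measure_display} {Omega : measurableType disp}.
Variable P : probability Omega R.

(* A Poisson process with a diffuse intensity measure has no multiple points,
   so it is given by the random set of its points. *)
Definition poisson_process disp' (T : measurableType disp')
    (mu : set T -> \bar R) (eta : Omega -> set T) : Prop :=
  let N (B : set T) (omega : Omega) : \bar R := counting (eta omega `&` B) in
  [/\ (forall B, measurable B -> measurable_fun setT (N B)),
      (forall B, measurable B -> (mu B < +oo)%E -> forall k : nat,
        P [set omega | N B omega = k%:R%:E] =
        (fine (mu B) ^+ k / k`!%:R * expR (- fine (mu B)))%:E),
      (forall B, measurable B -> mu B = +oo%E ->
        P [set omega | N B omega = +oo%E] = 1%E) &
      (forall (m : nat) (B : 'I_m -> set T) (A : 'I_m -> set \bar R),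
        (forall i, measurable (B i)) -> trivIset setT B ->
        (forall i, measurable (A i)) ->
        P (\bigcap_i (N (B i) @^-1` A i)) =
        (\prod_(i < m) P (N (B i) @^-1` A i))%E)].

Definition hyp_poisson_process n (gamma : R)
    (eta : Omega -> set ('rV[R]_n * R)) : Prop :=
  [/\ (forall omega, eta omega `<=` halfspace),
      (forall omega K, compact K -> K `<=` halfspace ->
        finite_set (eta omega `&` K)) &
      poisson_process (fun B => (gamma%:E * hyp_vol B)%E) eta].

Variables (n : nat) (eta : Omega -> set ('rV[R]_n * R)).

(* xi_0(gamma, lambda), computed in the window W. *)
Definition vertex_intensity (lambda : R) (W : set 'rV[R]_n) : \bar R :=
  ((\int[P]_omega
      counting (vertices (tessellation (eta omega `&` horoball lambda)) `&` W))
   / lebesgue_rV n W)%E.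

Definition hull_volume_fraction (lambda : R) (W : set 'rV[R]_n)
    (omega : Omega) : R :=
  fine (hyp_vol (geodesic_hull (eta omega `&` horoball lambda)
                 `&` cylinder lambda W))
  / fine (hyp_vol (cylinder lambda W)).

Definition mean_hull_volume_fraction (lambda : R) (W : set 'rV[R]_n) :
    \bar R :=
  'E_P[hull_volume_fraction lambda W]%E.

End point_process.

(* Main.v *)
Require Import Defs.
From HB Require Import structures.
From mathcomp Require Import all_boot all_order all_algebra.
From mathcomp Require Import all_classical all_reals all_analysis.
From mathcomp Require Import measurable_realfun.
From mathcomp Require Import ring lra.

Set Implicit Arguments.
Unset Strict Implicit.
Unset Printing Implicit Defensive.

Import Order.TTheory GRing.Theory Num.Theory.
Import numFieldNormedType.Exports.

Local Open Scope classical_set_scope.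
Local Open Scope ring_scope.

(** Let n = d - 1. A half-ball is a set of points (v, y) with
    |v - w|^2 + y^2 < s. Call x exposed if some half-ball contains x and no
    point of the process at height lambda or above. The idea is that one
    probability p(x), that x is exposed, computes both sides of the theorem.

    Hull. The complement of a half-ball is geodesically convex, hence exposed
    points are not in the hull K ([covered_notin_hull]). Conversely almost surely
    the process has points far out in every orthant of R^n; then in the
    coordinates (v, |v|^2 + y^2), in which geodesic segments are straight and
    hemispheres are hyperplanes, a point x = (v, y) outside K is separated from K
    by a hyperplane that is not vertical, so it lies on the hemisphere of a
    half-ball without points in its interior ([on_empty_ball_notin_hull]), and
    (v, rho y) is exposed for all rho < 1. By Fubini
    ([mean_volume_random_set]), the mean volume of the part of the cylinder C
    over W that K leaves out is the integral of p over C, up to this vertical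
    scaling.

    Vertices. A vertex of the tessellation is the projection of a point x of the
    process that lies on an empty half-ball
    ([tessellation_vertex_on_empty_ball]). Conversely, if x is such a point, then
    the centres of the empty half-balls through x form a polytope, and a centre
    of maximal norm gives a hemisphere through n further points in general
    position, so that x projects to a vertex ([exposed_tessellation_vertex]). By
    the Mecke formula ([mecke]) the mean number of these points over W is gamma
    times the integral of p over C, again up to a vertical scaling.

    Both integrals are the same number: as the law of the process is invariant
    under the isometries (v, y) -> (a v + b, a y), p(v, y) depends on y / lambda
    only ([prob_exposedE]), and the integral of p over C is
    vol(W) lambda^-n c for a constant c ([integral_prob_exposed]). The volume of C
    is vol(W) lambda^-n / n. Hence xi_0 = gamma lambda^-n c and E V = 1 - n c.

    The scaling by rho changes the integrals by O(1 - rho^n), and rho -> 1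
    removes it. The counts of vertices and the volumes of hulls are never shown
    to be measurable: the integral of a nonnegative function is a supremum over
    the simple functions below it, hence monotone
    ([ge0_le_integral_nonmeasurable]), and both quantities lie between measurable
    ones whose means have the same limit. *)

(** * The hyperboloid model *)

Section inner_product.
Context {R : realType} {n : nat}.
Implicit Types u v w : 'rV[R]_n.

Definition dot u v : R := \sum_(i < n) u 0 i * v 0 i.

Lemma dotC u v : dot u v = dot v u.
Proof. by apply: eq_bigr => i _; rewrite mulrC. Qed.

Lemma dotDl u v w : dot (u + v) w = dot u w + dot v w.
Proof.
by rewrite /dot -big_split/=; apply: eq_bigr => i _; rewrite mxE mulrDl.
Qed.

Lemma dotZl a u v : dot (a *: u) v = a * dot u v.
Proof. by rewrite /dot mulr_sumr; apply: eq_bigr => i _; rewrite mxE mulrA. Qed.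

Lemma dotNl u v : dot (- u) v = - dot u v.
Proof. by rewrite -scaleN1r dotZl mulN1r. Qed.

Lemma dotDr u v w : dot u (v + w) = dot u v + dot u w.
Proof. by rewrite dotC dotDl !(dotC u). Qed.

Lemma dotZr a u v : dot u (a *: v) = a * dot u v.
Proof. by rewrite dotC dotZl dotC. Qed.

Lemma dotNr u v : dot u (- v) = - dot u v.
Proof. by rewrite dotC dotNl dotC. Qed.

Definition dotE := (dotDl, dotDr, dotNl, dotNr, dotZl, dotZr).

Lemma dot0l v : dot 0 v = 0.
Proof. by rewrite /dot big1// => i _; rewrite mxE mul0r. Qed.

Lemma dot_suml (I : Type) (r : seq I) (F : I -> 'rV[R]_n) v :
  dot (\sum_(i <- r) F i) v = \sum_(i <- r) dot (F i) v.
Proof.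
elim/big_rec2 : _ => [|i x y _ <-]; first by rewrite dot0l.
by rewrite dotDl.
Qed.

Lemma sqnorm2E v : sqnorm2 v = dot v v.
Proof. by apply: eq_bigr => i _; rewrite expr2. Qed.

Lemma sqnorm2_ge0 v : 0 <= sqnorm2 v.
Proof. by apply: sumr_ge0 => i _; exact: sqr_ge0. Qed.

Lemma sqnorm2_eq0 v : sqnorm2 v = 0 -> v = 0.
Proof.
move=> /eqP; rewrite psumr_eq0; last by move=> i _; exact: sqr_ge0.
move=> /allP v0; apply/rowP => i; rewrite mxE.
by have /implyP/(_ isT) := v0 i (mem_index_enum _); rewrite sqrf_eq0 => /eqP.
Qed.

(** Young's inequality; the weight a is free so that the error of moving the
    centre of a half-ball can be made relatively small. *)
Lemma dot_Young u v (a : R) : 0 < a ->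
  `|2 * dot u v| <= a * sqnorm2 u + a^-1 * sqnorm2 v.
Proof.
move=> a0; have := sqnorm2_ge0 (a *: u - v); have := sqnorm2_ge0 (a *: u + v).
rewrite !sqnorm2E !dotE (dotC v u) => h1 h2.
rewrite -(ler_pM2l a0) mulrDr !mulrA divff ?gt_eqF// mul1r.
by rewrite -[X in X * `|_|]gtr0_norm// -normrM ler_norml; apply/andP; split; lra.
Qed.

End inner_product.

Section hyperboloid.
Context {R : realType} {n : nat}.
Local Notation point := ('rV[R]_n * R)%type.
Implicit Types (p q r : point) (w : 'rV[R]_n).

Definition height p : R := sqnorm2 p.1 + p.2 ^+ 2.

Definition sqdist w p : R := sqnorm2 (p.1 - w) + p.2 ^+ 2.

Lemma sqdistE w p : sqdist w p = height p - 2 * dot w p.1 + sqnorm2 w.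
Proof. by rewrite /sqdist /height !sqnorm2E !dotE (dotC p.1 w); ring. Qed.

Lemma sqdist_ge0 w p : 0 <= sqdist w p.
Proof. by rewrite addr_ge0 ?sqnorm2_ge0 ?sqr_ge0. Qed.

(** The Minkowski form on R^(n+2), in the light-cone coordinates (V, H, Z) in
    which the hyperboloid model is the image of the upper halfspace under
    [minkowski]. *)
Definition minkowski_form (P Q : 'rV[R]_n * R * R) : R :=
  (P.1.2 * Q.2 + P.2 * Q.1.2) / 2 - dot P.1.1 Q.1.1.

Definition minkowski p : 'rV[R]_n * R * R :=
  (p.2^-1 *: p.1, p.2^-1 * height p, p.2^-1).

Definition comb (a b : R) (P Q : 'rV[R]_n * R * R) : 'rV[R]_n * R * R :=
  (a *: P.1.1 + b *: Q.1.1, a * P.1.2 + b * Q.1.2, a * P.2 + b * Q.2).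

Lemma minkowski_formC P Q : minkowski_form P Q = minkowski_form Q P.
Proof. by rewrite /minkowski_form dotC; congr (_ / _ - _); ring. Qed.

Lemma minkowski_form_combl a b P Q T : minkowski_form (comb a b P Q) T =
  a * minkowski_form P T + b * minkowski_form Q T.
Proof.
case: P Q T => [[P1 P2] P3] [[Q1 Q2] Q3] [[T1 T2] T3].
by rewrite /minkowski_form /comb/= !dotE; field.
Qed.

Lemma minkowski_form_combr a b P Q T : minkowski_form T (comb a b P Q) =
  a * minkowski_form T P + b * minkowski_form T Q.
Proof. by rewrite !(minkowski_formC T) minkowski_form_combl. Qed.

Lemma minkowski_form_self p : halfspace p ->
  minkowski_form (minkowski p) (minkowski p) = 1.
Proof.
rewrite /halfspace/= => p0; rewrite /minkowski_form /minkowski/= /height.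
by rewrite !dotE sqnorm2E; field; rewrite gt_eqF.
Qed.

(** On the orthogonal complement of a timelike vector the form is negative
    definite. *)
Lemma minkowski_form_definite p T : halfspace p ->
  minkowski_form T (minkowski p) = 0 -> minkowski_form T T = 0 -> T = (0, 0, 0).
Proof.
case: T => -[V H] Z; rewrite /halfspace/= => p0.
rewrite /minkowski_form /minkowski/= !dotE /height => orth null.
have HE : H = 2 * dot V p.1 - (sqnorm2 p.1 + p.2 ^+ 2) * Z.
  move: orth; set h := sqnorm2 _ + _; rewrite (_ : _ - _ =
    p.2^-1 / 2 * (H + Z * h - 2 * dot V p.1)); last by field; rewrite gt_eqF.
  by move/eqP; rewrite mulf_eq0 gt_eqF ?divr_gt0 ?invr_gt0//= => /eqP; lra.
have sum0 : sqnorm2 (V - Z *: p.1) + (p.2 * Z) ^+ 2 = 0.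
  move: null; rewrite HE !sqnorm2E !dotE (dotC p.1 V) => null.
  by rewrite -[RHS]oppr0 -null; field.
have [] : sqnorm2 (V - Z *: p.1) = 0 /\ (p.2 * Z) ^+ 2 = 0.
  have := sqnorm2_ge0 (V - Z *: p.1); have := sqr_ge0 (p.2 * Z).
  by move: sum0; set A := sqnorm2 _; set B := _ ^+ 2 => ? ? ?; split; lra.
move=> /sqnorm2_eq0 V0 /eqP; rewrite sqrf_eq0 mulf_eq0 gt_eqF//= => /eqP Z0.
move: V0; rewrite Z0 scale0r subr0 => V0.
by rewrite HE Z0 V0 dot0l !mulr0 subr0.
Qed.

Lemma hyp_dist_minkowski p q : halfspace p -> halfspace q ->
  hyp_dist p q = arcosh (minkowski_form (minkowski p) (minkowski q)).
Proof.
rewrite /halfspace/= => p0 q0; rewrite /hyp_dist; congr arcosh.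
rewrite /minkowski_form /minkowski/= /height !dotE !sqnorm2E !dotE (dotC q.1).
by field; rewrite !gt_eqF.
Qed.

(** The reversed Cauchy-Schwarz inequality, with its case of equality. *)
Lemma minkowski_form_ge1 p q : halfspace p -> halfspace q ->
  1 <= minkowski_form (minkowski p) (minkowski q) ?= iff (p == q).
Proof.
rewrite /halfspace/= => p0 q0.
have -> : minkowski_form (minkowski p) (minkowski q) =
  1 + (sqnorm2 (p.1 - q.1) + (p.2 - q.2) ^+ 2) / (2 * p.2 * q.2).
  rewrite /minkowski_form /minkowski/= /height !dotE !sqnorm2E !dotE (dotC q.1).
  by field; rewrite !gt_eqF.
have c0 : 0 < 2 * p.2 * q.2 by rewrite !mulr_gt0.
split; first by rewrite lerDl divr_ge0 ?(ltW c0)// addr_ge0 ?sqnorm2_ge0 ?sqr_ge0.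
apply/idP/idP => [|/eqP ->]; last first.
  by rewrite !subrr sqnorm2E dot0l expr0n addr0 mul0r addr0.
rewrite -subr_eq0 opprD addrA subrr add0r oppr_eq0 mulf_eq0 invr_eq0 (gt_eqF c0) orbF.
rewrite paddr_eq0 ?sqnorm2_ge0 ?sqr_ge0// sqrf_eq0 subr_eq0 => /andP[/eqP h1 h2].
apply/eqP; rewrite [p]surjective_pairing [q]surjective_pairing (eqP h2).
by congr pair; apply/eqP; rewrite -subr_eq0; apply/eqP/sqnorm2_eq0.
Qed.

(** Up to the positive factor p.2^-1, the power of p with respect to a
    half-ball is a linear form on the hyperboloid: totally geodesic
    hypersurfaces are hyperplane sections. *)
Lemma minkowski_sqdist w (s : R) p : halfspace p ->
  (minkowski p).1.2 - 2 * dot w (minkowski p).1.1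
    + (sqnorm2 w - s) * (minkowski p).2 = p.2^-1 * (sqdist w p - s).
Proof.
move=> _; rewrite sqdistE /minkowski/= /height !dotE; ring.
Qed.

(** The linear form of [minkowski_sqdist] is nonnegative at p and q, hence at
    their nonnegative combinations. *)
Lemma minkowski_comb_sqdist a b w (s : R) p q r :
  halfspace p -> halfspace q -> halfspace r -> 0 <= a -> 0 <= b ->
  minkowski r = comb a b (minkowski p) (minkowski q) ->
  s <= sqdist w p -> s <= sqdist w q -> s <= sqdist w r.
Proof.
move=> hp hq hr a0 b0 rE sp sq; rewrite -subr_ge0.
have r0 : 0 < r.2^-1 by rewrite invr_gt0.
pose f (T : 'rV[R]_n * R * R) :=
  T.1.2 - 2 * dot w T.1.1 + (sqnorm2 w - s) * T.2.
have fcomb P Q : f (comb a b P Q) = a * f P + b * f Q.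
  by rewrite /f /comb/= !dotE; ring.
rewrite -(pmulr_rge0 _ r0) -minkowski_sqdist// rE -/(f _) fcomb /f.
rewrite !minkowski_sqdist//.
by rewrite addr_ge0// !mulr_ge0// ?subr_ge0// invr_ge0 ltW.
Qed.

(** Inverse of [minkowski] on the hyperboloid. *)
Lemma minkowski_surj T : 0 < T.2 -> minkowski_form T T = 1 ->
  minkowski (T.2^-1 *: T.1.1, T.2^-1) = T /\
  halfspace (T.2^-1 *: T.1.1, T.2^-1).
Proof.
case: T => -[V H] Z /= Z0 T1; split; last by rewrite /halfspace/= invr_gt0.
rewrite /minkowski/= invrK scalerA divff ?gt_eqF// scale1r; congr (_, _, _).
rewrite /height/= sqnorm2E !dotE; move: T1; rewrite /minkowski_form/= => T1.
have -> : H = (1 + dot V V) / Z by rewrite -T1; field; rewrite gt_eqF.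
by field; rewrite gt_eqF.
Qed.

Lemma minkowski_inj p q : halfspace p -> halfspace q ->
  minkowski p = minkowski q -> p = q.
Proof.
rewrite /halfspace/= => p0 q0 -[] h1 _ /invr_inj h3.
rewrite [p]surjective_pairing [q]surjective_pairing h3; congr pair.
by move: h1; rewrite h3; apply: scalerI; rewrite invr_neq0// gt_eqF.
Qed.

End hyperboloid.

Section hyperbolic_functions.
Context {R : realType}.
Implicit Types s t x : R.

Definition cosh t : R := (expR t + expR (- t)) / 2.
Definition sinh t : R := (expR t - expR (- t)) / 2.

Lemma arcoshK x : 1 <= x -> cosh (arcosh x) = x.
Proof.
move=> x1; rewrite /cosh expRN /arcosh.
have x21 : 0 <= x ^+ 2 - 1 by rewrite subr_ge0 expr_ge1 ?(le_trans ler01).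
have := sqr_sqrtr x21; have := sqrtr_ge0 (x ^+ 2 - 1).
set y := Num.sqrt _ => y0 yE.
have xy : 0 < x + y by lra.
rewrite lnK ?posrE//.
have -> : (x + y)^-1 = x - y.
  apply: (mulfI (lt0r_neq0 xy)); rewrite divff ?gt_eqF//.
  by rewrite [RHS]mulrC -subr_sqr yE; ring.
by field.
Qed.

Lemma arcosh_ge0 x : 1 <= x -> 0 <= arcosh x.
Proof.
by move=> x1; rewrite /arcosh ln_ge0// (le_trans x1)// lerDl sqrtr_ge0.
Qed.

Lemma cosh_sqr t : cosh t ^+ 2 = 1 + sinh t ^+ 2.
Proof. by rewrite /cosh /sinh expRN; field; rewrite gt_eqF// expR_gt0. Qed.

Lemma coshN t : cosh (- t) = cosh t.
Proof. by rewrite /cosh opprK addrC. Qed.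

Lemma coshD s t : cosh (s + t) = cosh s * cosh t + sinh s * sinh t.
Proof.
rewrite /cosh /sinh !expRN expRD; field.
by rewrite !gt_eqF// expR_gt0.
Qed.

Lemma sinhD s t : sinh (s + t) = sinh s * cosh t + cosh s * sinh t.
Proof.
rewrite /cosh /sinh !expRN expRD; field.
by rewrite !gt_eqF// expR_gt0.
Qed.

Lemma sinhN t : sinh (- t) = - sinh t.
Proof. by rewrite /sinh opprK; field. Qed.

Lemma sinh_gt0 t : 0 < t -> 0 < sinh t.
Proof.
by move=> t0; rewrite /sinh divr_gt0// subr_gt0 ltr_expR; lra.
Qed.

Lemma sinh_ge0 t : 0 <= t -> 0 <= sinh t.
Proof.
by move=> t0; rewrite /sinh divr_ge0// subr_ge0 ler_expR; lra.
Qed.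

Lemma coshK t : 0 <= t -> arcosh (cosh t) = t.
Proof.
move=> t0; rewrite /arcosh cosh_sqr addrAC subrr add0r sqrtr_sqr.
rewrite ger0_norm ?sinh_ge0//.
by rewrite (_ : _ + _ = expR t) ?expRK// /cosh /sinh; field.
Qed.

End hyperbolic_functions.

(** * Geodesics and the convex hull *)

Section geodesics.
Context {R : realType} {n : nat}.
Local Notation point := ('rV[R]_n * R)%type.
Implicit Types (p q r : point) (w : 'rV[R]_n).

(** Equality in the triangle inequality: if r lies at distances t1 and t2 from
    p and q, where t1 + t2 is the distance of p and q, then the vector r - a p -
    b q of the Minkowski space, with the coefficients a, b of the geodesic, is
    orthogonal to p and isotropic, hence zero. *)
Lemma minkowski_between p q r (t1 t2 : R) :
  halfspace p -> halfspace q -> halfspace r ->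
  0 <= t1 -> 0 <= t2 -> 0 < t1 + t2 ->
  hyp_dist p r = t1 -> hyp_dist r q = t2 -> hyp_dist p q = t1 + t2 ->
  minkowski r = comb (sinh t2 / sinh (t1 + t2)) (sinh t1 / sinh (t1 + t2))
                  (minkowski p) (minkowski q).
Proof.
move=> hp hq hr t10 t20 t12.
rewrite !hyp_dist_minkowski// => /(congr1 cosh) + /(congr1 cosh) + /(congr1 cosh).
rewrite !arcoshK ?minkowski_form_ge1//.
set P := minkowski p; set Q := minkowski q; set T := minkowski r => pr rq pq.
have S0 : sinh (t1 + t2) != 0 by rewrite gt_eqF// sinh_gt0.
set a := sinh t2 / _; set b := sinh t1 / _.
pose D := comb 1 (-1) T (comb a b P Q).
have PP : minkowski_form P P = 1 by exact: minkowski_form_self.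
have QQ : minkowski_form Q Q = 1 by exact: minkowski_form_self.
have TT : minkowski_form T T = 1 by exact: minkowski_form_self.
have DP : minkowski_form D P = 0.
  rewrite !minkowski_form_combl PP (minkowski_formC T) (minkowski_formC Q) pr pq.
  apply: (mulIf S0); rewrite mul0r /a /b.
  rewrite [LHS](_ : _ = cosh t1 * sinh (t1 + t2) - sinh t2
    - sinh t1 * cosh (t1 + t2)); last by field.
  by rewrite coshD sinhD; ring: (cosh_sqr t1).
have DT : minkowski_form D T = 0.
  rewrite !minkowski_form_combl TT (minkowski_formC Q) pr rq.
  apply: (mulIf S0); rewrite mul0r /a /b.
  rewrite [LHS](_ : _ = sinh (t1 + t2) - sinh t2 * cosh t1
    - sinh t1 * cosh t2); last by field.
  by rewrite sinhD; ring.
have DQ : minkowski_form D Q = 0.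
  rewrite !minkowski_form_combl QQ rq pq.
  apply: (mulIf S0); rewrite mul0r /a /b.
  rewrite [LHS](_ : _ = cosh t2 * sinh (t1 + t2) - sinh t1
    - sinh t2 * cosh (t1 + t2)); last by field.
  by rewrite coshD sinhD; ring: (cosh_sqr t2).
have DD : minkowski_form D D = 0.
  by rewrite {2}/D !minkowski_form_combr DP DT DQ; ring.
have := minkowski_form_definite hp DP DD.
rewrite /D /comb /= => -[]; rewrite !scale1r !mul1r !scaleN1r !mulN1r => e1 e2 e3.
by rewrite /T /minkowski (subr0_eq e1) (subr0_eq e2) (subr0_eq e3).
Qed.

(** By [minkowski_between] every point of a geodesic segment is a nonnegative
    combination of the ends, to which [minkowski_comb_sqdist] applies. *)
Lemma geodesically_convex_sqdist_ge w (s : R) :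
  geodesically_convex [set p | halfspace p /\ s <= sqdist w p].
Proof.
split=> [p []//|L c L0 geo [h0 s0] [hL sL] t tL].
have [L00|L_gt0] := eqVneq L 0.
  have -> : t = 0 by move: tL; rewrite L00 in_itv/= => /le_anti.
  by [].
have I0 : 0 \in `[0, L] by rewrite in_itv/= lexx L0.
have IL : L \in `[0, L] by rewrite in_itv/= lexx L0.
have /andP[t0 tleL] : 0 <= t <= L by move: tL; rewrite in_itv.
have [_ ht d0t] := geo _ _ I0 tL.
have [_ _ dtL] := geo _ _ tL IL.
have [_ _ d0L] := geo _ _ I0 IL.
split=> //.
have Lpos : 0 < L by rewrite lt_neqAle eq_sym L_gt0.
rewrite sub0r normrN ger0_norm// in d0t.
rewrite distrC ger0_norm ?subr_ge0// in dtL.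
rewrite sub0r normrN ger0_norm// in d0L.
have sL0 : 0 < sinh (t + (L - t)) by rewrite sinh_gt0// addrC subrK.
apply: (minkowski_comb_sqdist h0 hL ht _ _ _ s0 sL); last first.
  apply: (@minkowski_between _ _ _ t (L - t)) => //; rewrite ?subr_ge0//.
    by rewrite addrC subrK.
  by rewrite d0L addrC subrK.
all: by rewrite divr_ge0 ?(ltW sL0)// sinh_ge0// subr_ge0.
Qed.

Lemma geodesically_convex_geodesic_hull (A : set point) : A `<=` halfspace ->
  geodesically_convex (geodesic_hull A).
Proof.
move=> Ah; split.
  move=> p; apply; split=> //; split=> // L c L0 geo _ _ t tL.
  by have [] := geo _ _ tL tL.
move=> L c L0 geo K0 KL t tL C [Cc AC].
by apply: Cc.2 geo _ _ _ tL => //; [exact: K0|exact: KL].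
Qed.

(** The complement of the half-ball is geodesically convex and contains X. *)
Lemma geodesic_hull_empty_ball (X : set point) w (s : R) : X `<=` halfspace ->
  (forall p, X p -> s <= sqdist w p) ->
  forall x, geodesic_hull X x -> s <= sqdist w x.
Proof.
move=> Xh Xs x Kx.
have [] := Kx [set p | halfspace p /\ s <= sqdist w p]; last by [].
split; first exact: geodesically_convex_sqdist_ge.
by move=> p Xp; split; [exact: Xh|exact: Xs].
Qed.

Lemma minkowski_form_comb2 p q (a b a' b' : R) : halfspace p -> halfspace q ->
  minkowski_form (comb a b (minkowski p) (minkowski q))
                 (comb a' b' (minkowski p) (minkowski q)) =
  a * a' + b * b' +
    (a * b' + b * a') * minkowski_form (minkowski p) (minkowski q).
Proof.
move=> hp hq; rewrite minkowski_form_combl !minkowski_form_combr.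
rewrite !minkowski_form_self// (minkowski_formC (minkowski q)); ring.
Qed.

(** Every point whose Minkowski vector is a nonnegative combination of those of
    p and q is on the geodesic from p to q, parametrized by
    (sinh (L - t) p + sinh t q) / sinh L. *)
Lemma geodesic_through p q r (a b : R) : halfspace p -> halfspace q ->
  halfspace r -> p != q -> 0 <= a -> 0 <= b ->
  minkowski r = comb a b (minkowski p) (minkowski q) ->
  exists L c t, [/\ 0 <= L, is_geodesic L c, c 0 = p, c L = q &
    t \in `[0, L] /\ c t = r].
Proof.
move=> hp hq hr pq a0 b0 rE.
set P := minkowski p in rE *; set Q := minkowski q in rE *.
pose z := minkowski_form P Q.
have z1 : 1 < z.
  have h := minkowski_form_ge1 hp hq.
  by rewrite lt_neqAle /z h.1 h.2 pq.
pose L := arcosh z; have zE : z = cosh L by rewrite arcoshK// ltW.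
have L0 : 0 < L.
  rewrite lt_neqAle arcosh_ge0 ?(ltW z1)// andbT eq_sym.
  apply/eqP => L00; move: z1; rewrite zE L00 /cosh oppr0 expR0.
  by rewrite (_ : (1 + 1) / 2 = 1) ?ltxx//; field.
have S0 := sinh_gt0 L0.
pose T t := comb (sinh (L - t) / sinh L) (sinh t / sinh L) P Q.
have TT s t : minkowski_form (T s) (T t) = cosh (s - t).
  rewrite minkowski_form_comb2// -/z zE !(sinhD, coshD, sinhN, coshN).
  by field: (cosh_sqr L); rewrite gt_eqF.
have T_gt0 t : t \in `[0, L] -> 0 < (T t).2.
  rewrite in_itv/= => /andP[t0 tL]; rewrite /T /comb/=.
  have [->|tnL] := eqVneq t L.
    rewrite subrr /sinh oppr0 subrr !mul0r add0r -/(sinh L) divff ?gt_eqF// mul1r.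
    by rewrite invr_gt0.
  apply: ltr_wpDr.
    by rewrite mulr_ge0// ?invr_ge0 ?(ltW hq)// divr_ge0 ?(ltW S0)// sinh_ge0.
  rewrite mulr_gt0// ?invr_gt0// divr_gt0// sinh_gt0// subr_gt0.
  by rewrite lt_neqAle tnL.
pose c t : point := ((T t).2^-1 *: (T t).1.1, (T t).2^-1).
have cE t : t \in `[0, L] -> minkowski (c t) = T t /\ halfspace (c t).
  move=> tL; apply: minkowski_surj; first exact: T_gt0.
  by rewrite TT subrr /cosh oppr0 expR0; field.
have I0 : 0 \in `[0, L] by rewrite in_itv/= lexx ltW.
have IL : L \in `[0, L] by rewrite in_itv/= lexx ltW.
have T0 : T 0 = P.
  rewrite /T subr0 /sinh oppr0 subrr !mul0r -/(sinh L) divff ?gt_eqF//.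
  rewrite /comb !scale0r !scale1r !mul0r !mul1r !addr0.
  by rewrite [P]surjective_pairing [P.1]surjective_pairing.
have TL : T L = Q.
  rewrite /T subrr /sinh oppr0 subrr !mul0r -/(sinh L) divff ?gt_eqF//.
  rewrite /comb !scale0r !scale1r !mul0r !mul1r !add0r.
  by rewrite [Q]surjective_pairing [Q.1]surjective_pairing.
have rr : a ^+ 2 + b ^+ 2 + 2 * a * b * z = 1.
  have := minkowski_form_self hr; rewrite rE minkowski_form_comb2// => h.
  by rewrite -[RHS]h -/z; ring.
have x1 : 1 <= a + b * z.
  rewrite -(@expr_ge1 _ 2%N)//; last first.
    by rewrite addr_ge0// mulr_ge0// ltW// (lt_trans ltr01).
  rewrite -[X in X <= _]rr -subr_ge0 [X in 0 <= X](_ : _ = b ^+ 2 * (z ^+ 2 - 1)); last by ring.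
  by rewrite mulr_ge0 ?sqr_ge0// subr_ge0 expr_ge1 ?ltW// (lt_trans ltr01).
(* The time t at which the geodesic passes through r has cosh t = <p, r>. *)
pose t := arcosh (a + b * z).
have ct : cosh t = a + b * z by rewrite arcoshK.
have t0 : 0 <= t by exact: arcosh_ge0.
have st : sinh t = b * sinh L.
  apply/eqP; rewrite -(@eqrXn2 _ 2%N)//; last 2 first.
    exact: sinh_ge0.
    by rewrite mulr_ge0// ltW.
  have sinh_sqr u : sinh u ^+ 2 = cosh u ^+ 2 - 1 by rewrite cosh_sqr; ring.
  rewrite (exprMn _ b) !sinh_sqr ct -zE.
  have -> : b ^+ 2 * (z ^+ 2 - 1) =
      (a + b * z) ^+ 2 - (a ^+ 2 + b ^+ 2 + 2 * a * b * z) by ring.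
  by rewrite rr.
have sLt : sinh (L - t) = a * sinh L.
  by rewrite sinhD sinhN coshN ct st zE; ring.
have tL : t <= L.
  rewrite leNgt; apply/negP => Lt.
  have : 0 < sinh (t - L) by rewrite sinh_gt0// subr_gt0.
  by rewrite -opprB sinhN sLt oppr_gt0 ltNge mulr_ge0// ltW.
have tI : t \in `[0, L] by rewrite in_itv/= t0.
exists L, c, t; split.
- exact: ltW.
- move=> s u sL uL; have [sE hs] := cE _ sL; have [uE hu] := cE _ uL.
  split=> //; rewrite hyp_dist_minkowski// sE uE TT.
  have [su|us] := leP u s.
    by rewrite coshK ?subr_ge0// ger0_norm ?subr_ge0.
  by rewrite -coshN opprB coshK ?subr_ge0 ?ltW// distrC gtr0_norm ?subr_gt0.
- have [E h] := cE _ I0; apply: minkowski_inj => //; by rewrite E T0.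
- have [E h] := cE _ IL; apply: minkowski_inj => //; by rewrite E TL.
- split=> //; have [E h] := cE _ tI; apply: minkowski_inj => //.
  by rewrite E rE /T st sLt !mulfK ?gt_eqF.
Qed.

(** In the coordinates (v, |v|^2 + y^2), which map half-balls to halfspaces,
    geodesic segments are Euclidean segments. *)
Lemma geodesically_convex_segment (C : set point) p q r (t : R) :
  geodesically_convex C -> C p -> C q -> halfspace r -> 0 <= t <= 1 ->
  r.1 = (1 - t) *: p.1 + t *: q.1 ->
  height r = (1 - t) * height p + t * height q -> C r.
Proof.
move=> [Ch Cc] Cp Cq hr /andP[t0 t1] r1 r2.
have hp := Ch _ Cp; have hq := Ch _ Cq.
have [pq|pq] := eqVneq p q.
  suff -> : r = p by [].
  move: r1 r2; rewrite -pq -scalerDl -mulrDl subrK scale1r mul1r => r1.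
  rewrite /height r1 => /addrI/eqP; rewrite eqrXn2 ?ltW// => /eqP r2.
  by rewrite [r]surjective_pairing [p]surjective_pairing r1 r2.
have p0 : p.2 != 0 by rewrite gt_eqF.
have q0 : q.2 != 0 by rewrite gt_eqF.
have r0 : r.2 != 0 by rewrite gt_eqF.
have [|||L [c [u [L0 geo c0 cL [uL <-]]]]] :=
    @geodesic_through p q r ((1 - t) * p.2 / r.2) (t * q.2 / r.2) hp hq hr pq.
- by rewrite divr_ge0 ?(ltW hr)// mulr_ge0 ?(ltW hp)// subr_ge0.
- by rewrite divr_ge0 ?(ltW hr)// mulr_ge0 ?(ltW hq).
- rewrite /minkowski /comb/= r1 r2 scalerDr !scalerA; congr (_, _, _).
  + congr (_ *: _ + _ *: _); field; exact/andP.
  + by field; rewrite r0 p0 q0.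
  + by field; rewrite r0 p0 q0.
apply: Cc geo _ _ _ uL => //; first by rewrite c0.
by rewrite cL.
Qed.

End geodesics.

(** * Separation of convex sets *)

Section compactness.
Context {R : realType} {n : nat}.

Lemma box_closed_compact (A : set 'rV[R]_n) (M : R) : closed A ->
  (forall u, A u -> forall i, `|u 0 i| <= M) -> compact A.
Proof.
move=> cA AM; have boxM := @rV_compact _ n (fun=> `[- M, M]%classic)
  (fun=> @segment_compact _ _ _).
apply: subclosed_compact cA boxM _ => u Au i.
by rewrite /= in_itv/= -ler_norml AM.
Qed.

Lemma closed_preimage_le (f : 'rV[R]_n -> R) (a : R) : continuous f ->
  closed [set u | f u <= a].
Proof.
by move=> cf; apply: (@preimage_closed _ _ f [set y | y <= a]).
Qed.

Lemma closed_preimage_ge (f : 'rV[R]_n -> R) (a : R) : continuous f ->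
  closed [set u | a <= f u].
Proof. by move=> cf; apply: (@preimage_closed _ _ f [set y | a <= y]). Qed.

Lemma continuous_sumr (I : Type) (r : seq I) (F : I -> 'rV[R]_n -> R) :
  (forall i, continuous (F i)) -> continuous (fun u => \sum_(i <- r) F i u).
Proof.
by move=> cF; apply: continuous_big => //; exact: add_continuous.
Qed.

Lemma continuous_dot (c : 'rV[R]_n) : continuous (dot^~ c).
Proof.
apply: continuous_sumr => i u.
by apply: continuousM; [exact: coord_continuous|exact: cst_continuous].
Qed.

Lemma continuous_sqnorm2 : continuous (@sqnorm2 R n).
Proof.
apply: continuous_sumr => i u.
rewrite (_ : (fun v : 'rV[R]_n => v 0 i ^+ 2) = (fun v => v 0 i) \* (fun v => v 0 i)).
  by apply: continuousM; exact: coord_continuous.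
by apply/funext => v; rewrite /= expr2.
Qed.

Lemma sqr_coord_le_sqnorm2 (u : 'rV[R]_n) i : u 0 i ^+ 2 <= sqnorm2 u.
Proof.
rewrite /sqnorm2 (bigD1 i)//= lerDl.
by apply: sumr_ge0 => j _; exact: sqr_ge0.
Qed.

Lemma normr_coord_le (u : 'rV[R]_n) (M : R) i : 0 <= M -> sqnorm2 u <= M ^+ 2 ->
  `|u 0 i| <= M.
Proof.
move=> M0 uM; rewrite -(@ler_pXn2r _ 2%N)// ?nnegrE//.
by rewrite real_normK ?num_real// (le_trans (sqr_coord_le_sqnorm2 u i)).
Qed.

End compactness.

Section separation.
Context {R : realType}.

(** The point of minimal norm of the convex hull of the c i defines the
    separating hyperplane. *)
Lemma separation_finite m k (c : 'I_k.+1 -> 'rV[R]_m) :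
  (forall t : 'I_k.+1 -> R, (forall i, 0 <= t i) -> \sum_i t i = 1 ->
     \sum_i t i *: c i != 0) ->
  exists u, sqnorm2 u = 1 /\ forall i, 0 <= dot u (c i).
Proof.
move=> c0.
pose S := [set t : 'rV[R]_k.+1 | (forall i, 0 <= t 0 i) /\ \sum_i t 0 i = 1].
pose z (t : 'rV[R]_k.+1) := \sum_i t 0 i *: c i.
have S0 : S !=set0.
  exists (\row_j (j == 0)%:R); split=> [i|]; first by rewrite mxE.
  rewrite (bigD1 0)//= mxE eqxx big1 ?addr0// => i /negbTE i0.
  by rewrite mxE i0.
have cS : compact S.
  apply: (@box_closed_compact _ _ _ 1); last first.
    move=> t [t0 t1] i; rewrite ger0_norm// -t1 (bigD1 i)//= lerDl.
    exact: sumr_ge0.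
  rewrite (_ : S = (\bigcap_(i in setT) [set t : 'rV[R]_k.+1 | 0 <= t 0 i]) `&`
    ([set t | \sum_i t 0 i <= 1] `&` [set t | 1 <= \sum_i t 0 i])).
    have cs : continuous (fun t : 'rV[R]_k.+1 => \sum_i t 0 i).
      by apply: continuous_sumr => i; exact: coord_continuous.
    apply: closedI; last first.
      by apply: closedI; [exact: closed_preimage_le|exact: closed_preimage_ge].
    by apply: closed_bigI => i _; apply: closed_preimage_ge; exact: coord_continuous.
  apply/seteqP; split=> t /= [t0 t1]; split.
  - by move=> i _; exact: t0.
  - by rewrite t1.
  - by move=> i; exact: t0.
  - by apply/eqP; rewrite eq_le; apply/andP.
have cz : continuous (fun t => sqnorm2 (z t)).
  apply: continuous_sumr => i t.
  have czi : continuous (fun t => z t 0 i).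
    rewrite (_ : (fun t => z t 0 i) =
        fun t : 'rV[R]_k.+1 => \sum_j t 0 j * c j 0 i).
      apply: continuous_sumr => j v.
      by apply: continuousM; [exact: coord_continuous|exact: cst_continuous].
    by apply/funext => v; rewrite /z summxE; apply: eq_bigr => j _; rewrite mxE.
  rewrite (_ : (fun v => z v 0 i ^+ 2) = (fun v => z v 0 i) \* (fun v => z v 0 i)).
    by apply: continuousM; exact: czi.
  by apply/funext => v; rewrite /= expr2.
have [t /[!inE] -[t0 t1] tmin] := EVT_min_rV S0 cS (continuous_subspaceT cz).
have zt0 : z t != 0 by exact: c0.
have nz0 : 0 < sqnorm2 (z t).
  rewrite lt_neqAle sqnorm2_ge0 andbT eq_sym.
  by apply: contra_neq zt0 => /sqnorm2_eq0.
(* Otherwise a small step from z t towards c i would decrease the norm; the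
   step e is so small that 2 A + e B < 0. *)
have key i : 0 <= dot (z t) (c i - z t).
  rewrite leNgt; apply/negP => A0.
  set A := dot _ _ in A0; pose B := sqnorm2 (c i - z t).
  have B0 : 0 <= B by exact: sqnorm2_ge0.
  have BA : 0 < B - A by lra.
  pose e := - A / (B - A).
  have e0 : 0 < e by rewrite divr_gt0//; lra.
  have e1 : e <= 1 by rewrite ler_pdivrMr//; lra.
  pose t' : 'rV[R]_k.+1 := (1 - e) *: t + e *: \row_j (j == i)%:R.
  have St' : S t'.
    split=> [j|].
      rewrite !mxE addr_ge0// mulr_ge0// ?subr_ge0//; exact: ltW.
    rewrite (eq_bigr (fun j => (1 - e) * t 0 j + e * (j == i)%:R)); last first.
      by move=> j _; rewrite !mxE.
    rewrite big_split/= -!mulr_sumr t1 (bigD1 i)//= eqxx big1 ?addr0; last first.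
      by move=> j /negbTE ->.
    by rewrite !mulr1 subrK.
  have zt' : z t' = z t + e *: (c i - z t).
    rewrite /z (eq_bigr (fun j => (1 - e) *: (t 0 j *: c j) +
        e *: ((j == i)%:R *: c j))); last first.
      by move=> j _; rewrite !mxE [LHS]scalerDl !scalerA.
    rewrite big_split/= -!scaler_sumr -/(z t).
    rewrite [X in _ + e *: X](bigD1 i)//= eqxx scale1r big1 ?addr0; last first.
      by move=> j /negbTE ->; rewrite scale0r.
    by rewrite scalerBl scale1r scalerBr addrA addrAC.
  have := tmin t'; rewrite inE => /(_ St'); rewrite zt'.
  rewrite [in leRHS]sqnorm2E !dotDl !dotDr !dotZl !dotZr -!sqnorm2E.
  rewrite -/B -/A (dotC _ (z t)) -/A.
  rewrite -subr_ge0 (_ : _ - _ = e * (2 * A + e * B)); last by ring.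
  rewrite pmulr_rge0// leNgt => /negP; apply.
  have -> : 2 * A + e * B = A * (B - 2 * A) / (B - A).
    by rewrite /e; field; rewrite gt_eqF.
  by rewrite pmulr_llt0 ?invr_gt0// nmulr_rlt0//; lra.
have sz0 : 0 < Num.sqrt (sqnorm2 (z t)) by rewrite sqrtr_gt0.
exists ((Num.sqrt (sqnorm2 (z t)))^-1 *: z t); split.
  rewrite sqnorm2E !dotE -sqnorm2E -[X in _ * (_ * X)]sqr_sqrtr ?sqnorm2_ge0//.
  by field; rewrite gt_eqF.
move=> i; rewrite dotZl mulr_ge0 ?invr_ge0 ?(ltW sz0)//.
have := key i; rewrite dotDr dotNr -sqnorm2E subr_ge0; apply: le_trans.
exact: ltW.
Qed.

(** Compactness of the unit sphere reduces the separation of 0 from a convex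
    set, which need not be closed, to the finite case. *)
Lemma separation m (A : set 'rV[R]_m) : A !=set0 ->
  (forall k (c : 'I_k -> 'rV[R]_m) (t : 'I_k -> R), (forall i, A (c i)) ->
     (forall i, 0 <= t i) -> \sum_i t i = 1 -> \sum_i t i *: c i != 0) ->
  exists u, sqnorm2 u = 1 /\ forall c, A c -> 0 <= dot u c.
Proof.
move=> [a0 Aa0] A0.
pose S := [set u : 'rV[R]_m | sqnorm2 u = 1].
have cS : compact S.
  apply: (@box_closed_compact _ _ _ 1); last first.
    by move=> u Su i; apply: normr_coord_le => //; rewrite expr1n Su.
  apply: (@preimage_closed _ _ (@sqnorm2 R m) [set y | y = 1]).
    by move=> x _; exact: continuous_sqnorm2.
  exact: closed_eq.
pose f c := S `&` [set u : 'rV[R]_m | 0 <= dot u c].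
have := cS; rewrite compact_In0 => /(_ _ A f).
case=> [||u fu]; last first.
- exists u; split; first by have [] := fu _ Aa0.
  by move=> c /fu[].
- move=> D DA; pose s := a0 :: finmap.enum_fset D.
  have sA i : A (tnth (in_tuple s) i).
    have : tnth (in_tuple s) i \in s by exact: mem_tnth.
    rewrite inE => /orP[/eqP ->//|iD].
    by have := DA _ iD; rewrite inE.
  have [|u [u1 u0]] := @separation_finite m (size (finmap.enum_fset D))
      (fun i => tnth (in_tuple s) i).
    by move=> t t0 t1; exact: A0.
  exists u => c /= cD; split=> //=.
  have cs : c \in s by rewrite inE; apply/orP; right.
  have := u0 (Ordinal (n:=(size (finmap.enum_fset D)).+1) (m:=index c s) ltac:(by rewrite -[X in (_ < X)%N]/(size s) index_mem)).
  by rewrite (tnth_nth 0)/= nth_index.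
- exists (fun c => [set u : 'rV[R]_m | 0 <= dot u c]) => // c _.
  by apply: closed_preimage_ge; exact: continuous_dot.
Qed.

End separation.

(** * Points outside the hull *)

Section point_configurations.
Context {R : realType} {n : nat}.
Local Notation point := ('rV[R]_n * R)%type.
Implicit Types (p q r x : point) (w : 'rV[R]_n) (X : set point).

(** If X is spread, the complement of its hull lies between this set and the
    next one, in which x may be on the hemisphere itself; they differ by
    arbitrarily small vertical shifts ([on_empty_ball_vscale]). *)
Definition covered_by_empty_ball X : set point :=
  [set x | exists w s, sqdist w x < s /\ forall p, X p -> s <= sqdist w p].

Definition on_empty_ball X : set point :=
  [set x | exists w, forall p, X p -> sqdist w x <= sqdist w p].

(** Arbitrarily far in every orthant there are points of X: this makes the hull
    of X, in the coordinates (v, |v|^2 + y^2), the epigraph of a function. *)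
Definition spread X := forall (e : {ffun 'I_n -> bool}) (m : nat),
  exists2 p, X p & forall i, m%:R <= (-1) ^+ e i * p.1 0 i.

Definition vscale (rho : R) p : point := (p.1, rho * p.2).

Lemma on_empty_ball_vscale X x (rho : R) : halfspace x -> 0 <= rho < 1 ->
  on_empty_ball X x -> covered_by_empty_ball X (vscale rho x).
Proof.
move=> x0 /andP[rho0 rho1] [w wx]; exists w, (sqdist w x); split=> //.
rewrite /sqdist /= ltrD2l exprMn gtr_pMl; last by rewrite exprn_gt0.
by rewrite expr_lt1.
Qed.

(** A point of X far enough in the orthant opposite to u is far below x in the
    direction u; one point serves all the u of an orthant, hence finitely many
    points serve all directions. *)
Lemma spread_orthant X (e : {ffun 'I_n -> bool}) x : spread X ->
  exists2 p, X p & (forall u : 'rV[R]_n, (forall i, e i = (0 <= u 0 i)) ->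
    dot u (p.1 - x.1) <= - \sum_i `|u 0 i|) /\
    ((0 < n)%N -> height x < height p).
Proof.
move=> sX.
pose M := 1 + `|height x| + \sum_i `|x.1 0 i|.
have [m Mm] : exists m : nat, M <= m%:R.
  exists (Num.trunc M).+1; apply: ltW; apply: truncnS_gt.
have hM i : 1 + `|height x| + `|x.1 0 i| <= m%:R.
  apply: le_trans Mm; rewrite lerD2l (bigD1 i)//= lerDl.
  by apply: sumr_ge0 => j _.
have [p Xp pm] := sX e m.
exists p => //; split.
  move=> u eu.
  rewrite -sumrN; apply: ler_sum => i _.
  have := pm i; have := hM i; rewrite eu 2!mxE.
  have := ler_norm (x.1 0 i); have := ler_norm (- x.1 0 i); rewrite normrN.
  have := normr_ge0 (height x) => h1 h2 h3 h4.
  have [ui|ui] := leP 0 (u 0 i) => h5.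
    rewrite (ger0_norm ui) -[leRHS]mulrN1 ler_wpM2l//.
    by move: h5; rewrite mulN1r; lra.
  rewrite (ltr0_norm ui) opprK -[leRHS]mulr1 ler_wnM2l ?(ltW ui)//.
  by move: h5; rewrite mul1r; lra.
move=> n0; pose i := Ordinal n0.
have pi : m%:R <= `|p.1 0 i|.
  apply: le_trans (pm i) _; apply: le_trans (ler_norm _) _.
  by rewrite normrM normrX normrN1 expr1n mul1r.
have hxm : `|height x| + 1 <= m%:R.
  by apply: le_trans (hM i); rewrite addrC lerDl.
have m1 : 1 <= m%:R :> R by apply: le_trans hxm; rewrite lerDr.
apply: (le_lt_trans (ler_norm _)); apply: (@lt_le_trans _ _ m%:R); first lra.
apply: (@le_trans _ _ (m%:R ^+ 2)); first by rewrite expr2 ler_peMl.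
rewrite (@le_trans _ _ (p.1 0 i ^+ 2))//.
  by rewrite -[leRHS]real_normK ?num_real// ler_pXn2r// nnegrE.
by rewrite /height (le_trans (sqr_coord_le_sqnorm2 p.1 i))// lerDl sqr_ge0.
Qed.

Lemma spread_opposite X (u : 'rV[R]_n) x : spread X ->
  exists2 p, X p & dot u (p.1 - x.1) <= - \sum_i `|u 0 i| /\
    ((0 < n)%N -> height x < height p).
Proof.
move=> /(@spread_orthant X [ffun i => 0 <= u 0 i] x)[p Xp [pu ph]].
by exists p => //; split=> //; apply: pu => i; rewrite ffunE.
Qed.

(** By induction on the number of points, as in the Euclidean case. The partial
    barycentres stay in the halfspace because h - |v|^2 is a weighted mean of the
    positive numbers [sqdist v (p i)]. *)
Lemma geodesically_convex_comb (C : set point) k (p : 'I_k -> point)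
    (t : 'I_k -> R) r :
  geodesically_convex C -> (forall i, C (p i)) -> (forall i, 0 <= t i) ->
  \sum_i t i = 1 -> halfspace r -> r.1 = \sum_i t i *: (p i).1 ->
  height r = \sum_i t i * height (p i) -> C r.
Proof.
move=> Cc; elim: k p t r => [|k IH] p t r Cp t0 t1 hr r1 r2.
  by move: t1; rewrite big_ord0 => /eqP; rewrite eq_sym oner_eq0.
have hp i : halfspace (p i) by exact: Cc.1.
pose s := \sum_(i < k) t (lift ord0 i).
have ts : t ord0 + s = 1 by rewrite -t1 big_ord_recl.
have s0 : 0 <= s by exact: sumr_ge0.
have [s00|sn0] := eqVneq s 0.
  have tl i : t (lift ord0 i) = 0.
    by apply: (psumr_eq0P (F := fun i => t (lift ord0 i)) _ s00).
  have t01 : t ord0 = 1 by rewrite -ts s00 addr0.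
  suff -> : r = p ord0 by [].
  move: r1 r2; rewrite !big_ord_recl t01 scale1r mul1r !big1 ?addr0; last 2 first.
  - by move=> i _; rewrite tl mul0r.
  - by move=> i _; rewrite tl scale0r.
  move=> r1; rewrite /height r1 => /addrI/eqP; rewrite eqrXn2 ?ltW//; last exact: hp.
  by move=> /eqP r2; rewrite [r]surjective_pairing [p ord0]surjective_pairing r1 r2.
have s_gt0 : 0 < s by rewrite lt_neqAle eq_sym sn0.
pose t' i := t (lift ord0 i) / s.
have t'0 i : 0 <= t' i by rewrite divr_ge0.
have t'1 : \sum_i t' i = 1 by rewrite -mulr_suml divff.
pose v := \sum_i t' i *: (p (lift ord0 i)).1.
pose h := \sum_i t' i * height (p (lift ord0 i)).
have hv : 0 < h - sqnorm2 v.
  have -> : h - sqnorm2 v = \sum_i t' i * sqdist v (p (lift ord0 i)).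
    rewrite (eq_bigr (fun i => t' i * height (p (lift ord0 i)) +
        (- 2 * (t' i * dot v (p (lift ord0 i)).1) + t' i * sqnorm2 v))); last first.
      by move=> i _; rewrite sqdistE; ring.
    rewrite !big_split/= -mulr_sumr -mulr_suml t'1 mul1r.
    have -> : \sum_i t' i * dot v (p (lift ord0 i)).1 = sqnorm2 v.
      rewrite sqnorm2E {2}/v dotC dot_suml; apply: eq_bigr => i _.
      by rewrite dotZl dotC.
    by rewrite /h; ring.
  rewrite lt_neqAle; apply/andP; split; last first.
    by apply: sumr_ge0 => i _; rewrite mulr_ge0// sqdist_ge0.
  apply/negP; rewrite eq_sym psumr_eq0; last first.
    by move=> i _; rewrite mulr_ge0// sqdist_ge0.
  move=> /allP z0.
  have : \sum_i t' i = 0.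
    apply: big1 => i _; have /implyP/(_ isT) := z0 i (mem_index_enum _).
    rewrite mulf_eq0 => /orP[/eqP //|].
    rewrite gt_eqF// /sqdist ltr_wpDl ?sqnorm2_ge0// exprn_gt0//; exact: hp.
  by rewrite t'1 => /eqP; rewrite oner_eq0.
pose r' : point := (v, Num.sqrt (h - sqnorm2 v)).
have hr' : halfspace r' by rewrite /halfspace/= sqrtr_gt0.
have heightr' : height r' = h.
  by rewrite /height /= sqr_sqrtr ?(ltW hv)// addrCA subrr addr0.
have Cr' : C r' by apply: (IH (fun i => p (lift ord0 i)) t').
have t0E : t ord0 = 1 - s by rewrite -ts addrK.
apply: (geodesically_convex_segment (t := s) Cc (Cp ord0) Cr' hr).
- by rewrite s0 -ts lerDr t0.
- rewrite r1 big_ord_recl t0E; congr (_ + _).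
  rewrite scaler_sumr; apply: eq_bigr => i _.
  by rewrite scalerA mulrCA divff ?mulr1.
- rewrite r2 big_ord_recl t0E heightr'; congr (_ + _).
  rewrite mulr_sumr; apply: eq_bigr => i _.
  by rewrite mulrA mulrCA divff ?mulr1.
Qed.

Lemma dot_row_mx m1 m2 (a b : 'rV[R]_m1) (c d : 'rV[R]_m2) :
  dot (row_mx a c) (row_mx b d) = dot a b + dot c d.
Proof.
rewrite /dot big_split_ord/=; congr (_ + _); apply: eq_bigr => i _.
  by rewrite !row_mxEl.
by rewrite !row_mxEr.
Qed.

(** A point outside the hull is separated from it by a hyperplane in the
    coordinates (v, |v|^2 + y^2), which is not vertical as X is spread: it is
    the image of a hemisphere. *)
Lemma on_empty_ball_notin_hull X x : (0 < n)%N -> X `<=` halfspace -> spread X ->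
  halfspace x -> ~ geodesic_hull X x -> on_empty_ball X x.
Proof.
move=> n0 Xh sX hx Kx.
pose l p : 'rV[R]_(n + 1) := row_mx (p.1 - x.1) (\row_j (height p - height x)).
have dotl (u : 'rV[R]_(n + 1)) p : dot u (l p) =
    dot (lsubmx u) (p.1 - x.1) + rsubmx u 0 0 * (height p - height x).
  rewrite -{1}[u]hsubmxK dot_row_mx; congr (_ + _).
  by rewrite /dot big_ord1 [in X in _ * X]mxE.
have [p0 Xp0 _] := spread_opposite 0 x sX.
have [||u [u1 lu]] := @separation R _ (l @` X).
- by exists (l p0); exists p0.
- move=> k c t cX t0 t1; apply/eqP => c0; apply: Kx.
  have /choice[p pX] : forall i, exists p, X p /\ l p = c i.
    by move=> i; have [p Xp <-] := cX i; exists p.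
  have Kc : geodesically_convex (geodesic_hull X).
    exact: geodesically_convex_geodesic_hull.
  have XK : X `<=` geodesic_hull X by exact: sub_gen_smallest.
  have lc i : c i = row_mx ((p i).1 - x.1) (\row_j (height (p i) - height x)).
    by rewrite -(pX i).2.
  apply: (geodesically_convex_comb Kc _ t0 t1 hx (p := p)).
  + by move=> i; apply: XK; have [] := pX i.
  + have : lsubmx (\sum_i t i *: c i) = 0 by rewrite c0 linear0.
    rewrite linear_sum/= (eq_bigr (fun i => t i *: (p i).1 - t i *: x.1)); last first.
      by move=> i _; rewrite linearZ/= lc row_mxKl scalerBr.
    by rewrite sumrB -scaler_suml t1 scale1r => /subr0_eq.
  + have : rsubmx (\sum_i t i *: c i) 0 0 = 0 by rewrite c0 linear0 mxE.
    rewrite linear_sum/= summxE.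
    rewrite (eq_bigr (fun i => t i * height (p i) - t i * height x)); last first.
      by move=> i _; rewrite linearZ/= lc row_mxKr !mxE mulrBr.
    by rewrite sumrB -mulr_suml t1 mul1r => /subr0_eq.
pose u' := lsubmx u; pose u0 := rsubmx u 0 0.
have {}lu p : X p -> 0 <= dot u' (p.1 - x.1) + u0 * (height p - height x).
  by move=> Xp; rewrite -dotl lu//; exists p.
(* A hyperplane with u0 <= 0 cannot have X on one side: X has points that are
   far in the direction - u' and arbitrarily high. *)
have u0_gt0 : 0 < u0.
  rewrite ltNge; apply/negP => u0_le0.
  have [q Xq [q1 /(_ n0) q2]] := spread_opposite u' x sX.
  have := lu q Xq; have u0q : u0 * (height q - height x) <= 0.
    by rewrite mulr_le0_ge0// subr_ge0 ltW.
  have su0 : 0 <= \sum_i `|u' 0 i| by exact: sumr_ge0.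
  move=> h.
  have su00 : \sum_i `|u' 0 i| = 0 by lra.
  have u00 : u0 = 0.
    have /eqP : u0 * (height q - height x) = 0 by lra.
    by rewrite mulf_eq0 [X in _ || X]gt_eqF ?subr_gt0// orbF => /eqP.
  have u'0 : u' = 0.
    apply/rowP => i; rewrite [RHS]mxE; apply/eqP; rewrite -normr_eq0; apply/eqP.
    by apply: (psumr_eq0P (F := fun i => `|u' 0 i|) _ su00).
  move: u1; rewrite -[u]hsubmxK -/u' u'0 sqnorm2E dot_row_mx dot0l add0r.
  rewrite /dot big_ord1 -/u0 u00 mul0r => /eqP.
  by rewrite eq_sym oner_eq0.
exists (- (2 * u0)^-1 *: u') => p Xp.
rewrite !sqdistE lerD2r -subr_ge0 !dotE.
have := lu p Xp; rewrite !dotE => h.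
rewrite (_ : _ - _ = u0^-1 *
   (dot u' p.1 - dot u' x.1 + u0 * (height p - height x))); last first.
  by field; rewrite gt_eqF.
by rewrite mulr_ge0// invr_ge0 ltW.
Qed.

Lemma covered_notin_hull X x : X `<=` halfspace ->
  covered_by_empty_ball X x -> ~ geodesic_hull X x.
Proof.
move=> Xh [w [s [xs sX]]] /(geodesic_hull_empty_ball Xh sX).
by rewrite leNgt xs.
Qed.

End point_configurations.

(** * Vertices of the tessellation *)

Section simplices.
Context {R : realType} {n : nat}.

Lemma convex_setE (A : set 'rV[R]_n) : @convex_set R 'rV[R]_n A <->
  forall (a b : 'rV[R]_n) (t : R), 0 <= t <= 1 -> A a -> A b ->
    A (t *: a + (1 - t) *: b).
Proof.
split=> [cA a b t /andP[t0 t1] Aa Ab|cA a b t].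
  by have := cA a b (Itv01 t0 t1); rewrite !inE; apply.
by rewrite !inE; apply: cA; rewrite ge0 le1.
Qed.

Lemma convex_set_convex_hull (A : set 'rV[R]_n) :
  @convex_set R 'rV[R]_n (convex_hull A).
Proof.
apply/convex_setE => a b t t01 Ka Kb C [cC AC].
by have /convex_setE := cC; apply => //; [exact: Ka|exact: Kb].
Qed.

(** Removing an extreme point from a convex set leaves a convex set. *)
Lemma extreme_point_convex_hull (A : set 'rV[R]_n) v :
  extreme_point (convex_hull A) v -> A v.
Proof.
move=> [Kv ext]; apply: contrapT => Av.
have cD : @convex_set R 'rV[R]_n (convex_hull A `\ v).
  apply/convex_setE => a b t /andP[t0 t1] [Ka av] [Kb bv]; split.
    have /convex_setE := @convex_set_convex_hull A; apply => //.
    exact/andP.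
  have [->|tn0] := eqVneq t 0; first by rewrite scale0r subr0 scale1r add0r.
  have [->|tn1] := eqVneq t 1; first by rewrite scale1r subrr scale0r addr0.
  move=> /= vE; have ab : a = b.
    by apply: (ext _ _ t) => //; rewrite !lt_neqAle eq_sym tn0 t0 tn1.
  by apply: av => /=; rewrite -vE -ab -scalerDl addrC subrK scale1r.
have /= := Kv (convex_hull A `\ v); case=> //; split=> // w Aw; split.
  by apply: sub_gen_smallest.
by move=> /= wv; apply: Av; rewrite -wv.
Qed.

Lemma extreme_point_simplex m (v : 'I_m -> 'rV[R]_n) i :
  affinely_independent v -> extreme_point (convex_hull (range v)) (v i).
Proof.
move=> indep.
pose T := [set x | exists a : 'I_m -> R,
  [/\ forall j, 0 <= a j, \sum_j a j = 1 & x = \sum_j a j *: v j]].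
have cT : @convex_set R 'rV[R]_n T.
  apply/convex_setE => _ _ t /andP[t0 t1] [a [a0 a1 ->]] [b [b0 b1 ->]].
  exists (fun j => t * a j + (1 - t) * b j); split.
  - by move=> j; rewrite addr_ge0// mulr_ge0// subr_ge0.
  - by rewrite big_split/= -!mulr_sumr a1 b1 !mulr1 addrC subrK.
  - rewrite !scaler_sumr -big_split/=; apply: eq_bigr => j _.
    by rewrite [RHS]scalerDl !scalerA.
have sT : convex_hull (range v) `<=` T.
  apply: smallest_sub => // _ [j _ <-].
  exists (fun k => (k == j)%:R); split=> //.
    by rewrite (bigD1 j)//= eqxx big1 ?addr0// => k /negbTE ->.
  by rewrite (bigD1 j)//= eqxx scale1r big1 ?addr0// => k /negbTE ->; rewrite scale0r.
split; first by apply: sub_gen_smallest; exists i.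
move=> _ _ t /sT[a [a0 a1 ->]] /sT[b [b0 b1 ->]] /andP[t0 t1] vE.
have c0 j : t * a j + (1 - t) * b j - (j == i)%:R = 0.
  apply: (indep (fun j => t * a j + (1 - t) * b j - (j == i)%:R)).
    rewrite sumrB big_split/= -!mulr_sumr a1 b1 !mulr1 addrC subrK.
    by rewrite (bigD1 i)//= eqxx big1 ?addr0 ?subrr// => k /negbTE ->.
  rewrite (eq_bigr (fun j => t *: (a j *: v j) + (1 - t) *: (b j *: v j) -
      (j == i)%:R *: v j)); last first.
    by move=> k _; rewrite [LHS]scalerBl [in LHS]scalerDl !scalerA.
  rewrite sumrB big_split/= -!scaler_sumr -vE (bigD1 i)//= eqxx scale1r.
  by rewrite big1 ?addr0 ?subrr// => k /negbTE ->; rewrite scale0r.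
have ab0 j : j != i -> a j = 0 /\ b j = 0.
  move=> /negbTE ji; have := c0 j; rewrite ji subr0 => /eqP.
  rewrite paddr_eq0 ?mulr_ge0 ?subr_ge0 ?(ltW t0) ?(ltW t1)//.
  rewrite !mulf_eq0 (gt_eqF t0) subr_eq0 (gt_eqF t1)/=.
  by move=> /andP[/eqP -> /eqP ->].
apply: eq_bigr => j _.
have [->|ji] := eqVneq j i; last by have [-> ->] := ab0 _ ji.
congr (_ *: _); move: a1 b1; rewrite !(bigD1 (P := xpredT) i)//=.
rewrite [X in _ + X]big1 ?addr0; last by move=> k /ab0[].
by rewrite [X in _ + X]big1 ?addr0; [move=> -> ->|move=> k /ab0[]].
Qed.

Lemma affinely_independent_inj m (v : 'I_m -> 'rV[R]_n) :
  affinely_independent v -> injective v.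
Proof.
move=> indep i j vij; apply/eqP/negPn/negP => ij.
have := indep (fun k => (k == i)%:R - (k == j)%:R).
case/(_ _ _ i)/Wrap => [||[]].
- rewrite sumrB (bigD1 i)//= eqxx big1 ?addr0; last by move=> k /negbTE ->.
  by rewrite (bigD1 j)//= eqxx big1 ?addr0 ?subrr// => k /negbTE ->.
- under eq_bigr do rewrite scalerBl.
  rewrite sumrB (bigD1 i)//= eqxx big1 ?addr0; last first.
    by move=> k /negbTE ->; rewrite scale0r.
  rewrite (bigD1 j)//= eqxx big1 ?addr0; last first.
    by move=> k /negbTE ->; rewrite scale0r.
  by rewrite !scale1r vij subrr.
- by rewrite eqxx (negbTE ij) subr0 => /eqP; rewrite oner_eq0.
Qed.

End simplices.

Section tessellation_vertices.
Context {R : realType} {n : nat}.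
Local Notation point := ('rV[R]_n * R)%type.
Implicit Types (p q r x : point) (w : 'rV[R]_n) (X : set point).

Lemma tessellation_vertex_on_empty_ball X v : vertices (tessellation X) v ->
  exists2 x, X x /\ x.1 = v & on_empty_ball X x.
Proof.
move=> [_ [x [_ Xx _ [w [r [_ xr Xr]]] ->]] /extreme_point_convex_hull[i _ <-]].
exists (x i) => //; exists w => p Xp.
by rewrite /sqdist (xr i) leNgt; apply/negP/Xr.
Qed.

(** How far a centre can move without violating finitely many strict
    constraints. *)
Lemma small_multiple (T : eqType) (s : seq T) (f g : T -> R) :
  (forall z, z \in s -> 0 < f z) ->
  exists2 e, 0 < e & forall z, z \in s -> e * `|g z| <= f z.
Proof.
elim: s => [|a s IH] fs; first by exists 1.
have [|e e0 es] := IH; first by move=> p ps; apply: fs; rewrite inE ps orbT.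
have fa : 0 < f a by apply: fs; rewrite inE eqxx.
have ga : 0 < `|g a| + 1 by rewrite ltr_wpDl.
exists (Num.min e (f a / (`|g a| + 1))).
  by rewrite lt_min e0 divr_gt0.
move=> p; rewrite inE => /orP[/eqP ->|ps].
  apply: (@le_trans _ _ (f a / (`|g a| + 1) * (`|g a| + 1))).
    by rewrite ler_pM ?ge_min ?lexx ?orbT ?lerDl// le_min (ltW e0) divr_ge0// ltW.
  by rewrite divfK ?gt_eqF.
by apply: le_trans (es _ ps); rewrite ler_wpM2r// ge_min lexx.
Qed.

(** The centres w of the half-balls through x without points of X in their
    interior form a polytope. At a centre of maximal norm the points of X on
    the hemisphere span the space together with x, for otherwise the centre
    could be moved slightly in two opposite directions. *)
Lemma exposed_tessellation_vertex X x : (0 < n)%N -> X `<=` halfspace ->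
  (forall w M, finite_set (X `&` [set p | sqdist w p <= M])) -> spread X ->
  X x -> on_empty_ball X x -> vertices (tessellation X) x.1.
Proof.
move=> n0 Xh Xfin sX Xx [w0 xw0].
pose b p := (height p - height x) / 2.
have powE w p : sqdist w p - sqdist w x = 2 * (b p - dot w (p.1 - x.1)).
  by rewrite /b !sqdistE dotDr dotNr; field.
pose Q := [set w | forall p, X p -> dot w (p.1 - x.1) <= b p].
have QE w : Q w <-> forall p, X p -> sqdist w x <= sqdist w p.
  split=> h p Xp; have := h p Xp.
    by rewrite -subr_ge0 => h'; rewrite -subr_ge0 powE mulr_ge0.
  by rewrite -subr_ge0 powE pmulr_rge0// subr_ge0.
have Q0 : Q !=set0 by exists w0; apply/QE.
have cQ : compact Q.
  have /choice[pe peP] : forall e : {ffun 'I_n -> bool}, exists p, X p /\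
      (forall u : 'rV[R]_n, (forall i, e i = (0 <= u 0 i)) ->
        dot u (p.1 - x.1) <= - \sum_i `|u 0 i|).
    by move=> e; have [p Xp [pu _]] := spread_orthant e x sX; exists p.
  apply: (@box_closed_compact _ _ _ (\sum_e `|b (pe e)|)).
    rewrite (_ : Q = \bigcap_(p in X) [set w | dot w (p.1 - x.1) <= b p]).
      apply: closed_bigI => p _; apply: closed_preimage_le; exact: continuous_dot.
    by apply/seteqP; split.
  move=> w Qw i; pose e : {ffun 'I_n -> bool} := [ffun i => 0 <= (- w) 0 i].
  have [Xpe wpe] := peP e.
  have h1 : \sum_i `|w 0 i| <= dot w ((pe e).1 - x.1).
    have := wpe (- w) (fun i => ffunE _ i); rewrite dotNl lerN2.
    by rewrite [in X in X -> _](eq_bigr (fun i => `|w 0 i|))// => j _; rewrite mxE normrN.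
  apply: (@le_trans _ _ (\sum_i `|w 0 i|)).
    by rewrite (bigD1 i)//= lerDl sumr_ge0.
  apply: le_trans h1 _; apply: le_trans (Qw _ Xpe) _.
  apply: (le_trans (ler_norm _)).
  by rewrite (bigD1 e)//= lerDl sumr_ge0.
have [w /[!inE] Qw wmax] :=
  EVT_max_rV Q0 cQ (continuous_subspaceT (@continuous_sqnorm2 R n)).
have wX := (QE w).1 Qw.
pose act := X `&` [set p | sqdist w p = sqdist w x].
have /finite_seqP[s sE] : finite_set act.
  apply: sub_finite_set (Xfin w (sqdist w x)) => p [Xp /= ->].
  by split=> //=.
pose A : 'M[R]_(size s, n) := \matrix_i ((nth x s i).1 - x.1).
have sact i : (i < size s)%N -> act (nth x s i) by rewrite sE /=; exact: mem_nth.
(* Otherwise some u is orthogonal to all the active p - x, and the centres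
   w + d u and w - d u are admissible for small d. One of them has a larger
   norm than w. *)
have rA : row_full A.
  apply/negPn/negP => nrA.
  have kA : kermx A^T != 0 by rewrite kermx_eq0 /row_free mxrank_tr.
  pose u := nz_row (kermx A^T).
  have u0 : u != 0 by rewrite nz_row_eq0.
  have uA : u *m A^T = 0.
    have /submxP[D uD] := nz_row_sub (kermx A^T).
    by rewrite /u uD -mulmxA mulmx_ker mulmx0.
  have actu p : act p -> dot u (p.1 - x.1) = 0.
    rewrite sE /= => ps; have si : (index p s < size s)%N by rewrite index_mem.
    have := congr1 (fun B : 'M[R]__ => B 0 (Ordinal si)) uA.
    rewrite mxE [RHS]mxE => <-; apply: eq_bigr => j _.
    by rewrite !mxE /= nth_index// !mxE.
  (* Only the finitely many points with sqdist w p <= M restrict d: for the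
     others Young's inequality suffices, as d <= 1 / 4. *)
  pose K := sqnorm2 u + 2 * sqdist w x; pose M := K / 2 + 2 * sqdist w x.
  have /finite_seqP[F FE] : finite_set (X `&` [set p | sqdist w p <= M]) by exact: Xfin.
  pose G := [seq p <- F | sqdist w p != sqdist w x].
  have [p pG|e e0 eG] := @small_multiple _ G
      (fun p => sqdist w p - sqdist w x) (fun p => 2 * dot u (p.1 - x.1)).
    move: pG; rewrite mem_filter => /andP[pne pF].
    have [Xp _] : (X `&` [set p | sqdist w p <= M]) p by rewrite FE.
    by rewrite subr_gt0 lt_neqAle eq_sym pne wX.
  pose d := Num.min e (1 / 4).
  have d0 : 0 < d by rewrite lt_min e0/= divr_gt0.
  have de : d <= e by rewrite ge_min lexx.
  have d4 : d <= 1 / 4 by rewrite ge_min lexx orbT.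
  have key p : X p -> `|2 * (d * dot u (p.1 - x.1))| <= sqdist w p - sqdist w x.
    move=> Xp; rewrite mulrCA normrM (gtr0_norm d0).
    have [pa|pna] := eqVneq (sqdist w p) (sqdist w x).
      by rewrite actu// pa subrr mulr0 normr0 mulr0.
    have [pM|pM] := leP (sqdist w p) M.
      have pF : p \in F by have : [set` F] p by rewrite -FE.
      apply: le_trans (eG p _); first by rewrite ler_wpM2r.
      by rewrite mem_filter pna.
    have Y := dot_Young u (p.1 - x.1) ltr01; rewrite invr1 !mul1r in Y.
    have a2 : sqnorm2 (p.1 - x.1) <= 2 * sqdist w p + 2 * sqdist w x.
      have := sqnorm2_ge0 ((p.1 - w) + (x.1 - w)).
      have := sqr_ge0 p.2; have := sqr_ge0 x.2; rewrite /sqdist => h1 h2.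
      rewrite !sqnorm2E !dotE (dotC x.1 p.1) (dotC w p.1) (dotC w x.1); lra.
    have q0 := sqdist_ge0 w x; have su := sqnorm2_ge0 u.
    have K0 : 0 <= K by rewrite addr_ge0// mulr_ge0.
    apply: (@le_trans _ _ (1 / 4 * (K + 2 * sqdist w p))).
      rewrite ler_pM ?(ltW d0)//; apply: le_trans Y _; rewrite /K; lra.
    by move: pM; rewrite /M; lra.
  have Qpm (c : R) : `|c| = d -> Q (w + c *: u).
    move=> cd p Xp; have := key p Xp; rewrite powE dotDl dotZl => h.
    have : `|2 * (c * dot u (p.1 - x.1))| <= 2 * (b p - dot w (p.1 - x.1)).
      by move: h; rewrite !normrM cd (gtr0_norm d0).
    by rewrite ler_norml => /andP[_]; rewrite ler_pM2l//; lra.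
  have h1 := wmax _ (mem_set (Qpm d (gtr0_norm d0))).
  have h2 := wmax _ (mem_set (Qpm (- d) (etrans (normrN _) (gtr0_norm d0)))).
  have : 0 < d ^+ 2 * sqnorm2 u.
    rewrite mulr_gt0 ?exprn_gt0// lt_neqAle sqnorm2_ge0 andbT eq_sym.
    by apply: contra_neq u0 => /sqnorm2_eq0.
  by move: h1 h2; rewrite !sqnorm2E !dotE (dotC u w); lra.
pose f := fullrankfun rA.
pose y (i : 'I_n.+1) : point :=
  if unlift ord0 i is Some j then nth x s (f j) else x.
have y0 : y ord0 = x by rewrite /y unlift_none.
have yS j : y (lift ord0 j) = nth x s (f j) by rewrite /y liftK.
have acty i : act (y i).
  by case: (unliftP ord0 i) => [j|] ->; rewrite ?yS ?y0//; exact: sact.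
have indep : affinely_independent (fun i => (y i).1).
  move=> a a1 av.
  have al j : a (lift ord0 j) = 0.
    pose r : 'rV[R]_n := \row_j a (lift ord0 j).
    have r0 : r *m rowsub f A = 0.
      apply/rowP => k; rewrite !mxE.
      have := congr1 (fun B : 'rV[R]_n => B 0 k) av.
      rewrite summxE [RHS]mxE => av0.
      have a1k : \sum_i a i * x.1 0 k = 0 by rewrite -mulr_suml a1 mul0r.
      transitivity (\sum_i (a i *: (y i).1) 0 k - \sum_i a i * x.1 0 k); last first.
        by rewrite av0 a1k subrr.
      rewrite -sumrB big_ord_recl y0 !mxE subrr add0r.
      by apply: eq_bigr => i _; rewrite yS !mxE mulrBr.
    have := mulmxK (fullrowsub_unit rA) r; rewrite r0 mul0mx => r00.
    by have := congr1 (fun B : 'rV[R]_n => B 0 j) r00; rewrite !mxE.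
  move=> i; case: (unliftP ord0 i) => [j ->//|->].
  by move: a1; rewrite big_ord_recl big1 ?addr0.
exists (convex_hull (range (fun i => (y i).1))); last first.
  by rewrite -y0; apply: (extreme_point_simplex ord0 indep).
exists y; split=> //.
- by move=> i j yij; apply: (affinely_independent_inj indep); rewrite /= yij.
- by move=> i; have [] := acty i.
- exists w, (Num.sqrt (sqdist w x)).
  have q0 : 0 < sqdist w x.
    by rewrite /sqdist ltr_wpDl ?sqnorm2_ge0// exprn_gt0//; exact: Xh.
  split; first by rewrite sqrtr_gt0.
    by move=> i; rewrite sqr_sqrtr ?(ltW q0)//; have [_ /= <-] := acty i.
  move=> p Xp; rewrite sqr_sqrtr ?(ltW q0)//; apply/negP; rewrite -leNgt.
  exact: wX.
Qed.

End tessellation_vertices.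

(** * Similarities and the Lebesgue measure *)

Section image_measure.
Local Open Scope ereal_scope.
Context d1 d2 (T1 : measurableType d1) (T2 : measurableType d2) (R : realType).

Definition image_scales (m1 : set T1 -> \bar R) (m2 : set T2 -> \bar R)
    (f : T1 -> T2) (c : R) :=
  forall A, measurable A -> m1 (f @^-1` A) = c%:E * m2 A.

Lemma ge0_integral_image (m1 : {measure set T1 -> \bar R})
    (m2 : {measure set T2 -> \bar R}) (f : T1 -> T2) (c : R)
    (g : T2 -> \bar R) :
  measurable_fun setT f -> (0 <= c)%R -> image_scales m1 m2 f c ->
  measurable_fun setT g -> (forall y, 0 <= g y) ->
  \int[m1]_x g (f x) = c%:E * \int[m2]_y g y.
Proof.
move=> mf c0 fm mg g0.
have := @ge0_integral_pushforward _ _ _ _ _ _ mf m1 setT g measurableT mg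
  (fun y _ => g0 y).
rewrite preimage_setT => <-.
pose f' : {mfun T1 >-> T2} := HB.pack f (isMeasurableFun.Build _ _ _ _ _ mf).
rewrite -[c]/((NngNum c0)%:num) -ge0_integral_mscale//.
apply: (@eq_measure_integral _ _ _ _ (mscale (NngNum c0) m2) (pushforward m1 f')).
by move=> A mA _; exact: fm.
Qed.

End image_measure.

Section product_image.
Local Open Scope ereal_scope.
Context d1 d2 (T1 : measurableType d1) (T2 : measurableType d2) (R : realType).
Variables (m1 : {sigma_finite_measure set T1 -> \bar R})
          (m2 : {sigma_finite_measure set T2 -> \bar R}).

(** By Fubini, integrating first over the second factor. *)
Lemma image_scales_prod (f1 : T1 -> T1) (f2 : T2 -> T2) (c1 c2 : R) :
  (0 <= c1)%R -> (0 <= c2)%R ->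
  measurable_fun setT f1 -> measurable_fun setT f2 ->
  image_scales m1 m1 f1 c1 -> image_scales m2 m2 f2 c2 ->
  image_scales (m1 \x m2) (m1 \x m2) (fun z => (f1 z.1, f2 z.2)) (c1 * c2).
Proof.
move=> c10 c20 mf1 mf2 s1 s2 A mA.
rewrite /product_measure1/=.
pose h x := m2 (xsection A x).
have mh : measurable_fun setT h by exact: measurable_fun_xsection.
have h0 x : 0 <= h x by exact: measure_ge0.
rewrite (eq_integral (fun x => c2%:E * h (f1 x))); last first.
  move=> x _ /=; rewrite /h -s2; last exact: measurable_xsection.
  congr (m2 _); by apply/seteqP; split=> y; rewrite /xsection/= !inE.
rewrite ge0_integralZl//; last exact: measurableT_comp.
by rewrite (ge0_integral_image mf1 c10 s1)// muleA -EFinM mulrC.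
Qed.

End product_image.

Section affine_maps.
Context {R : realType}.
Local Open Scope ereal_scope.

Lemma image_scales_lebesgue (a b : R) : (0 < a)%R ->
  image_scales lebesgue_R lebesgue_R (fun x => a * x + b)%R a^-1.
Proof.
move=> a0 A mA.
pose f (x : R) : measurableTypeR R := (a * x + b)%R.
have mf : measurable_fun (setT : set (measurableTypeR R)) f.
  by apply: measurable_funD => //; apply: measurable_funM.
pose f' : {mfun measurableTypeR R >-> measurableTypeR R} :=
  HB.pack f (isMeasurableFun.Build _ _ _ _ _ mf).
have a0' : (0 <= a)%R by exact: ltW.
have h : @lebesgue_measure R A = (a%:E * @lebesgue_measure R (f @^-1` A))%E.
  apply: (@lebesgue_measure_unique R
    (mscale (NngNum a0') (pushforward (@lebesgue_measure R) f'))) => //.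
  move=> _ [[u v]] _ <-; rewrite /mscale/= /pushforward.
  rewrite [X in _ = _ * lebesgue_measure X](_ : _ = `](u - b) / a, (v - b) / a]%classic)%R; last first.
    apply/seteqP; split=> x; rewrite /f /= !in_itv/= ltr_pdivrMr// ler_pdivlMr//.
      by rewrite ltrBlDr lerBrDr mulrC.
    by rewrite ltrBlDr lerBrDr mulrC.
  rewrite !lebesgue_measure_itv/= !lte_fin ltr_pM2r ?invr_gt0// ltrD2r.
  case: ifPn => _; last by rewrite mule0.
  rewrite -!EFinB -EFinM; congr EFin; field; exact: lt0r_neq0.
by rewrite /lebesgue_R [in RHS]h muleA -EFinM mulVf ?gt_eqF// mul1e.
Qed.

Lemma measurable_affine_rV n (a : R) (b : 'rV[R]_n) :
  measurable_fun setT (fun v : 'rV[R]_n => a *: v + b)%R.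
Proof.
apply: measurable_fun_rV => i.
rewrite (_ : (fun x => _) = (fun v : 'rV[R]_n => a * v 0 i + b 0 i))%R.
  apply: measurable_funD => //; apply: measurable_funM => //.
  exact: measurable_coord_rV.
by apply/funext => v; rewrite !mxE.
Qed.

Lemma image_scales_lebesgue_rV n (a : R) (b : 'rV[R]_n) : (0 < a)%R ->
  image_scales (lebesgue_rV n) (lebesgue_rV n) (fun v => a *: v + b)%R (a ^- n).
Proof.
move=> a0; elim: n b => [|n IH] b A mA.
  rewrite expr0 invr1 mul1e; congr (lebesgue_rV 0 _).
  apply/funext => v /=; congr (A _).
  by rewrite [LHS]thinmx0 [RHS]thinmx0.
rewrite /= /cons_measure /pushforward.
pose b' : 'rV[R]_n := (\row_j b 0 (lift ord0 j))%R.
have -> : cons_rV @^-1` ((fun v => a *: v + b) @^-1` A)%R =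
    (fun z : R * 'rV[R]_n => (a * z.1 + b 0 ord0, a *: z.2 + b'))%R @^-1`
      (cons_rV @^-1` A).
  apply/funext => -[x v] /=; congr (A _); apply/rowP => i; rewrite !mxE.
  by case: (unliftP ord0 i) => [j|] -> //=; rewrite !mxE.
rewrite exprS invfM; apply: (@image_scales_prod _ _ _ _ R (@lebesgue_R R)
  (lebesgue_rV n) (fun x => a * x + b 0 ord0)%R (fun v => a *: v + b')%R).
- by rewrite invr_ge0 ltW.
- by rewrite invr_ge0 exprn_ge0// ltW.
- by apply: measurable_funD => //; apply: measurable_funM.
- exact: measurable_affine_rV.
- exact: image_scales_lebesgue.
- exact: IH.
- by rewrite -[X in measurable X]setTI; exact: measurable_cons_rV.
Qed.

(** The maps h(v, y) = (a v + b, a y), which are hyperbolic isometries. *)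
Definition hsim n (a : R) (b : 'rV[R]_n) (p : 'rV[R]_n * R) : 'rV[R]_n * R :=
  (a *: p.1 + b, a * p.2)%R.

Lemma measurable_hsim n (a : R) (b : 'rV[R]_n) : measurable_fun setT (hsim a b).
Proof.
apply: measurable_fun_pair.
  exact: (measurableT_comp (measurable_affine_rV a b) measurable_fst).
by apply: measurable_funM => //; exact: measurable_snd.
Qed.

Lemma image_scales_hsim n (a : R) (b : 'rV[R]_n) : (0 < a)%R ->
  image_scales (lebesgue_rV n \x lebesgue_R) (lebesgue_rV n \x lebesgue_R)
    (hsim a b) (a ^- n.+1).
Proof.
move=> a0 A mA.
have -> : hsim a b = fun z => (a *: z.1 + b, a * z.2 + 0)%R.
  by apply/funext => z; rewrite /hsim addr0.
rewrite exprSr invfM; apply: (@image_scales_prod _ _ _ _ R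
  (lebesgue_rV n) (@lebesgue_R R) (fun v => a *: v + b)%R (fun x => a * x + 0)%R).
- by rewrite invr_ge0 exprn_ge0// ltW.
- by rewrite invr_ge0 ltW.
- exact: measurable_affine_rV.
- by apply: measurable_funD => //; apply: measurable_funM.
- exact: image_scales_lebesgue_rV.
- exact: image_scales_lebesgue.
- exact: mA.
Qed.

End affine_maps.

(** * Integrals and hyperbolic volume *)

Section lower_integral.
Local Open Scope ereal_scope.
Context d (T : measurableType d) (R : realType) (mu : {measure set T -> \bar R}).

(** The integral of a nonnegative function is the supremum of the integrals of
    the simple functions below it: no measurability is needed to compare. *)
Lemma ge0_le_integral_nonmeasurable (f g : T -> \bar R) :
  (forall x, 0 <= f x) -> (forall x, f x <= g x) ->
  \int[mu]_x f x <= \int[mu]_x g x.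
Proof.
move=> f0 fg; rewrite !ge0_integralTE//; last first.
  by move=> x; exact: le_trans (fg x).
apply: le_ereal_sup => _ [h hf <-].
by exists h => // x; apply: le_trans (hf x) (fg x).
Qed.

End lower_integral.

Section powers.

Lemma is_derive_exprV {R : realType} n (y : R) : 0 < y -> (0 < n)%N ->
  is_derive y (1 : R) (fun z : R => - (z ^- n / n%:R)) (y ^- n.+1).
Proof.
move=> y0 n0; have yn0 : y ^+ n != 0 by rewrite expf_neq0// gt_eqF.
have n00 : n%:R != 0 :> R by rewrite pnatr_eq0 -lt0n.
have hX := is_deriveX n (is_derive_id y (1 : R)).
rewrite exprfctE in hX.
have hV := @is_deriveV R (fun z : R => z ^+ n) y _ 1 yn0 hX.
have h := is_deriveN (is_deriveM hV (is_derive_cst (n%:R^-1 : R) y (1 : R))).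
apply: is_derive_eq h _.
rewrite /= scaler0 add0r /GRing.scale/=.
case: n n0 n00 yn0 {hX hV} => // m _ m0 _.
rewrite -pred_Sn !exprS. field.
by rewrite nat1r m0 expf_neq0 gt_eqF.
Qed.
Lemma cvg_exprV_pinfty {R : realType} n : (0 < n)%N -> (y ^- n) @[y --> +oo] --> (0 : R).
Proof.
move=> n0; apply: (@squeeze_cvgr _ _ _ _ (fun=> 0) (fun y => y^-1)).
- near=> y; have y1 : (1 <= y) by near: y; exact: nbhs_pinfty_ge.
  rewrite invr_ge0 exprn_ge0 ?(le_trans _ y1)//= lef_pV2 ?posrE ?exprn_gt0 ?(lt_le_trans _ y1)//.
  by rewrite -[leLHS]expr1 ler_weXn2l.
- exact: cvg_cst.
- by apply/(@gtr0_cvgV0 _ _ _ _ id) => //; exact: nbhs_pinfty_gt.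
Unshelve. all: by end_near. Qed.

End powers.

Section halfline_integrals.
Context {R : realType} (n : nat).
Local Open Scope ereal_scope.

(** The density of the hyperbolic volume, extended by 0 below the boundary. *)
Definition decay (y : R) : R := if (0 < y)%R then (y ^- n.+1)%R else 0%R.

Lemma decay_ge0 y : (0 <= decay y)%R.
Proof. by rewrite /decay; case: ifPn => // y0; rewrite invr_ge0 exprn_ge0// ltW. Qed.

Lemma measurable_decay : measurable_fun setT decay.
Proof.
have -> : decay = (fun y : R => y ^- n.+1 : R)%R \_ (`]0%R, +oo[%classic).
  apply/funext => y; rewrite /decay patchE /=.
  have [y0|y0] := boolP (0 < y)%R; first by rewrite mem_set//= in_itv/= y0.
  by rewrite memNset//= in_itv/= (negbTE y0).
apply/(measurable_restrictT _ _).1 => //.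
apply: open_continuous_measurable_fun => // y; rewrite inE/= in_itv/= andbT => y0.
apply: (@continuousV R R (fun y => y ^+ n.+1)%R y); first by rewrite expf_neq0// gt_eqF.
exact: exprn_continuous.
Qed.

(** The two measures are equal but live on different measurable types; the
    integral is carried over along the identity. *)
Lemma lebesgue_R_integralE (f : R -> \bar R) : measurable_fun setT f ->
  (forall x, 0 <= f x) -> \int[@lebesgue_R R]_x f x = \int[@lebesgue_measure R]_x f x.
Proof.
move=> mf f0.
pose i (x : R) : measurableTypeR R := x.
rewrite -[RHS]mul1e -(@ge0_integral_image _ _ _ _ _ (@lebesgue_R R) _ i 1%R f)//.
  by move=> _ A mA; rewrite setTI.
by move=> A mA; apply/esym; exact: mul1e.
Qed.

Lemma integral_decay (a : R) : (0 < n)%N -> (0 < a)%R ->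
  \int[@lebesgue_R R]_(y in `[a, +oo[) (decay y)%:E = (a ^- n / n%:R)%:E.
Proof.
move=> n0 a0; have n00 : (n%:R != 0 :> R)%R by rewrite pnatr_eq0 -lt0n.
rewrite integral_mkcond lebesgue_R_integralE; last 2 first.
- apply/(measurable_restrictT _ _).1 => //.
  by apply: measurable_funTS; apply/measurable_EFinP; exact: measurable_decay.
- by move=> y; rewrite patchE; case: ifP => // _; rewrite lee_fin decay_ge0.
rewrite -integral_mkcond.
rewrite (eq_integral (fun y : measurableTypeR R => ((y : R) ^- n.+1)%:E)); last first.
  move=> y; rewrite inE/= in_itv/= andbT => ay; rewrite /decay ifT//.
  exact: lt_le_trans ay.
pose F (y : R) : R := (- (y ^- n / n%:R))%R.
have dF (y : R) : (0 < y)%R -> is_derive y (1%R : R) F (y ^- n.+1)%R.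
  by move=> y0; exact: is_derive_exprV.
rewrite (@ge0_continuous_FTC2y _ _ F a 0%R)//.
- by rewrite /F EFinN oppeK add0e.
- by move=> y ay; rewrite invr_ge0 exprn_ge0// (le_trans _ ay)// ltW.
- apply: continuous_in_subspaceT => y; rewrite inE/= in_itv/= andbT => ay.
  apply: (@continuousV R R (fun y => y ^+ n.+1)%R y); last exact: exprn_continuous.
  by rewrite expf_neq0// gt_eqF// (lt_le_trans a0).
- rewrite -[X in _ --> X]oppr0 -(mul0r (n%:R^-1)%R); apply: cvgN; apply: cvgMr_tmp.
  exact: cvg_exprV_pinfty.
- by move=> y ay; have [] := dF y (lt_trans a0 ay).
- apply: cvg_at_right_filter; have [dFa _] := dF a a0.
  by apply: differentiable_continuous; apply/derivable1_diffP.
- move=> y; rewrite in_itv/= andbT => ay.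
  by rewrite derive1E; have [_ ->] := dF y (lt_trans a0 ay).
Qed.

End halfline_integrals.
Section hyperbolic_volume.
Context {R : realType} {n : nat}.
Local Open Scope ereal_scope.
Local Notation L := (lebesgue_rV n \x @lebesgue_R R).
Implicit Type A : set ('rV[R]_n * R).

Definition hyp_density (p : 'rV[R]_n * R) : \bar R := (decay n p.2)%:E.

Lemma hyp_density_ge0 p : 0 <= hyp_density p.
Proof. by rewrite lee_fin decay_ge0. Qed.

Lemma measurable_hyp_density : measurable_fun setT hyp_density.
Proof.
apply/measurable_EFinP.
exact: (measurableT_comp (measurable_decay n) measurable_snd).
Qed.

Lemma hyp_volE A : hyp_vol A = \int[L]_(p in A) hyp_density p.
Proof.
rewrite /hyp_vol integral_mkcondr; apply: eq_integral => p _.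
rewrite patchE /hyp_density /decay; case: ifPn => [|] h.
  by rewrite ifT//; move: h; rewrite inE.
by rewrite ifF//; apply/negbTE; move: h; rewrite notin_setE => /negP.
Qed.

Lemma hyp_vol_ge0 A : 0 <= hyp_vol A.
Proof. by rewrite hyp_volE integral_ge0// => p _; exact: hyp_density_ge0. Qed.

Lemma le_hyp_vol (A B : set ('rV[R]_n * R)) : A `<=` B -> hyp_vol A <= hyp_vol B.
Proof.
move=> AB; rewrite !hyp_volE integral_mkcond [leRHS]integral_mkcond.
apply: ge0_le_integral_nonmeasurable => p; rewrite !patchE.
  by case: ifP => // _; exact: hyp_density_ge0.
case: ifPn => [/[!inE] /AB Bp|_]; first by rewrite mem_set.
by case: ifP => // _; exact: hyp_density_ge0.
Qed.

(** The factor a^(n+1) of the Lebesgue measure cancels that of the density. *)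
Lemma hyp_vol_hsim (a : R) (b : 'rV[R]_n) A : (0 < a)%R -> measurable A ->
  hyp_vol (hsim a b @^-1` A) = hyp_vol A.
Proof.
move=> a0 mA; rewrite !hyp_volE integral_mkcond [RHS]integral_mkcond.
rewrite (eq_integral (fun p => (a ^+ n.+1)%:E * (hyp_density \_ A) (hsim a b p))); last first.
  move=> p _; rewrite !patchE.
  have -> : (p \in hsim a b @^-1` A) = (hsim a b p \in A).
    by apply/idP/idP; rewrite !inE.
  case: ifP => _; last by rewrite mule0.
  rewrite /hyp_density /decay /= pmulr_rgt0//; case: ifP => [p0|_]; last by rewrite mule0.
  by rewrite -EFinM exprMn invfM mulrA divff ?mul1r// expf_neq0// gt_eqF.
have h0 p : 0 <= (hyp_density \_ A) p.
  by rewrite patchE; case: ifP => // _; exact: hyp_density_ge0.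
have mh : measurable_fun setT (hyp_density \_ A).
  apply/(measurable_restrictT _ _).1 => //.
  exact: measurable_funTS measurable_hyp_density.
rewrite ge0_integralZl//.
- rewrite (@ge0_integral_image _ _ _ _ R L L (hsim a b) (a ^- n.+1) _ (measurable_hsim a b))//.
  + by rewrite muleA -EFinM divff ?mul1e// expf_neq0// gt_eqF.
  + by rewrite invr_ge0 exprn_ge0// ltW.
  + exact: image_scales_hsim.
- exact: (measurableT_comp mh (measurable_hsim a b)).
- by rewrite lee_fin exprn_ge0// ltW.
Qed.

Lemma measurable_cylinder (lambda : R) (W : set 'rV[R]_n) : measurable W ->
  measurable (cylinder lambda W).
Proof. by move=> mW; apply: measurableX. Qed.

Lemma integral_cylinder (lambda : R) (W : set 'rV[R]_n) (psi : R -> \bar R) :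
  measurable W -> measurable_fun setT psi -> (forall y, 0 <= psi y) ->
  \int[L]_(p in cylinder lambda W) (psi p.2 * hyp_density p) =
  lebesgue_rV n W *
    \int[@lebesgue_R R]_(y in `[lambda, +oo[) (psi y * (decay n y)%:E).
Proof.
move=> mW mpsi psi0.
pose G (y : R) := psi y * (decay n y)%:E.
have G0 y : 0 <= G y by rewrite mule_ge0// lee_fin decay_ge0.
have mG : measurable_fun setT G.
  by apply: emeasurable_funM => //; apply/measurable_EFinP; exact: measurable_decay.
pose G' := G \_ `[lambda, +oo[%classic.
have G'0 y : 0 <= G' y by rewrite /G' patchE; case: ifP.
have mG' : measurable_fun setT G'.
  by apply/(measurable_restrictT _ _).1 => //; exact: measurable_funTS.
pose f (p : 'rV[R]_n * R) := (\1_W p.1)%:E * G' p.2.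
have f0 p : 0 <= f p by rewrite mule_ge0// lee_fin.
rewrite integral_mkcond (eq_integral f); last first.
  move=> p _; rewrite patchE /f /G' patchE indicE.
  have -> : (p \in cylinder lambda W) = (p.1 \in W) && (p.2 \in `[lambda, +oo[%classic).
    by apply/idP/andP; rewrite !inE.
  by case: (p.1 \in W); case: (_ \in _); rewrite ?mul1e ?mule0 ?mul0e.
rewrite fubini_tonelli1//; last first.
  apply: emeasurable_funM.
    apply/measurable_EFinP.
    apply: (measurableT_comp (f := \1_W : _ -> R) _ measurable_fst).
    exact: measurable_indic.
  exact: (measurableT_comp mG' measurable_snd).
rewrite (eq_integral (fun v => (\int[@lebesgue_R R]_y G' y) * (\1_W v)%:E)); last first.
  move=> v _; rewrite /fubini_F /f /= ge0_integralZl//.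
  by rewrite muleC.
rewrite ge0_integralZl//; last 2 first.
- by apply/measurable_EFinP; exact: measurable_indic.
- by rewrite integral_ge0.
by rewrite integral_indic// setIT muleC [in RHS]integral_mkcond.
Qed.

Lemma hyp_vol_cylinder (lambda : R) (W : set 'rV[R]_n) : (0 < n)%N ->
  (0 < lambda)%R -> measurable W ->
  hyp_vol (cylinder lambda W) = lebesgue_rV n W * (lambda ^- n / n%:R)%:E.
Proof.
move=> n0 l0 mW; rewrite hyp_volE.
rewrite (eq_integral (fun p => cst 1 p.2 * hyp_density p)); last first.
  by move=> p _; rewrite mul1e.
rewrite integral_cylinder//; congr (_ * _); rewrite -integral_decay//.
by apply: eq_integral => y _; rewrite mul1e.
Qed.

Lemma integral_decay_scale (kappa lambda : R) (psi : R -> \bar R) :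
  (0 < kappa)%R -> measurable_fun setT psi -> (forall y, 0 <= psi y) ->
  \int[@lebesgue_R R]_(y in `[lambda, +oo[) (psi (kappa * y)%R * (decay n y)%:E) =
  (kappa ^+ n)%:E *
  \int[@lebesgue_R R]_(y in `[(kappa * lambda)%R, +oo[) (psi y * (decay n y)%:E).
Proof.
move=> k0 mpsi psi0; rewrite integral_mkcond [in RHS]integral_mkcond.
set g := (X in _ = _ * \int[_]_y X y).
have g0 y : 0 <= g y.
  by rewrite /g patchE; case: ifP => // _; rewrite mule_ge0// lee_fin decay_ge0.
have mg : measurable_fun setT g.
  apply/(measurable_restrictT _ _).1 => //; apply: measurable_funTS.
  by apply: emeasurable_funM => //; apply/measurable_EFinP; exact: measurable_decay.
rewrite (eq_integral (fun y => (kappa ^+ n.+1)%:E * g (kappa * y + 0)%R)); last first.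
  move=> y _; rewrite /g !patchE addr0.
  have -> : ((kappa * y)%R \in `[(kappa * lambda)%R, +oo[%classic) = (y \in `[lambda, +oo[%classic).
    by apply/idP/idP; rewrite !inE/= !in_itv/= !andbT ler_pM2l.
  case: ifP => _; last by rewrite mule0.
  rewrite muleCA; congr (_ * _); rewrite /decay pmulr_rgt0//.
  case: ifP => [y0|_]; last by rewrite mule0.
  by rewrite -EFinM exprMn invfM mulrA divff ?mul1r// expf_neq0// gt_eqF.
have ma : measurable_fun setT (fun y : R => kappa * y + 0)%R.
  by apply: measurable_funD => //; apply: measurable_funM.
rewrite ge0_integralZl//; last 2 first.
- exact: (measurableT_comp mg ma).
- by rewrite lee_fin exprn_ge0// ltW.
rewrite (@ge0_integral_image _ _ _ _ R _ (@lebesgue_R R) _ kappa^-1)//.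
- by rewrite muleA -EFinM exprSr mulfK// gt_eqF.
- by rewrite invr_ge0 ltW.
- exact: image_scales_lebesgue.
Qed.

End hyperbolic_volume.

Section lebesgue_boxes.
Context {R : realType}.
Local Open Scope ereal_scope.

Lemma measurable_rV_all n (P : 'I_n -> set R) : (forall i, measurable (P i)) ->
  measurable [set v : 'rV[R]_n | forall i, P i (v 0%R i)].
Proof.
move=> mP; rewrite (_ : [set _ | _] =
    \bigcap_(i in setT) ((fun v : 'rV[R]_n => v 0%R i) @^-1` P i)).
  apply: fin_bigcap_measurable => // i _.
  by rewrite -[X in measurable X]setTI; exact: measurable_coord_rV.
by apply/seteqP; split=> v /= Pv i; [move=> _; exact: Pv|exact: Pv].
Qed.

Lemma lebesgue_rV_all n (P : 'I_n.+1 -> set R) : (forall i, measurable (P i)) ->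
  lebesgue_rV n.+1 [set v | forall i, P i (v 0%R i)] =
  lebesgue_R (P ord0) * lebesgue_rV n [set v | forall i, P (lift ord0 i) (v 0%R i)].
Proof.
move=> mP; rewrite -product_measure1E//; last first.
  by apply: (@measurable_rV_all n (fun i => P (lift ord0 i))).
transitivity ((@lebesgue_R R \x lebesgue_rV n)
  (@cons_rV R n @^-1` [set v | forall i, P i (v 0%R i)])) => //.
congr (product_measure1 _ _ _).
apply/seteqP; split=> -[x v] /=.
  move=> h; split; first by have := h ord0; rewrite mxE unlift_none.
  by move=> i; have := h (lift ord0 i); rewrite mxE liftK.
by move=> [h0 h] i; rewrite mxE; case: (unliftP ord0 i) => [j|] -> //=.
Qed.

Lemma lebesgue_rV_box_lty n (M : R) :
  lebesgue_rV n [set v | forall i, (`[(- M)%R, M]%classic : set R) (v 0%R i)] < +oo.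
Proof.
elim: n => [|n IH]; first by rewrite /= diracE ltry.
rewrite (@lebesgue_rV_all n (fun=> `[(- M)%R, M]%classic))//.
rewrite lte_mul_pinfty ?measure_ge0//.
by rewrite /lebesgue_R lebesgue_measure_itv/=; case: ifP.
Qed.

(** The orthant with sign vector e, pushed out by m in every coordinate. *)
Definition orthant n (e : 'I_n -> bool) (m : nat) : set 'rV[R]_n :=
  [set v | forall i, ([set x : R | m%:R <= (-1) ^+ e i * x])%R (v 0%R i)].

Let side_itv (b : bool) (m : nat) : ([set x : R | m%:R <= (-1) ^+ b * x])%R =
  if b then `]-oo, (- m%:R)%R]%classic else `[m%:R%R, +oo[%classic.
Proof.
apply/seteqP; case: b; split=> x /=; rewrite in_itv/= ?andbT ?expr1 ?expr0 ?mul1r ?mulN1r//.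
  by rewrite lerNr.
by rewrite lerNr.
Qed.

Let measurable_side (b : bool) (m : nat) :
  measurable ([set x : R | m%:R <= (-1) ^+ b * x])%R.
Proof. by rewrite side_itv; case: b. Qed.

Lemma measurable_orthant n (e : 'I_n -> bool) m : measurable (orthant e m).
Proof.
apply: (@measurable_rV_all n (fun i => [set x : R | m%:R <= (-1) ^+ e i * x])%R).
by move=> i; exact: measurable_side.
Qed.

Let lebesgue_side (b : bool) (m : nat) :
  lebesgue_R ([set x : R | m%:R <= (-1) ^+ b * x])%R = +oo.
Proof. by rewrite side_itv /lebesgue_R; case: b; rewrite lebesgue_measure_itv/= ?ltNyr ?ltry. Qed.

Lemma lebesgue_rV_orthant n (e : 'I_n -> bool) (m : nat) : (0 < n)%N ->
  lebesgue_rV n (orthant e m) = +oo.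
Proof.
have [k] := ubnP n; elim: k n e => // k IH [//|n] e nk _.
rewrite (@lebesgue_rV_all n (fun i => [set x : R | m%:R <= (-1) ^+ e i * x])%R); last first.
  by move=> i; exact: measurable_side.
rewrite lebesgue_side gt0_mulye//.
have [n0|] := ltnP 0 n.
  by have := IH n (fun i => e (lift ord0 i)) nk n0; rewrite /orthant/= => ->; rewrite ltey.
rewrite leqn0 => /eqP n0; move: e nk; rewrite {}n0 => e _.
rewrite /= diracE mem_set ?lte01//.
by move=> i; have := ltn_ord i.
Qed.

End lebesgue_boxes.

(** * Counting points *)

Section counting.
Local Open Scope ereal_scope.
Context {R : realType} {T : pointedType}.
Implicit Types A B : set T.

(* [counting] is a measure on the sigma-algebra of all the sets. *)
Let discreteT := g_sigma_algebraType [set: set T].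

Let measurable_discrete (A : set discreteT) : measurable A.
Proof. exact: sub_sigma_algebra. Qed.

Lemma counting_le A B : A `<=` B -> counting A <= counting B :> \bar R.
Proof.
move=> AB; apply: (@le_measure _ R discreteT (@counting _ R)) => //;
  by rewrite inE; exact: measurable_discrete.
Qed.

Lemma countingU A B : A `&` B = set0 ->
  counting (A `|` B) = counting A + counting B :> \bar R.
Proof.
by move=> AB; apply: (@measureU _ R discreteT (@counting _ R)).
Qed.

Lemma cvg_counting (F : (set T)^nat) : {homo F : i j / (i <= j)%N >-> i `<=` j} ->
  counting (F k) @[k --> \oo] --> (counting (\bigcup_k F k) : \bar R).
Proof.
move=> ndF; apply: (@nondecreasing_cvg_mu _ discreteT R (@counting _ R) F) => [i||].
- exact: (@measurable_discrete (F i)).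
- exact: (@measurable_discrete (\bigcup_k F k)).
- by move=> i j ij; apply/subsetPset; exact: ndF.
Qed.

Lemma counting_ge0 A : 0 <= counting A :> \bar R.
Proof. exact: (@measure_ge0 _ discreteT R (@counting _ R)). Qed.

Lemma counting_eq0 A : (counting A = 0 :> \bar R) <-> A = set0.
Proof.
rewrite /counting; case: asboolP => [fA|infA]; last first.
  by split=> // A0; exfalso; apply: infA; rewrite A0.
split=> [[]/eqP|->]; last by rewrite fset_set0.
rewrite pnatr_eq0 finmap.cardfs_eq0 => /eqP; exact: fset_set_set0.
Qed.

Lemma counting_set1 (x : T) : counting [set x] = 1 :> \bar R.
Proof. by rewrite /counting asboolT// fset_set1 finmap.cardfs1. Qed.

Lemma counting_eq1 A : (counting A = 1 :> \bar R) <-> exists x, A = [set x].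
Proof.
split=> [|[x ->]]; last exact: counting_set1.
rewrite /counting; case: asboolP => // fA []/eqP.
rewrite (eqr_nat _ _ 1%N) => /finmap.cardfs1P[x Ax]; exists x.
by rewrite -(fset_setK fA) Ax; apply/seteqP; split=> y /=; rewrite finmap.in_fset1 => /eqP.
Qed.

Lemma counting_values A :
  (exists k : nat, counting A = k%:R%:E :> \bar R) \/ counting A = +oo :> \bar R.
Proof.
rewrite /counting; case: asboolP => fA; last by right.
by left; eexists.
Qed.

End counting.

Section counting_image.
Local Open Scope ereal_scope.
Context {R : realType} {T U : pointedType}.

Lemma counting_image_le (f : T -> U) (A : set T) :
  counting (f @` A) <= counting A :> \bar R.
Proof.
rewrite {2}/counting; case: asboolP => [fA|_]; last by rewrite leey.
rewrite /counting asboolT; last exact: finite_image.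
rewrite lee_fin ler_nat fset_set_image//.
exact: finmap.leq_imfset_card.
Qed.

Lemma counting_image_inj (f : T -> U) (A : set T) : {in A &, injective f} ->
  counting (f @` A) = counting A :> \bar R.
Proof.
move=> fI; rewrite /counting.
have -> : `[< finite_set (f @` A) >] = `[< finite_set A >].
  apply/asboolP/asboolP; last exact: finite_image.
  by rewrite (eq_finite_set (inj_card_eq fI)).
case: asboolP => // fA; rewrite fset_set_image// finmap.card_in_imfset//.
by move=> x y; rewrite !in_fset_set// => xA yA; apply: fI.
Qed.

End counting_image.

Section poisson_series.
Context {R : realType}.
Local Open Scope ereal_scope.

Definition poisson_weight (m : R) (k : nat) : R := (m ^+ k / k`!%:R * expR (- m))%R.

Lemma poisson_weight_ge0 m k : (0 <= m)%R -> (0 <= poisson_weight m k)%R.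
Proof. by move=> m0; rewrite mulr_ge0 ?expR_ge0// divr_ge0// exprn_ge0. Qed.

Lemma sum_poisson_weight m : (0 <= m)%R -> \sum_(k <oo) (poisson_weight m k)%:E = 1.
Proof.
move=> m0.
rewrite (eq_eseriesr (g := fun k => (expR (- m))%:E * (exp_coeff m k)%:E)); last first.
  by move=> k _; rewrite -EFinM mulrC.
rewrite nneseriesZl; last by move=> k _; rewrite lee_fin divr_ge0// exprn_ge0.
have -> : \sum_(k <oo) (exp_coeff m k)%:E = (expR m)%:E.
  rewrite expRE -EFin_lim; last first.
    rewrite /pseries/=; under eq_fun do rewrite mulrC.
    exact: is_cvg_series_exp_coeff.
  apply/congr_lim/funext => k/=; rewrite /pseries/= /series/= -sumEFin//.
  by apply: eq_bigr => i _; rewrite mulrC.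
by rewrite -EFinM expRN mulVf// gt_eqF// expR_gt0.
Qed.

(** The mean of the Poisson distribution: k m^k / k! = m m^(k-1) / (k-1)!. *)
Lemma sum_mul_poisson_weight m : (0 <= m)%R -> \sum_(k <oo) (k%:R * poisson_weight m k)%:E = m%:E.
Proof.
move=> m0; have f0 k : 0 <= (k%:R * poisson_weight m k)%:E.
  by rewrite lee_fin mulr_ge0// poisson_weight_ge0.
rewrite nneseries_recl// mul0r add0e -nneseries_addn//.
rewrite (eq_eseriesr (g := fun k => m%:E * (poisson_weight m k)%:E)); last first.
  move=> k _; rewrite addn1 -EFinM; congr EFin.
  have k0 : k.+1%:R != 0%R :> R by rewrite pnatr_eq0.
  have fk0 : k`!%:R != 0%R :> R by rewrite pnatr_eq0 -lt0n fact_gt0.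
  rewrite /poisson_weight factS natrM exprS; move: (k.+1%:R) k0 => c c0.
  by field; rewrite c0 fk0.
by rewrite nneseriesZl ?sum_poisson_weight ?mule1// => k _; rewrite lee_fin poisson_weight_ge0.
Qed.

End poisson_series.

(** * Void probabilities of a Poisson process *)

Section poisson.
Context {R : realType} {disp disp' : measure_display}
  {Omega : measurableType disp} {T : measurableType disp'}.
Variables (P : probability Omega R) (mu : set T -> \bar R)
  (eta : Omega -> set T).
Hypothesis mu_ge0 : forall B, (0 <= mu B)%E.
Hypothesis heta : poisson_process P mu eta.
Implicit Types (A C : set T) (E X Y : set Omega).

Let Pr E : R := fine (P E).

Let PrE E : measurable E -> P E = (Pr E)%:E.
Proof. by move=> mE; rewrite fineK// fin_num_measure. Qed.

Let PrU X Y : measurable X -> measurable Y ->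
  Pr (X `|` Y) = Pr X + Pr Y - Pr (X `&` Y).
Proof.
move=> mX mY; rewrite /Pr measureUfinl//; last first.
  by rewrite ltey_eq fin_num_measure.
rewrite fineB ?fin_numD ?fin_num_measure//; last exact: measurableI.
by rewrite fineD ?fin_num_measure.
Qed.

Definition npoints B (omega : Omega) : \bar R := counting (eta omega `&` B).

Definition empty_on B : set Omega := [set omega | eta omega `&` B = set0].

Lemma empty_onE B : empty_on B = npoints B @^-1` [set 0%E].
Proof. by apply/seteqP; split=> omega /= /counting_eq0. Qed.

Lemma measurable_npoints B : measurable B -> measurable_fun setT (npoints B).
Proof. by case: heta => + _ _ _; apply. Qed.

Lemma measurable_npoints_in B (S : set \bar R) : measurable B -> measurable S ->
  measurable (npoints B @^-1` S).
Proof.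
by move=> mB mS; rewrite -[X in measurable X]setTI; exact: measurable_npoints.
Qed.

Lemma measurable_empty_on B : measurable B -> measurable (empty_on B).
Proof. by move=> mB; rewrite empty_onE; apply: measurable_npoints_in. Qed.

Lemma prob_npoints B k : measurable B -> (mu B < +oo)%E ->
  P (npoints B @^-1` [set k%:R%:E]) = (poisson_weight (fine (mu B)) k)%:E.
Proof. by case: heta => _ h _ _ mB /h -/(_ mB k). Qed.

Lemma prob_empty_on B : measurable B -> (mu B < +oo)%E ->
  P (empty_on B) = (expR (- fine (mu B)))%:E.
Proof.
move=> mB Bfin; rewrite empty_onE (prob_npoints 0 mB Bfin) /poisson_weight.
by rewrite expr0 fact0 invr1 !mul1r.
Qed.

Lemma prob_npoints1 B : measurable B -> (mu B < +oo)%E ->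
  P (npoints B @^-1` [set 1%E]) = (mu B * P (empty_on B))%E.
Proof.
move=> mB Bfin; rewrite (prob_npoints 1 mB Bfin) prob_empty_on// /poisson_weight expr1.
by rewrite factS fact0 invr1 mulr1 EFinM fineK// ge0_fin_numE.
Qed.

Lemma prob_npoints_infty B : measurable B -> mu B = +oo%E ->
  P (npoints B @^-1` [set +oo%E]) = 1%E.
Proof. by case: heta => _ _ h _ mB /h -/(_ mB). Qed.

Lemma prob_empty_on_infty B : measurable B -> mu B = +oo%E -> P (empty_on B) = 0%E.
Proof.
move=> mB /(prob_npoints_infty mB) h; apply/eqP; rewrite eq_le measure_ge0 andbT.
have mi : measurable (npoints B @^-1` [set +oo%E]) by exact: measurable_npoints_in.
rewrite -[leRHS](subee (x := 1%E))// -[X in (_ <= _ - X)%E]h -probability_setC//.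
apply: le_measure; rewrite ?inE//.
- exact: measurable_empty_on.
- exact: measurableC.
- by rewrite empty_onE => omega /= ->.
Qed.

Lemma prob_empty_on_eq A B : measurable A -> measurable B -> mu A = mu B ->
  P (empty_on A) = P (empty_on B).
Proof.
move=> mA mB AB; have [Bfin|] := ltP (mu B) +oo%E.
  by rewrite !prob_empty_on// ?AB.
by rewrite leye_eq => /eqP Boo; rewrite !prob_empty_on_infty// AB.
Qed.

Definition some_empty_on (B : nat -> set T) (s : seq nat) : set Omega :=
  [set omega | exists2 i, i \in s & empty_on (B i) omega].

Lemma some_empty_on_nil B : some_empty_on B [::] = set0.
Proof. by apply/seteqP; split=> omega // -[]. Qed.

Lemma some_empty_on_cons B i s : some_empty_on B (i :: s) = empty_on (B i) `|` some_empty_on B s.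
Proof.
apply/seteqP; split=> omega /=.
  by move=> [j + Bj]; rewrite inE => /orP[/eqP <-|js]; [left|right; exists j].
move=> [Bi|[j js Bj]]; first by exists i => //; rewrite inE eqxx.
by exists j => //; rewrite inE js orbT.
Qed.

Lemma empty_onI A B : empty_on A `&` empty_on B = empty_on (A `|` B).
Proof.
apply/seteqP; split=> omega; rewrite /empty_on /= setIUr.
  by move=> [-> ->]; rewrite setU0.
by rewrite setU_eq0.
Qed.

Lemma empty_onI_some A B s :
  empty_on A `&` some_empty_on B s = some_empty_on (fun i => A `|` B i) s.
Proof.
apply/seteqP; split=> omega /=.
  by move=> [Ao [i si Bi]]; exists i => //; rewrite -empty_onI.
move=> [i si]; rewrite -empty_onI => -[Ao Bi]; split=> //.
by exists i.
Qed.

Lemma measurable_some_empty_on B s : (forall i, measurable (B i)) ->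
  measurable (some_empty_on B s).
Proof.
move=> mB; elim: s => [|i s IH]; first by rewrite some_empty_on_nil.
by rewrite some_empty_on_cons; apply: measurableU => //; exact: measurable_empty_on.
Qed.

Lemma independent_empty_on A B (S : set \bar R) : measurable A -> measurable B ->
  A `&` B = set0 -> measurable S ->
  P ((npoints A @^-1` S) `&` empty_on B) = (P (npoints A @^-1` S) * P (empty_on B))%E.
Proof.
case: heta => _ _ _ h mA mB AB mS.
pose F (i : 'I_2) := if i == ord0 then A else B.
pose G (i : 'I_2) : set \bar R := if i == ord0 then S else [set 0%E].
have := h 2%N F G.
rewrite big_ord_recl big_ord1 /F /G /= -!/(npoints _) -empty_onE => <-.
- congr (P _); apply/seteqP; split=> omega /=.
    by move=> [Ao Bo] i _; case: ifP => // _; rewrite /= -/(npoints _ _); move: Bo; rewrite empty_onE.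
  move=> h'; split; first exact: (h' ord0 I).
  by rewrite empty_onE; exact: (h' (lift ord0 ord0) I).
- by move=> i; case: ifP.
- apply/trivIsetP => i j _ _; case: (unliftP ord0 i) => [i'|] ->; case: (unliftP ord0 j) => [j'|] -> //=.
  + by rewrite (ord1 i') (ord1 j') eqxx.
  + by rewrite setIC.
- by move=> i; case: ifP.
Qed.

(** The event on the right is a finite union of events {no point in B i}, a
    family closed under intersection; inclusion-exclusion is an induction on the
    length of the union. *)
Lemma independent_some_empty_on A (S : set \bar R) B s : measurable A -> measurable S ->
  (forall i, measurable (B i)) -> (forall i, A `&` B i = set0) ->
  P ((npoints A @^-1` S) `&` some_empty_on B s) =
  (P (npoints A @^-1` S) * P (some_empty_on B s))%E.
Proof.
move=> mA mS; set E := npoints A @^-1` S.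
have mE : measurable E by exact: measurable_npoints_in.
suff key : forall s B, (forall i, measurable (B i)) ->
    (forall i, A `&` B i = set0) -> Pr (E `&` some_empty_on B s) = Pr E * Pr (some_empty_on B s).
  move=> mB AB; rewrite !PrE// ?key//; first exact: measurable_some_empty_on.
  by apply: measurableI => //; exact: measurable_some_empty_on.
elim=> [|i {}s IH] {}B mB AB; first by rewrite some_empty_on_nil setI0 /Pr measure0 mulr0.
have mBi := measurable_empty_on (mB i); have ms := measurable_some_empty_on s mB.
have mBB j : measurable (B i `|` B j) by exact: measurableU.
have ABB j : A `&` (B i `|` B j) = set0 by rewrite setIUr !AB setU0.
rewrite some_empty_on_cons setIUr !PrU//; try exact: measurableI.
rewrite setIACA setIid empty_onI_some !IH//.
have -> : Pr (E `&` empty_on (B i)) = Pr E * Pr (empty_on (B i)).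
  by rewrite /Pr independent_empty_on// fineM// fin_num_measure.
by ring.
Qed.

(** The probability of a void event depends on mu only, and by
    inclusion-exclusion so does that of a finite union of void events. *)
Lemma prob_some_empty_on_preimage (h : T -> T) B s : measurable_fun setT h ->
  (forall A, measurable A -> mu (h @^-1` A) = mu A) ->
  (forall i, measurable (B i)) ->
  P (some_empty_on (fun i => h @^-1` B i) s) = P (some_empty_on B s).
Proof.
move=> mh hmu mB.
have mhA A : measurable A -> measurable (h @^-1` A).
  by move=> mA; rewrite -[X in measurable X]setTI; exact: mh.
suff key : forall s B, (forall i, measurable (B i)) ->
    Pr (some_empty_on (fun i => h @^-1` B i) s) = Pr (some_empty_on B s).
  by rewrite !PrE ?key//; apply: measurable_some_empty_on => // i; exact: mhA.
elim=> [|i {}s IH] {}B {}mB; first by rewrite !some_empty_on_nil.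
have mBB j : measurable (B i `|` B j) by exact: measurableU.
rewrite !some_empty_on_cons !PrU//; try exact: measurable_some_empty_on;
  try (apply: measurable_empty_on => //; exact: mhA);
  try (apply: measurable_some_empty_on => // j; exact: mhA).
rewrite !empty_onI_some IH// -(IH (fun j => B i `|` B j))//.
congr (_ + _ - _); congr fine; apply: prob_empty_on_eq => //; first exact: mhA.
exact: hmu.
Qed.

Lemma prob_npoints_finite C : measurable C -> (mu C < +oo)%E ->
  P (npoints C @^-1` [set +oo%E]) = 0%E.
Proof.
move=> mC Cfin; pose F k := npoints C @^-1` [set k%:R%:E].
have mF k : measurable (F k) by exact: measurable_npoints_in.
have tF : trivIset setT F.
  apply/trivIsetP => i j _ _ ij; apply/seteqP; split=> // omega [].
  rewrite /F /= => -> []/eqP.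
  by rewrite eqr_nat (negbTE ij).
have mFU : measurable (\bigcup_k F k) by exact: bigcup_measurable.
have F1 : P (\bigcup_k F k) = 1%E.
  rewrite measure_semi_bigcup//.
  rewrite (eq_eseriesr (g := fun k => (poisson_weight (fine (mu C)) k)%:E)).
    by rewrite sum_poisson_weight// fine_ge0.
  by move=> k _; exact: prob_npoints.
rewrite (_ : _ @^-1` _ = ~` \bigcup_k F k); last first.
  apply/seteqP; split=> omega /=; first by move=> Noo [k _]; rewrite /F /= Noo.
  move=> nF; case: (counting_values (R := R) (eta omega `&` C)) => // -[k Nk].
  by exfalso; apply: nF; exists k.
by rewrite probability_setC// F1 subee.
Qed.

(** Off C, where the B i are, the process is independent of the number of its
    points in C, whose mean is mu C. *)
Lemma integral_npoints_some_empty_on C B s : measurable C -> (mu C < +oo)%E ->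
  (forall i, measurable (B i)) -> (forall i, C `&` B i = set0) ->
  (\int[P]_omega (npoints C omega * (\1_(some_empty_on B s) omega)%:E) =
   mu C * P (some_empty_on B s))%E.
Proof.
move=> mC Cfin mB CB; set V := some_empty_on B s.
have mV : measurable V by exact: measurable_some_empty_on.
pose F k := npoints C @^-1` [set k%:R%:E].
have mF k : measurable (F k) by exact: measurable_npoints_in.
pose g k omega := (k%:R * \1_(F k `&` V) omega)%:E : \bar R.
have g0 k omega : (0 <= g k omega)%E by rewrite lee_fin mulr_ge0.
have mg k : measurable_fun setT (g k).
  apply/measurable_EFinP; apply: measurable_funM => //; apply: measurable_indic.
  exact: measurableI.
have gsum omega k : npoints C omega = k%:R%:E ->
    (\sum_(j <oo) g j omega = npoints C omega * (\1_V omega)%:E)%E.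
  move=> Nk; rewrite (nneseriesD1 (n := k)) //=.
  rewrite eseries0; last first.
    move=> j _ jk; rewrite /g indicE memNset ?mulr0//= => -[+ _].
    rewrite /F /= Nk => -[]/eqP; rewrite eqr_nat => /eqP kj.
    by move: jk; rewrite kj eqxx.
  rewrite adde0 /g Nk -EFinM !indicE in_setI.
  by rewrite (_ : omega \in F k)//; apply/mem_set.
rewrite (ae_eq_integral (fun omega => \sum_(j <oo) g j omega)%E)//; last 3 first.
- apply: emeasurable_funM; first exact: measurable_npoints.
  by apply/measurable_EFinP; exact: measurable_indic.
- by apply: ge0_emeasurable_sum.
- exists (npoints C @^-1` [set +oo%E]); split.
  + exact: measurable_npoints_in.
  + exact: prob_npoints_finite.
  + move=> omega /= /not_implyP[_ neq].
    case: (counting_values (R := R) (eta omega `&` C)) => // -[k Nk].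
    by exfalso; apply: neq; rewrite (gsum _ k).
rewrite integral_nneseries//.
have mu0 : 0 <= fine (mu C) by rewrite fine_ge0.
rewrite (eq_eseriesr (g := fun k =>
   ((Pr V)%:E * (k%:R * poisson_weight (fine (mu C)) k)%:E)%E)); last first.
  move=> k _; rewrite /g.
  under eq_integral do rewrite EFinM.
  rewrite ge0_integralZl//; last first.
    by apply/measurable_EFinP; apply: measurable_indic; exact: measurableI.
  rewrite integral_indic//; last exact: measurableI.
  rewrite setIT.
  transitivity (k%:R%:E * (P (F k) * P V))%E.
    by congr (_ * _)%E; exact: independent_some_empty_on.
  rewrite prob_npoints// EFinM.
  by rewrite muleA muleC -PrE.
rewrite nneseriesZl; last by move=> k _; rewrite lee_fin mulr_ge0// poisson_weight_ge0.
by rewrite sum_mul_poisson_weight// -PrE// muleC fineK// ge0_fin_numE.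
Qed.

End poisson.

(** * The Mecke formula *)

Section mecke.
Context {R : realType} {disp disp' : measure_display}
  {Omega : measurableType disp} {T : measurableType disp'}.
Variables (P : probability Omega R) (m : {measure set T -> \bar R})
  (g : T -> \bar R) (mu : set T -> \bar R) (eta : Omega -> set T).
Hypothesis g_ge0 : forall x, (0 <= g x)%E.
Hypothesis mg : measurable_fun setT g.
Hypothesis muE : forall B, measurable B -> mu B = (\int[m]_(x in B) g x)%E.
Hypothesis mu_ge0 : forall B, (0 <= mu B)%E.
Hypothesis heta : poisson_process P mu eta.
Variables (D B : nat -> set T).
Hypothesis mD : forall i, measurable (D i).
Hypothesis mB : forall i, measurable (B i).
Hypothesis Dfin : forall i, (mu (D i) < +oo)%E.

(** The points x for which some B i holds no other point. The indices of s1 are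
    those for which D i has already been found to contain the set under
    consideration. *)
Definition lone (s1 s2 : seq nat) (omega : Omega) : set T :=
  [set x | (exists2 i, i \in s1 & eta omega `&` B i `<=` [set x]) \/
           (exists2 i, i \in s2 & D i x /\ eta omega `&` B i `<=` [set x])].

Definition covered (s1 s2 : seq nat) (x : T) : set Omega :=
  [set omega | some_empty_on eta B s1 omega \/
               exists2 i, i \in s2 & D i x /\ empty_on eta (B i) omega].

Let measurable_covered2 s1 s2 :
  measurable [set z : T * Omega | covered s1 s2 z.1 z.2].
Proof.
elim: s2 => [|i s2 IH].
  rewrite (_ : [set _ | _] = setT `*` some_empty_on eta B s1).
    by apply: measurableX => //; exact: measurable_some_empty_on heta _ _ mB.
  by apply/seteqP; split=> -[x omega] /=; [move=> [//|[]]|move=> [_]; left].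
rewrite (_ : [set _ | _] = [set z : T * Omega | covered s1 s2 z.1 z.2] `|`
    (D i `*` empty_on eta (B i))).
  apply: measurableU => //; apply: measurableX => //.
  exact: measurable_empty_on heta _ (mB i).
apply/seteqP; split=> -[x omega] /=.
  move=> [sx|[j + [Dj Bj]]]; first by left; left.
  by rewrite inE => /orP[/eqP <-|js]; [right|left; right; exists j].
move=> [[sx|[j js [Dj Bj]]]|[Di Bi]]; first by left.
  by right; exists j => //; rewrite inE js orbT.
by right; exists i => //; rewrite inE eqxx.
Qed.

Lemma measurable_prob_covered s1 s2 :
  measurable_fun setT (fun x => P (covered s1 s2 x)).
Proof.
rewrite (_ : (fun x => _) =
    P \o xsection [set z : T * Omega | covered s1 s2 z.1 z.2]).
  exact: measurable_fun_xsection.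
apply/funext => x /=; congr (P _).
by apply/seteqP; split=> omega; rewrite /xsection/= inE.
Qed.

Let cnt C s1 s2 omega : \bar R :=
  counting (eta omega `&` C `&` lone s1 s2 omega).

Let claim C s1 s2 := measurable_fun setT (cnt C s1 s2) /\
  (\int[P]_omega cnt C s1 s2 omega =
   \int[m]_(x in C) (P (covered s1 s2 x) * g x))%E.

Let measurable_integrand s1 s2 (C : set T) :
  measurable_fun C (fun x => P (covered s1 s2 x) * g x)%E.
Proof.
apply: measurable_funTS; apply: emeasurable_funM => //.
exact: measurable_prob_covered.
Qed.

(** The formula is additive in C, which allows to cut C along the sets D i and
    B i until [claim_base] applies to each piece. *)
Let claim_split C A s1 s2 : measurable C -> measurable A ->
  claim (C `&` A) s1 s2 -> claim (C `\` A) s1 s2 -> claim C s1 s2.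
Proof.
move=> mC mA [m1 e1] [m2 e2].
have cE : cnt C s1 s2 = (fun omega => cnt (C `&` A) s1 s2 omega +
                                      cnt (C `\` A) s1 s2 omega)%E.
  apply/funext => omega; rewrite /cnt -countingU.
    by rewrite -setIUl -setIUr setUIDK.
  by apply/seteqP; split=> // x [[[_ [_ Ax]] _] [[_ [_ nAx]] _]].
split; first by rewrite cE; exact: emeasurable_funD.
rewrite cE ge0_integralD//; try by move=> omega _; exact: counting_ge0.
rewrite e1 e2 -[in RHS](setUIDK C A) ge0_integral_setU//.
- exact: measurableI.
- exact: measurableD.
- by move=> x _; rewrite mule_ge0.
- by apply/disj_setPS => x [[_ Ax] [_ nAx]].
Qed.

Let claim_move C i s1 s2 : C `<=` D i -> claim C (i :: s1) s2 ->
  claim C s1 (i :: s2).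
Proof.
move=> CD [m1 e1].
have cE : cnt C s1 (i :: s2) = cnt C (i :: s1) s2.
  apply/funext => omega; rewrite /cnt; congr counting.
  apply/seteqP; split=> x [[ex Cx] h]; split=> //.
    case: h => [[j js jx]|[j]].
      by left; exists j => //; rewrite inE js orbT.
    rewrite inE => /orP[/eqP -> [_ ix]|js jx]; last by right; exists j.
    by left; exists i => //; rewrite inE eqxx.
  case: h => [[j]|[j js jx]]; last by right; exists j => //; rewrite inE js orbT.
  rewrite inE => /orP[/eqP -> ix|js jx]; last by left; exists j.
  by right; exists i; rewrite ?inE ?eqxx//; split=> //; exact: CD.
split; first by rewrite cE.
rewrite cE e1; apply: eq_integral => x /[!inE] Cx; congr (P _ * _)%E.
apply/seteqP; split=> omega.
  move=> [|[j js [Dj jx]]]; last by right; exists j => //; rewrite inE js orbT.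
  rewrite some_empty_on_cons => -[ix|sx]; last by left.
  by right; exists i; rewrite ?inE ?eqxx//; split=> //; exact: CD.
rewrite /covered /= some_empty_on_cons => -[sx|[j]]; first by left; right.
rewrite inE => /orP[/eqP -> [_ ix]|js jx]; last by right; exists j.
by left; left.
Qed.

Let claim_drop C i s1 s2 : C `&` D i = set0 -> claim C s1 s2 ->
  claim C s1 (i :: s2).
Proof.
move=> CD [m1 e1].
have nD x : C x -> ~ D i x by move=> Cx Dx; have : set0 x by rewrite -CD.
have cE : cnt C s1 (i :: s2) = cnt C s1 s2.
  apply/funext => omega; rewrite /cnt; congr counting.
  apply/seteqP; split=> x [[ex Cx] h]; split=> //.
    case: h => [sx|[j]]; first by left.
    rewrite inE => /orP[/eqP -> [/(nD _ Cx)//]|js jx]; by right; exists j.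
  case: h => [sx|[j js jx]]; first by left.
  by right; exists j => //; rewrite inE js orbT.
split; first by rewrite cE.
rewrite cE e1; apply: eq_integral => x /[!inE] Cx; congr (P _ * _)%E.
apply/seteqP; split=> omega.
  move=> [sx|[j js jx]]; first by left.
  by right; exists j => //; rewrite inE js orbT.
move=> [sx|[j]]; first by left.
by rewrite inE => /orP[/eqP -> [/(nD _ Cx)//]|js jx]; right; exists j.
Qed.

(** On a set C which each B i either contains or avoids, the number of lone
    points depends on the points in C only through their number: all of them
    are lone if some B i avoiding C is empty, and otherwise only a single point
    of C can be. The numbers of points in C and off C are independent. *)
Let claim_base C (s1 : seq nat) : measurable C ->
  (forall i, i \in s1 -> C `<=` D i /\ (C `<=` B i \/ C `&` B i = set0)) ->
  claim C s1 [::].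
Proof.
move=> mC hs.
have lone0 omega x : lone s1 [::] omega x <->
    exists2 i, i \in s1 & eta omega `&` B i `<=` [set x].
  by split=> [[//|[//]]|h]; left.
have cov0 x : covered s1 [::] x = some_empty_on eta B s1.
  by apply/seteqP; split=> omega; [move=> [//|[]]|left].
case: s1 hs lone0 cov0 => [|i0 s1'] hs lone0 cov0.
  have cE : cnt C [::] [::] = cst 0%E.
    apply/funext => omega; apply/counting_eq0.
    by apply/seteqP; split=> // x [_ /lone0[]].
  split; first by rewrite cE.
  rewrite cE integral0 integral0_eq// => x _.
  by rewrite cov0 some_empty_on_nil measure0 mul0e.
have Cfin : (mu C < +oo)%E.
  apply: le_lt_trans (Dfin i0); rewrite !muE//.
  apply: ge0_subset_integral => //; first exact: measurable_funTS.
  by have [] := hs i0 (mem_head _ _).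
move: (i0 :: s1') hs lone0 cov0 => {i0} {}s1' hs lone0 cov0.
pose B' i := B i `\` C.
have mB' i : measurable (B' i) by exact: measurableD.
have CB' i : C `&` B' i = set0.
  by apply/seteqP; split=> // x [Cx [_ /(_ Cx)]].
pose sa := [seq i <- s1' | `[< C `&` B i = set0 >]].
have saP i : i \in sa <-> C `&` B i = set0 /\ i \in s1'.
  by rewrite mem_filter; split=> [/andP[/asboolP]//|[h1 h2]]; apply/andP; split=> //; apply/asboolP.
have sB' i : C `&` B i = set0 -> B' i = B i.
  move=> CB; apply/seteqP; split=> x; first by move=> [].
  by move=> Bx; split=> // Cx; have : set0 x by rewrite -CB.
pose VA := some_empty_on eta B' sa; pose V := some_empty_on eta B' s1'.
have VAV : VA `<=` V.
  by move=> omega [i /saP[_ is1] iv]; exists i.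
have mVA : measurable VA by exact: measurable_some_empty_on heta _ _ mB'.
have mV : measurable V by exact: measurable_some_empty_on heta _ _ mB'.
pose N1 : set Omega := (npoints eta C : Omega -> \bar R) @^-1` [set 1%E].
have mN1 : measurable N1 by exact: (measurable_npoints_in heta).
pose f omega : \bar R := (npoints eta C omega * (\1_VA omega)%:E +
                 (\1_(N1 `&` (V `\` VA)) omega)%:E)%E.
have cE : cnt C s1' [::] = f.
  apply/funext => omega; rewrite /cnt /f !indicE.
  have [VAo|nVAo] := pselect (VA omega).
    rewrite mem_set// memNset; last by move=> [_ [_ /(_ VAo)]].
    rewrite mule1 adde0; congr counting.
    apply/seteqP; split=> x; first by move=> [].
    move=> [ex Cx]; split=> //; apply/lone0.
    have [i /saP[CB is1]] := VAo; rewrite sB'// => vi.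
    by exists i => //; rewrite vi.
  rewrite memNset// mule0 add0e.
  have [N1V|nN1V] := pselect ((N1 `&` V) omega).
    rewrite mem_set; last by case: N1V.
    have [/counting_eq1[x xE] [i is1 iv]] := N1V.
    rewrite (_ : _ `&` _ = [set x]) ?counting_set1//.
    rewrite -xE; apply/seteqP; split=> y; first by move=> [].
    move=> exy; split=> //; apply/lone0; exists i => // z [ez Bz].
    have -> : y = x by have : [set x] y by rewrite -xE.
    have [Cz|nCz] := pselect (C z); first by rewrite -xE.
    by have : set0 z by rewrite -iv.
  rewrite memNset; last by move=> [N1o [Vo _]]; apply: nN1V.
  apply/counting_eq0; apply/seteqP; split=> // y [[ey Cy] /lone0[i is1 iy]].
  have [CB|nCB] := pselect (C `&` B i = set0).
    apply: nVAo; exists i; first by apply/saP.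
    rewrite /empty_on /= sB'//; apply/seteqP; split=> // z ez.
    have := iy _ ez => /= zy; have : set0 y by rewrite -CB; split=> //; rewrite -zy; case: ez.
    by [].
  have [_ [CB|//]] := hs i is1.
  apply: nN1V; split.
    apply/counting_eq1; exists y; apply/seteqP; split=> z.
      by move=> [ez Cz]; apply: iy; split=> //; exact: CB.
    by move=> ->.
  exists i => //; apply/seteqP; split=> // z [ez [Bz nCz]].
  by apply: nCz; rewrite (iy z (conj ez Bz)).
have mf : measurable_fun setT f.
  apply: emeasurable_funD.
    apply: emeasurable_funM; first exact: (measurable_npoints heta).
    by apply/measurable_EFinP; exact: measurable_indic.
  apply/measurable_EFinP; apply: measurable_indic; apply: measurableI => //.
  exact: measurableD.
split; rewrite cE//.
rewrite /f ge0_integralD//; last 3 first.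
- by move=> omega _; rewrite mule_ge0// ?lee_fin//; exact: counting_ge0.
- apply: emeasurable_funM; first exact: (measurable_npoints heta).
  by apply/measurable_EFinP; exact: measurable_indic.
- apply/measurable_EFinP; apply: measurable_indic; apply: measurableI => //.
  exact: measurableD.
transitivity (mu C * P VA + P (N1 `&` (V `\` VA)))%E.
  rewrite (integral_npoints_some_empty_on mu_ge0 heta)//.
  rewrite integral_indic//; last by apply: measurableI => //; exact: measurableD.
  by rewrite setIT.
rewrite (eq_integral (fun x => P (some_empty_on eta B s1') * g x)%E); last first.
  by move=> x _; rewrite cov0.
rewrite ge0_integralZl//; last exact: measurable_funTS.
rewrite -muE//.
have Vtot : some_empty_on eta B s1' = VA `|` (empty_on eta C `&` V).
  apply/seteqP; split=> omega.
    move=> [i is1 iv]; have [CB|nCB] := pselect (C `&` B i = set0).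
      by left; exists i; [apply/saP|rewrite sB'].
    have [_ [CB|//]] := hs i is1; right; split.
      by apply/seteqP; split=> // z [ez Cz]; rewrite -iv; split=> //; exact: CB.
    exists i => //; apply/seteqP; split=> // z [ez [Bz _]].
    by rewrite -iv.
  move=> [[i /saP[CB is1]]|[vC [i is1 iv]]].
    by rewrite sB'// => iv; exists i.
  exists i => //; apply/seteqP; split=> // z [ez Bz].
  have [Cz|nCz] := pselect (C z); first by rewrite -vC.
  by rewrite -iv.
pose Pr E := fine (P E).
have PrE E : measurable E -> P E = (Pr E)%:E.
  by move=> mE; rewrite fineK// fin_num_measure.
have mC0 : measurable (empty_on eta C) by exact: (measurable_empty_on heta).
have PN1 : P N1 = (mu C * P (empty_on eta C))%E by exact: (prob_npoints1 mu_ge0 heta).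
have PNV W : measurable W -> W = VA \/ W = V ->
    P (N1 `&` W) = (P N1 * P W)%E /\
    P (empty_on eta C `&` W) = (P (empty_on eta C) * P W)%E.
  move=> mW hW.
  have [s ->] : exists s, W = some_empty_on eta B' s by case: hW => ->; eexists.
  rewrite (empty_onE (R := R)).
  by split; apply: (independent_some_empty_on heta).
have [PNA PCA] := PNV _ mVA (or_introl erefl).
have [PNVV PCV] := PNV _ mV (or_intror erefl).
have -> : P (N1 `&` (V `\` VA)) = (P N1 * (P V - P VA))%E.
  transitivity (P (N1 `&` V) - P (N1 `&` VA))%E.
    rewrite setIDA measureD//; first last.
    - by rewrite ltey_eq fin_num_measure//; exact: measurableI.
    - exact: measurableI.
    by congr (_ - P _)%E; rewrite -setIA (_ : V `&` VA = VA)//; apply/setIidPr.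
  rewrite PNVV PNA !PrE//.
  by rewrite -!(EFinM, EFinB); congr EFin; ring.
transitivity (P (VA `|` (empty_on eta C `&` V)) * mu C)%E; last by rewrite Vtot.
transitivity ((P VA + P (empty_on eta C `&` V) - P (empty_on eta C `&` VA)) * mu C)%E;
  last first.
  congr (_ * _)%E; rewrite measureUfinl//; last 2 first.
  - exact: measurableI.
  - by rewrite ltey_eq fin_num_measure.
  by congr (_ - P _)%E; rewrite setICA (_ : VA `&` V = VA)//; apply/setIidPl.
rewrite PCV PCA PN1 !PrE//.
have -> : mu C = (fine (mu C))%:E by rewrite fineK// ge0_fin_numE.
by rewrite -!(EFinM, EFinB, EFinD); congr EFin; ring.
Qed.

(** The Mecke formula for the points that satisfy one of finitely many
    conditions D i x, no further point in B i: the mean number of these points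
    in C is the integral over C of the probability that the process itself
    satisfies one of the conditions, with respect to the intensity. *)
Lemma mecke C (s : seq nat) : measurable C ->
  measurable_fun setT (fun omega => counting
    [set x | [/\ eta omega x, C x & exists2 i, i \in s &
                D i x /\ eta omega `&` B i `<=` [set x]]] : \bar R) /\
  (\int[P]_omega counting
    [set x | [/\ eta omega x, C x & exists2 i, i \in s &
                D i x /\ eta omega `&` B i `<=` [set x]]] =
  \int[m]_(x in C) (P [set omega | exists2 i, i \in s &
                        D i x /\ empty_on eta (B i) omega] * g x))%E.
Proof.
move=> mC.
suff : claim C [::] s.
  rewrite /claim /cnt (_ : (fun omega => _) = fun omega => counting
    [set x | [/\ eta omega x, C x & exists2 i, i \in s &
                D i x /\ eta omega `&` B i `<=` [set x]]]).
    move=> [m1 e1]; split=> //; rewrite e1; apply: eq_integral => x _.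
    congr (P _ * _)%E; apply/seteqP; split=> omega; last by right.
    by move=> [[]//|].
  apply/funext => omega; congr counting; apply/seteqP; split=> x.
    by move=> [[ex Cx] [[]//|h]].
  by move=> [ex Cx h]; split=> //; right.
have : forall i, i \in ([::] : seq nat) -> C `<=` D i /\ (C `<=` B i \/ C `&` B i = set0) by [].
elim: s [::] C mC => [|i s IH] s1 C mC h; first exact: claim_base.
apply: (claim_split mC (mD i)); last first.
  apply: claim_drop; last first.
    apply: IH; first exact: measurableD.
    move=> j /h[CD CB]; split=> [x [/CD]//|].
    case: CB => CB; first by left=> x [/CB].
    by right; apply/seteqP; split=> // x [[Cx _] Bx]; rewrite -CB.
  by apply/seteqP; split=> // x [[]].
have mCD : measurable (C `&` D i) by exact: measurableI.
have hI A : measurable A -> (A `<=` B i \/ (C `&` D i `&` A) `&` B i = set0) ->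
    claim (C `&` D i `&` A) s1 (i :: s).
  move=> mA hA; apply: claim_move; first by move=> x [[]].
  apply: IH; first exact: measurableI.
  move=> j; rewrite inE => /orP[/eqP ->|/h[CD CB]].
    split; first by move=> x [[]].
    by case: hA => [AB|hA]; [left=> x [_ /AB]|right].
  split; first by move=> x [[/CD]].
  case: CB => CB; first by left=> x [[/CB]].
  by right; apply/seteqP; split=> // x [[[Cx _] _] Bx]; rewrite -CB.
apply: (claim_split mCD (mB i)); first by apply: hI => //; left.
rewrite setDE; apply: hI; first exact: measurableC.
by right; apply/seteqP; split=> // x [[_ nB]].
Qed.

End mecke.

(** * Half-balls *)

Section half_balls.
Context {R : realType} {n : nat}.
Local Notation point := ('rV[R]_n * R)%type.
Implicit Types (p q x : point) (w : 'rV[R]_n).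

(** A half-ball is encoded as its centre and the square of its radius. *)
Definition half_ball (c : point) : set point := [set p | sqdist c.1 p < c.2].

Definition rational_ball (i : nat) : point :=
  if @unpickle ('rV[rat]_n * rat)%type i is Some c then
    (map_mx ratr c.1, ratr c.2) else (0, 0).

Lemma rat_approx (a b : R) : a < b -> exists q : rat, a < ratr q < b.
Proof.
by move=> ab; have [q] := rat_in_itvoo ab; rewrite in_itv/= => qab; exists q.
Qed.

Lemma rational_rV_approx w (d : R) : 0 < d ->
  exists w' : 'rV[rat]_n, sqnorm2 (w - map_mx ratr w') < d.
Proof.
move=> d0; pose h := Num.min 1 (d / n.+1%:R).
have h0 : 0 < h by rewrite lt_min ltr01 divr_gt0.
have h1 : h <= 1 by rewrite ge_min lexx.
have hd : h <= d / n.+1%:R by rewrite ge_min lexx orbT.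
have /choice[f fP] : forall i, exists q : rat, w 0 i - h < ratr q < w 0 i + h.
  by move=> i; apply: rat_approx; lra.
exists (\row_i f i); rewrite /sqnorm2.
apply: (@le_lt_trans _ _ (\sum_(i < n) d / n.+1%:R)).
  apply: ler_sum => i _; rewrite !mxE; apply: le_trans hd.
  have /andP[f1 f2] := fP i.
  have fh : `|w 0 i - ratr (f i)| <= h by rewrite ler_norml; apply/andP; split; lra.
  rewrite -real_normK ?num_real// expr2.
  by apply: le_trans (ler_pM _ _ fh fh) _; rewrite // ler_piMl// ltW.
rewrite sumr_const card_ord -[_ *+ _]mulr_natl mulrCA.
rewrite gtr_pMr// ltr_pdivrMr ?mul1r ?ltr_nat//.
Qed.

Lemma sqdist_change w w' p (e : R) : 0 < e ->
  sqdist w p <= (1 + e) * sqdist w' p + (1 + e^-1) * sqnorm2 (w' - w).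
Proof.
move=> e0; rewrite /sqdist.
have -> : p.1 - w = (p.1 - w') + (w' - w) by rewrite addrA subrK.
move: (p.1 - w') (w' - w) => a b.
have Y := dot_Young a b e0; have := ler_norm (2 * dot a b).
have ep : 0 <= e * p.2 ^+ 2 by rewrite mulr_ge0 ?sqr_ge0// ltW.
rewrite [sqnorm2 (a + b)]sqnorm2E !dotDl !dotDr -!sqnorm2E (dotC b a).
by lra.
Qed.

(** Density of the rational half-balls: it turns the uncountable union over all
    half-balls, in the definition of exposed points, into a countable one. *)
Lemma rational_ball_between w (s : R) x : sqdist w x < s ->
  exists2 i, half_ball (rational_ball i) x &
    half_ball (rational_ball i) `<=` half_ball (w, s).
Proof.
move=> xs; pose t := sqdist w x; pose D := s - t.
have t0 : 0 <= t by exact: sqdist_ge0.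
have D0 : 0 < D by rewrite subr_gt0.
have s0 : 0 < s by exact: le_lt_trans xs.
pose e := D / (6 * (s + 1)).
have s1 : 0 < 6 * (s + 1) by rewrite mulr_gt0// addr_gt0.
have e0 : 0 < e by rewrite divr_gt0.
have es : e * s <= D / 6.
  have -> : e * s = D / 6 * (s / (s + 1)).
    by rewrite /e; field; rewrite gt_eqF// addr_gt0.
  rewrite ler_piMr ?divr_ge0 ?(ltW D0)//.
  by rewrite ler_pdivrMr ?mul1r ?lerDl// addr_gt0.
have c0 : 0 < 1 + e^-1 by rewrite addr_gt0// invr_gt0.
have [w' w'w] := @rational_rV_approx w (D / 6 / (1 + e^-1))
  ltac:(by rewrite !divr_gt0).
have cw : (1 + e^-1) * sqnorm2 (w - map_mx ratr w') < D / 6.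
  by rewrite mulrC -ltr_pdivlMr.
have cw' : (1 + e^-1) * sqnorm2 (map_mx ratr w' - w) < D / 6.
  by rewrite -opprB sqnorm2E dotNl dotNr opprK -sqnorm2E.
have [s' /andP[s'1 s'2]] := @rat_approx (t + D / 3) (t + 2 * D / 3) ltac:(lra).
have s's : ratr s' <= s by rewrite /D in s'2; lra.
have es' : e * ratr s' <= D / 6 by apply: le_trans es; rewrite ler_pM2l.
have et : e * t <= D / 6 by apply: le_trans es; rewrite ler_pM2l// ltW.
exists (pickle (w', s')); rewrite /half_ball /rational_ball pickleK/=.
  have := sqdist_change (map_mx ratr w') w x e0; rewrite -/t => h.
  apply: le_lt_trans h _; lra.
move=> p /= ps; have := sqdist_change w (map_mx ratr w') p e0 => h.
apply: le_lt_trans h _.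
have h1 : (1 + e) * sqdist (map_mx ratr w') p < (1 + e) * ratr s'.
  by rewrite ltr_pM2l// addr_gt0.
by rewrite /D in cw' es' s'1 s'2 D0 *; lra.
Qed.

Lemma measurable_sqdist w : measurable_fun setT (sqdist w : point -> R).
Proof.
apply: measurable_funD; last first.
  by apply: measurable_funX; exact: measurable_snd.
apply: measurable_sum => i; apply: measurable_funX.
rewrite (_ : (fun p => _) = fun p : point => p.1 0 i - w 0 i).
  apply: measurable_funB => //.
  exact: (measurableT_comp (measurable_coord_rV i) measurable_fst).
by apply/funext => p; rewrite !mxE.
Qed.

Lemma measurable_half_ball (c : point) : measurable (half_ball c).
Proof.
rewrite (_ : half_ball c = sqdist c.1 @^-1` `]-oo, c.2[%classic).
  by rewrite -[X in measurable X]setTI; apply: measurable_sqdist.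
by apply/seteqP; split=> p; rewrite /half_ball/= in_itv.
Qed.

Lemma measurable_horoball (lambda : R) : measurable (horoball lambda : set point).
Proof.
rewrite (_ : horoball lambda = snd @^-1` `[lambda, +oo[%classic).
  by rewrite -[X in measurable X]setTI; apply: measurable_snd.
by apply/seteqP; split=> p; rewrite /horoball/= in_itv/= andbT.
Qed.

(** Such a set is contained in a cylinder over a cube. *)
Lemma hyp_vol_box_lty (lambda M : R) (A : set point) : (0 < n)%N -> 0 < lambda ->
  (forall p, A p -> lambda <= p.2 /\ forall i, `|p.1 0 i| <= M) ->
  (hyp_vol A < +oo)%E.
Proof.
move=> n0 l0 AM.
pose W := [set v : 'rV[R]_n | forall i, (`[- M, M]%classic : set R) (v 0 i)].
have mW : measurable W by apply: (@measurable_rV_all R n (fun=> `[- M, M]%classic)).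
apply: (@le_lt_trans _ _ (hyp_vol (cylinder lambda W))).
  apply: le_hyp_vol => p /AM[p2 p1]; split; last by rewrite /= in_itv/= p2.
  by move=> i; rewrite /= in_itv/= -ler_norml.
rewrite hyp_vol_cylinder// lte_mul_pinfty ?measure_ge0//.
  by rewrite ge0_fin_numE ?measure_ge0//; exact: lebesgue_rV_box_lty.
by rewrite ltry.
Qed.

Lemma sqdist_bounded w (M : R) p : sqdist w p <= M ->
  (forall i, `|p.1 0 i - w 0 i| <= Num.sqrt M) /\ p.2 <= Num.sqrt M.
Proof.
move=> pM; have M0 : 0 <= M by exact: le_trans (sqdist_ge0 w p) pM.
have sM : Num.sqrt M ^+ 2 = M by rewrite sqr_sqrtr.
split=> [i|].
  have -> : p.1 0 i - w 0 i = (p.1 - w) 0 i by rewrite !mxE.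
  apply: normr_coord_le; first exact: sqrtr_ge0.
  by rewrite sM; apply: le_trans pM; rewrite lerDl sqr_ge0.
apply: le_trans (ler_norm _) _.
rewrite -(@ler_pXn2r _ 2%N) ?nnegrE ?sqrtr_ge0// real_normK ?num_real// sM.
by apply: le_trans pM; rewrite lerDr sqnorm2_ge0.
Qed.

Lemma sqdist_bounded_coord w (M : R) p : sqdist w p <= M ->
  forall i, `|p.1 0 i| <= Num.sqrt M + \sum_j `|w 0 j|.
Proof.
move=> /sqdist_bounded[pw _] i.
rewrite -[p.1 0 i](subrK (w 0 i)); apply: le_trans (ler_normD _ _) _.
by apply: lerD => //; rewrite (bigD1 i)//= lerDl sumr_ge0.
Qed.

Lemma sqdist_compact (lambda : R) w (M : R) :
  compact ([set v : 'rV[R]_n | forall i,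
    (`[w 0 i - Num.sqrt M, w 0 i + Num.sqrt M]%classic : set R) (v 0 i)] `*`
    `[lambda, Num.sqrt M]%classic).
Proof.
apply: compact_setX; last exact: segment_compact.
by apply: (@rV_compact _ n (fun i => `[w 0 i - Num.sqrt M, w 0 i + Num.sqrt M]%classic));
  move=> i; exact: segment_compact.
Qed.

End half_balls.

(** * The probability of being exposed *)

Section exposed_points.
Context {R : realType} {disp : measure_display} {Omega : measurableType disp}.
Variables (P : probability Omega R) (n : nat) (gamma : R).
Local Notation point := ('rV[R]_n * R)%type.
Variable eta : Omega -> set point.
Hypothesis gamma_gt0 : 0 < gamma.
Hypothesis heta : hyp_poisson_process P gamma eta.
Implicit Types (p q x : point) (w : 'rV[R]_n) (lambda : R).

Definition hyp_intensity (B : set point) : \bar R := (gamma%:E * hyp_vol B)%E.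

Lemma hyp_intensity_ge0 B : (0 <= hyp_intensity B)%E.
Proof. by rewrite mule_ge0 ?hyp_vol_ge0// lee_fin ltW. Qed.

Lemma hyp_poisson : poisson_process P hyp_intensity eta.
Proof. by case: heta. Qed.

Lemma hyp_intensity_hsim (a : R) (b : 'rV[R]_n) B : 0 < a -> measurable B ->
  hyp_intensity (hsim a b @^-1` B) = hyp_intensity B.
Proof. by move=> a0 mB; rewrite /hyp_intensity hyp_vol_hsim. Qed.

Definition ball_in_horoball lambda i : set point :=
  half_ball (rational_ball i) `&` horoball lambda.

Lemma measurable_ball_in_horoball lambda i : measurable (ball_in_horoball lambda i).
Proof.
by apply: measurableI; [exact: measurable_half_ball|exact: measurable_horoball].
Qed.

(** Up to vertical scalings close to 1, the complement of the hull. *)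
Definition exposed lambda omega : set point :=
  covered_by_empty_ball (eta omega `&` horoball lambda).

Lemma sqdist_hsim (a : R) b w p :
  sqdist (a *: w + b) (hsim a b p) = a ^+ 2 * sqdist w p.
Proof.
rewrite /sqdist /hsim /= opprD addrACA subrr addr0 -scalerBr !sqnorm2E !dotE.
by rewrite exprMn; ring.
Qed.

(** The similarity is applied to the half-balls rather than to the process, so
    that both sides of [prob_exposed_hsim] become unions of void events with the
    same indices. *)
Lemma exposed_hsimE (a : R) (b : 'rV[R]_n) lambda omega x : 0 < a ->
  exposed lambda omega x <->
  exists2 i, half_ball (rational_ball i) (hsim a b x) &
    empty_on eta (hsim a b @^-1` ball_in_horoball (a * lambda) i) omega.
Proof.
move=> a0; have a20 : 0 < a ^+ 2 by rewrite exprn_gt0.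
split=> [[w [s [xs Xs]]]|[i xi vi]].
  have xs' : sqdist (a *: w + b) (hsim a b x) < a ^+ 2 * s.
    by rewrite sqdist_hsim ltr_pM2l.
  have [i xi iw] := rational_ball_between xs'; exists i => //.
  apply/seteqP; split=> // p [ep [/iw ip hp]].
  have : s <= sqdist w p.
    by apply: Xs; split=> //; move: hp; rewrite /horoball/= ler_pM2l.
  by move: ip; rewrite /half_ball/= sqdist_hsim ltr_pM2l// ltNge => /negP.
pose w := a^-1 *: ((rational_ball i).1 - b).
pose s := (@rational_ball R n i).2 / a ^+ 2.
have wE : (rational_ball i).1 = a *: w + b.
  by rewrite /w scalerA divff ?gt_eqF// scale1r subrK.
exists w, s; split.
  by move: xi; rewrite /half_ball/= wE sqdist_hsim mulrC -ltr_pdivlMr.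
move=> p [ep hp]; rewrite leNgt; apply/negP => ps.
have : (eta omega `&` hsim a b @^-1` ball_in_horoball (a * lambda) i) p.
  split=> //; split; last by rewrite /horoball/= ler_pM2l.
  by rewrite /half_ball/= wE sqdist_hsim mulrC -ltr_pdivlMr.
by rewrite vi.
Qed.

Lemma hsim1 : hsim (1 : R) (0 : 'rV[R]_n) = id.
Proof.
by apply/funext => p; rewrite /hsim scale1r addr0 mul1r -surjective_pairing.
Qed.

Lemma exposedE lambda omega x : exposed lambda omega x <->
  exists2 i, half_ball (rational_ball i) x &
    empty_on eta (ball_in_horoball lambda i) omega.
Proof.
have := exposed_hsimE 0 lambda omega x ltr01.
by rewrite hsim1 mul1r.
Qed.

Lemma measurable_exposed2 lambda :
  measurable [set z : point * Omega | exposed lambda z.2 z.1].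
Proof.
rewrite (_ : [set _ | _] = \bigcup_i
    (half_ball (rational_ball i) `*` empty_on eta (ball_in_horoball lambda i))).
  apply: bigcup_measurable => i _; apply: measurableX.
    exact: measurable_half_ball.
  by apply: (measurable_empty_on hyp_poisson); exact: measurable_ball_in_horoball.
apply/seteqP; split=> -[x omega] /=.
  by move=> /exposedE[i xi vi]; exists i.
by move=> [i _ [xi vi]]; apply/exposedE; exists i.
Qed.

Definition prob_exposed lambda x : \bar R := P [set omega | exposed lambda omega x].

Lemma exposed_xsection lambda x :
  [set omega | exposed lambda omega x] =
  xsection [set z : point * Omega | exposed lambda z.2 z.1] x.
Proof. by apply/seteqP; split=> omega; rewrite /xsection/= inE. Qed.

Lemma measurable_exposed lambda x : measurable [set omega | exposed lambda omega x].
Proof.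
by rewrite exposed_xsection; apply: measurable_xsection; exact: measurable_exposed2.
Qed.

Lemma measurable_prob_exposed lambda : measurable_fun setT (prob_exposed lambda).
Proof.
rewrite (_ : prob_exposed lambda =
    P \o xsection [set z : point * Omega | exposed lambda z.2 z.1]).
  by apply: measurable_fun_xsection; exact: measurable_exposed2.
by apply/funext => x /=; rewrite -exposed_xsection.
Qed.

(** Continuity from below, which reduces exposure to finitely many
    half-balls. *)
Lemma prob_exists_empty_on (Q : nat -> Prop) (B : nat -> set point) :
  (forall i, measurable (B i)) ->
  P (some_empty_on eta B [seq i <- iota 0 k | `[< Q i >]]) @[k --> \oo] -->
  P [set omega | exists2 i, Q i & empty_on eta (B i) omega].
Proof.
move=> mB; set F := fun k => some_empty_on eta B [seq i <- iota 0 k | `[< Q i >]].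
have mF k : measurable (F k) by exact: (measurable_some_empty_on hyp_poisson).
have FU : \bigcup_k F k = [set omega | exists2 i, Q i & empty_on eta (B i) omega].
  apply/seteqP; split=> omega.
    move=> [k _ [i]]; rewrite mem_filter => /andP[/asboolP Qi _] vi.
    by exists i.
  move=> [i Qi vi]; exists i.+1 => //; exists i => //.
  by rewrite mem_filter mem_iota/= add0n ltnSn andbT; apply/asboolP.
rewrite -FU; apply: nondecreasing_cvg_mu; first exact: mF.
  by apply: bigcup_measurable => k _; exact: mF.
move=> k l kl; apply/subsetPset => omega [i].
rewrite mem_filter mem_iota/= add0n => /andP[Qi ik] vi; exists i => //.
by rewrite mem_filter Qi mem_iota/= add0n; exact: leq_trans ik kl.
Qed.

(** The isometries [hsim] preserve the intensity, hence by
    [prob_some_empty_on_preimage] the probabilities of unions of void events. *)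
Lemma prob_exposed_hsim (a : R) (b : 'rV[R]_n) lambda x : 0 < a ->
  prob_exposed lambda x = prob_exposed (a * lambda) (hsim a b x).
Proof.
move=> a0; pose Q i := half_ball (rational_ball i) (hsim a b x).
pose B := ball_in_horoball (a * lambda).
have mB i : measurable (B i) by exact: measurable_ball_in_horoball.
rewrite /prob_exposed.
have -> : [set omega | exposed lambda omega x] =
    [set omega | exists2 i, Q i & empty_on eta (hsim a b @^-1` B i) omega].
  by apply/seteqP; split=> omega /(exposed_hsimE b lambda omega x a0).
have -> : [set omega | exposed (a * lambda) omega (hsim a b x)] =
    [set omega | exists2 i, Q i & empty_on eta (B i) omega].
  by apply/seteqP; split=> omega /exposedE.
have mB' i : measurable (hsim a b @^-1` B i).
  by rewrite -[X in measurable X]setTI; exact: measurable_hsim.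
have h1 := @prob_exists_empty_on Q _ mB'; have h2 := @prob_exists_empty_on Q _ mB.
have E k : P (some_empty_on eta (fun i => hsim a b @^-1` B i)
      [seq i <- iota 0 k | `[< Q i >]]) =
    P (some_empty_on eta B [seq i <- iota 0 k | `[< Q i >]]).
  apply: (prob_some_empty_on_preimage hyp_poisson) => //.
    exact: measurable_hsim.
  by move=> A mA; exact: hyp_intensity_hsim.
rewrite (funext E) in h1.
exact: cvg_unique h1 h2.
Qed.

Definition exposure (u : R) : \bar R := prob_exposed 1 (0, u).

(** The isometries [hsim] act transitively; the one that maps the horoball at
    height lambda to that at height 1 is unique up to a translation. *)
Lemma prob_exposedE lambda x : 0 < lambda ->
  prob_exposed lambda x = exposure (lambda^-1 * x.2)%R.
Proof.
move=> l0; rewrite (@prob_exposed_hsim lambda^-1 (- (lambda^-1 *: x.1))) ?invr_gt0//.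
by rewrite mulVf ?gt_eqF// /hsim subrr.
Qed.

Lemma exposure_ge0 u : (0 <= exposure u)%E.
Proof. exact: measure_ge0. Qed.

Lemma exposure_le1 u : (exposure u <= 1)%E.
Proof. by apply: probability_le1; exact: measurable_exposed. Qed.

Lemma measurable_exposure : measurable_fun setT exposure.
Proof.
apply: (measurableT_comp (measurable_prob_exposed 1)).
by apply: measurable_fun_pair.
Qed.

End exposed_points.

Section exposure_integrals.
Context {R : realType} {disp : measure_display} {Omega : measurableType disp}.
Variables (P : probability Omega R) (n : nat) (gamma : R).
Local Notation point := ('rV[R]_n * R)%type.
Local Notation L := (lebesgue_rV n \x @lebesgue_R R)%E.
Variable eta : Omega -> set point.
Hypothesis gamma_gt0 : 0 < gamma.
Hypothesis n_gt0 : (0 < n)%N.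
Hypothesis heta : hyp_poisson_process P gamma eta.

Let weight (y : R) : \bar R := (exposure P eta y * (decay n y)%:E)%E.

Let weight_ge0 y : (0 <= weight y)%E.
Proof. by rewrite mule_ge0 ?exposure_ge0// lee_fin decay_ge0. Qed.

Let measurable_decayE : measurable_fun setT (fun y : R => (decay n y)%:E).
Proof. by apply/measurable_EFinP; exact: measurable_decay. Qed.

Let measurable_weight : measurable_fun setT weight.
Proof.
by apply: emeasurable_funM => //; exact: measurable_exposure heta.
Qed.

Let weight_le y : (weight y <= (decay n y)%:E)%E.
Proof.
rewrite /weight -[leRHS]mul1e; apply: lee_wpmul2r.
  by rewrite lee_fin decay_ge0.
exact: (exposure_le1 heta).
Qed.

(** The mean volume, per unit of base area, of the exposed points at height at
    least 1 when the points of the process below height 1 are discarded. *)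
Definition total_exposure : R :=
  fine (\int[@lebesgue_R R]_(u in `[1%R, +oo[) weight u)%E.

Lemma total_exposureE :
  (\int[@lebesgue_R R]_(u in `[1%R, +oo[) weight u = total_exposure%:E)%E.
Proof.
rewrite /total_exposure fineK// ge0_fin_numE; last by rewrite integral_ge0.
apply: (@le_lt_trans _ _ (\int[@lebesgue_R R]_(y in `[1%R, +oo[) (decay n y)%:E)%E).
  by apply: ge0_le_integral => //; exact: measurable_funTS.
by rewrite integral_decay// ltry.
Qed.

(** Substitution of y by lambda y in [prob_exposedE]. *)
Lemma integral_prob_exposed (lambda : R) (W : set 'rV[R]_n) :
  0 < lambda -> measurable W ->
  (\int[L]_(x in cylinder lambda W) (prob_exposed P eta lambda x * hyp_density x) =
   lebesgue_rV n W * (lambda ^- n * total_exposure)%:E)%E.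
Proof.
move=> l0 mW.
rewrite (eq_integral (fun x => (fun y => exposure P eta (lambda^-1 * y)) x.2 *
    hyp_density x)%E); last by move=> x _; rewrite (prob_exposedE heta).
rewrite (@integral_cylinder R n lambda W
  (fun y => exposure P eta (lambda^-1 * y)))//; last first.
  apply: (measurableT_comp (f := exposure P eta) (g := fun y : R => lambda^-1 * y)).
    exact: (measurable_exposure heta).
  exact: measurable_funM.
rewrite (integral_decay_scale _ (psi := exposure P eta)) ?invr_gt0//; last first.
  exact: (measurable_exposure heta).
by rewrite mulVf ?gt_eqF// total_exposureE -EFinM exprVn.
Qed.

(** After the substitution the integral starts from rho instead of 1; between
    rho and 1 the probability is at most 1, which costs at most
    (1 - rho^n) / n. *)
Lemma integral_prob_exposed_vscale (lambda rho : R) (W : set 'rV[R]_n) :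
  0 < lambda -> 0 < rho < 1 -> measurable W ->
  (\int[L]_(x in cylinder lambda W)
     (prob_exposed P eta lambda (vscale rho x) * hyp_density x) <=
   lebesgue_rV n W * (lambda ^- n * (total_exposure + (1 - rho ^+ n) / n%:R))%:E)%E.
Proof.
move=> l0 /andP[rho0 rho1] mW; have k0 : 0 < rho / lambda by rewrite divr_gt0.
rewrite (eq_integral (fun x => (fun y => exposure P eta (rho / lambda * y)) x.2 *
    hyp_density x)%E); last first.
  by move=> x _; rewrite (prob_exposedE heta)//= mulrA (mulrC rho).
rewrite (@integral_cylinder R n lambda W
  (fun y => exposure P eta (rho / lambda * y)))//; last first.
  apply: (measurableT_comp (f := exposure P eta) (g := fun y : R => rho / lambda * y)).
    exact: (measurable_exposure heta).
  exact: measurable_funM.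
rewrite lee_wpmul2l//.
rewrite (integral_decay_scale _ (psi := exposure P eta))//; last first.
  exact: (measurable_exposure heta).
rewrite divfK ?gt_eqF//.
have split_itv : `[rho, +oo[%classic = `[rho, 1[%classic `|` `[1, +oo[%classic :> set R.
  apply/seteqP; split=> y /=; rewrite !in_itv/= ?andbT.
    by move=> ->; case: (ltP y 1) => ?; [left|right].
  by move=> [/andP[]//|y1]; rewrite (le_trans _ y1)// ltW.
have disj : [disjoint `[rho, 1[%classic & (`[1, +oo[%classic : set R)]%classic.
  apply/disj_setPS => y [] /=; rewrite !in_itv/= andbT => /andP[_ y1] y1'.
  by move: y1; rewrite ltNge y1'.
have dE : (\int[@lebesgue_R R]_(y in `[rho, 1%R[) (decay n y)%:E =
    ((rho ^- n - 1) / n%:R)%:E)%E.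
  have := @integral_decay R n rho n_gt0 rho0.
  rewrite split_itv ge0_integral_setU//; last 2 first.
  - exact: measurable_funTS.
  - by move=> y _; rewrite lee_fin decay_ge0.
  rewrite integral_decay// expr1n invr1.
  case: (\int[_]_(_ in `[rho, 1%R[) _)%E => [r|//|//] /= [rE].
  by congr EFin; rewrite mulrBl -rE addrK.
apply: (@le_trans _ _ (((rho / lambda) ^+ n)%:E *
    (((rho ^- n - 1) / n%:R)%:E + total_exposure%:E))%E).
  rewrite lee_wpmul2l ?lee_fin ?exprn_ge0 ?(ltW k0)//.
  rewrite -[leLHS]/(\int[@lebesgue_R R]_(y in `[rho, +oo[) weight y)%E split_itv ge0_integral_setU//; last exact: measurable_funTS.
  rewrite total_exposureE leeD2r// -dE; apply: ge0_le_integral => //.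
  - exact: measurable_funTS.
  - exact: measurable_funTS.
have c0 : 0 <= total_exposure.
  by rewrite fine_ge0// integral_ge0.
rewrite -EFinD -EFinM lee_fin.
have -> : ((rho / lambda) ^+ n * ((rho ^- n - 1) / n%:R + total_exposure) =
    lambda ^- n * (rho ^+ n * total_exposure + (1 - rho ^+ n) / n%:R))%R.
  have nR : n%:R != 0 :> R by rewrite pnatr_eq0 -lt0n.
  have rho_neq0 : rho ^+ n != 0 by rewrite expf_neq0// gt_eqF.
  have l_neq0 : lambda ^+ n != 0 by rewrite expf_neq0// gt_eqF.
  by rewrite expr_div_n; field; rewrite nR rho_neq0 l_neq0.
rewrite ler_wpM2l ?invr_ge0 ?exprn_ge0 ?(ltW l0)// lerD2r ler_piMl//.
by rewrite exprn_ile1// ltW.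
Qed.

End exposure_integrals.

(** * Comparison of means *)

Section almost_sure_comparison.
Local Open Scope ereal_scope.
Context {R : realType} {d : measure_display} {Omega : measurableType d}.
Variable P : probability Omega R.

(** Restricting f to the almost sure event S does not change its integral and
    makes it smaller than g everywhere. *)
Lemma ge0_le_integral_almost_surely (S : set Omega) (f g : Omega -> \bar R) :
  measurable S -> P S = 1 -> measurable_fun setT f ->
  (forall omega, 0 <= f omega) -> (forall omega, 0 <= g omega) ->
  (forall omega, S omega -> f omega <= g omega) ->
  \int[P]_omega f omega <= \int[P]_omega g omega.
Proof.
move=> mS PS mf f0 g0 fg.
rewrite (@ge0_negligible_integral _ _ _ P setT (~` S))//; last 2 first.
- exact: measurableC.
- by transitivity (P (~` S)) => //; rewrite probability_setC// PS subee.
rewrite setTD setCK integral_mkcond; apply: ge0_le_integral_nonmeasurable => omega.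
  by apply: erestrict_ge0 => ? _; exact: f0.
by rewrite patchE; case: ifPn => [/set_mem|_]; [exact: fg|exact: g0].
Qed.

End almost_sure_comparison.

Section random_sets.
Local Open Scope ereal_scope.
Context {R : realType} {d d' : measure_display} {T : measurableType d}
  {Omega : measurableType d'}.
Variables (m : {sigma_finite_measure set T -> \bar R}) (P : probability Omega R).

(** Robbins' theorem: by Fubini, the mean volume of a random set is the
    integral of the probability that the set contains a given point. *)
Lemma mean_volume_random_set (f : T -> \bar R) (A : Omega -> set T) :
  measurable [set z : T * Omega | A z.2 z.1] ->
  measurable_fun setT f -> (forall x, 0 <= f x) ->
  measurable_fun setT (fun omega => \int[m]_(x in A omega) f x) /\
  \int[P]_omega \int[m]_(x in A omega) f x =
  \int[m]_x (P [set omega | A omega x] * f x).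
Proof.
move=> mA mf f0; set A' := [set z : _ | _] in mA.
pose F (z : T * Omega) := (\1_A' z)%:E * f z.1.
have F0 z : 0 <= F z by rewrite /F mule_ge0.
have mF : measurable_fun setT F.
  apply: emeasurable_funM; first by apply/measurable_EFinP; exact: measurable_indic.
  by apply: measurableT_comp => //; exact: measurable_fst.
have FE : (fun omega => \int[m]_(x in A omega) f x) = fubini_G m F.
  apply/funext => omega; rewrite integral_mkcond; apply: eq_integral => x _.
  rewrite patchE /F indicE.
  have -> : ((x, omega) \in A') = (x \in A omega) by apply: asbool_equiv_eq.
  by case: ifP => _; rewrite ?mul1e ?mul0e.
rewrite FE; split; first exact: (measurable_fun_fubini_tonelli_G F mF F0).
transitivity (\int[P]_omega \int[m]_x F (x, omega)) => //.
rewrite -(fubini_tonelli F mF F0); apply: eq_integral => x _.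
have mx : measurable (xsection A' x) by exact: measurable_xsection.
have xE : xsection A' x = [set omega | A omega x].
  by apply/seteqP; split=> omega; rewrite /xsection/= inE.
transitivity (\int[P]_omega ((\1_(xsection A' x) omega)%:E * f x)).
  by apply: eq_integral => omega _; rewrite /F /= !indicE mem_xsection.
rewrite ge0_integralZr//; last first.
  by apply/measurable_EFinP; exact: measurable_indic.
by congr (_ * _); rewrite integral_indic// setIT xE.
Qed.

End random_sets.

Definition sigma_finite_productX {R : realType} {d1 d2 : measure_display}
    {T1 : measurableType d1} {T2 : measurableType d2}
    (m1 : {sigma_finite_measure set T1 -> \bar R})
    (m2 : {sigma_finite_measure set T2 -> \bar R}) :=
  HB.pack_for {sigma_finite_measure set (T1 * T2)%type -> \bar R} (m1 \x m2)%E
    (Measure_isSigmaFinite.Build _ _ _ (m1 \x m2)%E (sigma_finite_product m1 m2)).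

(** * Bounds for the vertices and the hull *)

Section hyperbolic_mecke.
Context {R : realType} {disp : measure_display} {Omega : measurableType disp}.
Variables (P : probability Omega R) (n : nat) (gamma : R).
Local Notation point := ('rV[R]_n * R)%type.
Local Notation L := (lebesgue_rV n \x @lebesgue_R R)%E.
Variable eta : Omega -> set point.
Hypothesis gamma_gt0 : 0 < gamma.
Hypothesis n_gt0 : (0 < n)%N.
Hypothesis heta : hyp_poisson_process P gamma eta.
Variable lambda : R.
Hypothesis lambda_gt0 : 0 < lambda.

Local Notation X omega := (eta omega `&` horoball lambda).
Local Notation B := (@ball_in_horoball R n lambda).

Let g (p : point) : \bar R := (gamma%:E * hyp_density p)%E.

Let g_ge0 p : (0 <= g p)%E.
Proof. by rewrite mule_ge0 ?hyp_density_ge0// lee_fin ltW. Qed.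

Let mg : measurable_fun setT g.
Proof. by apply: measurable_funeM; exact: measurable_hyp_density. Qed.

Let hyp_intensityE A : measurable A ->
  hyp_intensity gamma A = (\int[L]_(x in A) g x)%E.
Proof.
move=> mA; rewrite /hyp_intensity hyp_volE /g ge0_integralZl//.
- exact: measurable_funTS measurable_hyp_density.
- by move=> p _; exact: hyp_density_ge0.
- by rewrite lee_fin ltW.
Qed.

(** The cylinder over an orthant has infinite volume, so it contains infinitely
    many points of the process almost surely; there are countably many orthants
    [orthant e m]. *)
Lemma almost_surely_spread : exists Omega0 : set Omega,
  [/\ measurable Omega0, P Omega0 = 1%E &
      forall omega, Omega0 omega -> spread (X omega)].
Proof.
pose em k := odflt ([ffun=> false], 0%N)
  (@unpickle ({ffun 'I_n -> bool} * nat)%type k).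
pose far k : set point := cylinder lambda (orthant (em k).1 (em k).2).
have mfar k : measurable (far k).
  by apply: measurable_cylinder; exact: measurable_orthant.
pose G k := (npoints eta (far k) : Omega -> \bar R) @^-1` [set +oo%E].
have mG k : measurable (G k) by exact: (measurable_npoints_in (hyp_poisson heta)).
have PG k : P (G k) = 1%E.
  apply: (prob_npoints_infty (hyp_poisson heta)) => //.
  rewrite /hyp_intensity hyp_vol_cylinder//; last exact: measurable_orthant.
  rewrite lebesgue_rV_orthant// gt0_mulye ?gt0_muley ?lte_fin//.
  by rewrite divr_gt0 ?ltr0n// invr_gt0 exprn_gt0.
have mU : measurable (\bigcup_k ~` G k).
  by apply: bigcup_measurable => k _; exact: measurableC.
exists (~` \bigcup_k ~` G k); split.
- exact: measurableC.
- rewrite probability_setC// (_ : P _ = 0%E) ?sube0//.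
  apply/negligibleP => //; apply: negligible_bigcup => k.
  apply/negligibleP; first exact: measurableC.
  by transitivity (P (~` G k)) => //; rewrite probability_setC// PG subee.
move=> omega nU e m.
have : G (pickle (e, m)) omega.
  by apply: contrapT => nG; apply: nU; exists (pickle (e, m)).
rewrite /G /far /em pickleK /= => Noo.
have : eta omega `&` cylinder lambda (orthant e m) !=set0.
  by apply/set0P/eqP => h; move: Noo; rewrite /npoints (counting_eq0 _).2.
move=> [p [ep [pe pl]]]; exists p; last by move=> i; exact: pe.
by split=> //; move: pl; rewrite /horoball/= in_itv/= andbT.
Qed.

Lemma finite_points_in_half_ball omega w (M : R) :
  finite_set (X omega `&` [set p | sqdist w p <= M]).
Proof.
case: heta => _ fin _.
apply: sub_finite_set (fin omega _ (@sqdist_compact R n lambda w M) _).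
  move=> p [[ep lp] pM]; split=> //; have [pw p2] := sqdist_bounded pM.
  split; last by rewrite /= in_itv/= p2 andbT.
  by move=> i; have := pw i; rewrite /= in_itv/= ler_distl.
move=> p [_] /=; rewrite in_itv/= => /andP[lp _].
exact: lt_le_trans lp.
Qed.

Let measurable_B i : measurable (B i).
Proof. exact: measurable_ball_in_horoball. Qed.

Let prob_near (D : nat -> set point) (k : nat) x : \bar R :=
  P [set omega | exists2 i, i \in iota 0 k & D i x /\ empty_on eta (B i) omega].

Let mecke_limit (D : nat -> set point) (C : set point) (h : point -> \bar R) :
  measurable C -> (forall i, measurable (D i)) ->
  (forall x, C x -> h x =
     P [set omega | exists2 i, D i x & empty_on eta (B i) omega]) ->
  (\int[L]_(x in C) (prob_near D k x * g x) @[k --> \oo] -->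
   \int[L]_(x in C) (h x * g x))%E.
Proof.
move=> mC mD hE.
have pE k x : prob_near D k x =
    P (some_empty_on eta B [seq i <- iota 0 k | `[< D i x >]]).
  congr (P _); apply/seteqP; split=> omega [i].
    by move=> ik [Di vi]; exists i => //; rewrite mem_filter ik andbT; apply/asboolP.
  by rewrite mem_filter => /andP[/asboolP Di ik] vi; exists i.
have cvgp x : C x -> prob_near D k x @[k --> \oo] --> h x.
  move=> Cx; rewrite hE// (funext (fun k => pE k x)).
  by apply: (prob_exists_empty_on heta).
have gfin x : g x \is a fin_num by [].
have cvgpg x : C x -> (prob_near D k x * g x)%E @[k --> \oo] --> (h x * g x)%E.
  by move=> Cx; apply: cvgeZr => //; exact: cvgp.
have -> : (\int[L]_(x in C) (h x * g x) =
    \int[L]_(x in C) limn (fun k => prob_near D k x * g x))%E.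
  apply: eq_integral => x /[!inE] Cx; apply/esym/cvg_lim => //.
  exact: cvgpg.
apply: cvg_monotone_convergence => //.
- move=> k; apply: measurable_funTS; apply: emeasurable_funM => //.
  have := measurable_prob_covered (hyp_poisson heta) mD measurable_B [::] (iota 0 k).
  congr measurable_fun; apply/funext => x; congr (P _).
  by apply/seteqP; split=> omega; [move=> [[]//|]|right].
- by move=> k x _; rewrite mule_ge0// measure_ge0.
- move=> x _ k l kl; rewrite lee_wpmul2r//.
  rewrite !pE; apply: le_measure; rewrite ?inE.
  + exact: (measurable_some_empty_on (hyp_poisson heta)).
  + exact: (measurable_some_empty_on (hyp_poisson heta)).
  + move=> omega [i]; rewrite mem_filter mem_iota/= add0n => /andP[Di ik] vi.
    by exists i => //; rewrite mem_filter Di mem_iota/= add0n; exact: leq_trans ik kl.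
Qed.

Let near_points (D : nat -> set point) C k omega : set point :=
  [set x | [/\ eta omega x, C x &
     exists2 i, i \in iota 0 k & D i x /\ eta omega `&` B i `<=` [set x]]].

Let near_points_ndecr D C omega :
  {homo (near_points D C)^~ omega : i j / (i <= j)%N >-> i `<=` j}.
Proof.
move=> k l kl x [ex Cx [i ik Di]]; split=> //; exists i => //.
by move: ik; rewrite !mem_iota/= !add0n => ik; exact: leq_trans ik kl.
Qed.

Let mecke_near (D : nat -> set point) C k :
  measurable C -> (forall i, measurable (D i)) ->
  (forall i, (hyp_vol (D i) < +oo)%E) ->
  measurable_fun setT (fun omega => counting (near_points D C k omega) : \bar R) /\
  (\int[P]_omega counting (near_points D C k omega) =
   \int[L]_(x in C) (prob_near D k x * g x))%E.
Proof.
move=> mC mD Dfin.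
apply: (@mecke R _ _ _ _ P L g (hyp_intensity gamma) eta g_ge0 mg hyp_intensityE
  (hyp_intensity_ge0 gamma_gt0) (hyp_poisson heta) D B mD measurable_B) => //.
move=> i; rewrite /hyp_intensity.
have : hyp_vol (D i) \is a fin_num by rewrite ge0_fin_numE// hyp_vol_ge0.
by case: (hyp_vol (D i)) => // r _; rewrite -EFinM ltry.
Qed.

Let integral_g (h : point -> \bar R) C : measurable C -> measurable_fun setT h ->
  (forall x, 0 <= h x)%E ->
  (\int[L]_(x in C) (h x * g x) = gamma%:E * \int[L]_(x in C) (h x * hyp_density x))%E.
Proof.
move=> mC mh h0; rewrite -ge0_integralZl//; last 3 first.
- apply: measurable_funTS; apply: emeasurable_funM => //.
  exact: measurable_hyp_density.
- by move=> x _; rewrite mule_ge0// hyp_density_ge0.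
- by rewrite lee_fin ltW.
by apply: eq_integral => x _; rewrite /g muleCA.
Qed.

Lemma measurable_vscale (rho : R) : measurable_fun setT (vscale rho : point -> point).
Proof.
apply: measurable_fun_pair => //.
by apply: measurable_funM => //; exact: measurable_snd.
Qed.

(** With D i = B i, the points counted by the Mecke formula lie on empty
    half-balls: each is the only point of the process in a half-ball with centre
    w, hence the nearest one to w. So they project to vertices, and distinct ones
    to distinct vertices. *)
Lemma le_integral_vertices (W : set 'rV[R]_n) : measurable W ->
  (gamma%:E * (lebesgue_rV n W * (lambda ^- n * total_exposure P eta)%:E) <=
   \int[P]_omega counting (vertices (tessellation (X omega)) `&` W))%E.
Proof.
move=> mW; have [S0 [mO PO spreadO]] := almost_surely_spread.
have mC := measurable_cylinder lambda mW.
have Bfin i : (hyp_vol (B i) < +oo)%E.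
  apply: (hyp_vol_box_lty n_gt0 lambda_gt0) => p [hp lp]; split=> //.
  by apply: sqdist_bounded_coord; exact: ltW hp.
have XH omega : X omega `<=` halfspace.
  by move=> p [_ lp]; exact: lt_le_trans lp.
have near_on omega k x : near_points B (cylinder lambda W) k omega x ->
    [/\ X omega x, W x.1 & on_empty_ball (X omega) x].
  move=> [ex [Wx]]; rewrite /= in_itv/= andbT => lx [i _ [[ix _] Bx]].
  split=> //; exists (@rational_ball R n i).1 => p [ep lp].
  have [pi|] := ltP (sqdist (@rational_ball R n i).1 p) (@rational_ball R n i).2.
    by rewrite (Bx p).
  exact: (le_trans (ltW ix)).
have near_inj omega k :
    {in near_points B (cylinder lambda W) k omega &, injective fst}.
  move=> [v y] [v' y'] /set_mem/near_on[Xx _ [w xw]] /set_mem/near_on[Xx' _ [w' xw']] /= vE.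
  move: (xw _ Xx') (xw' _ Xx) (XH _ _ Xx) (XH _ _ Xx').
  rewrite /sqdist /halfspace/= -vE !lerD2l => h1 h2 y0 y0'; congr pair.
  apply/eqP; rewrite eq_le; apply/andP; split.
    by rewrite -(@ler_pXn2r _ 2%N)// nnegrE ltW.
  by rewrite -(@ler_pXn2r _ 2%N)// nnegrE ltW.
have limE : (\int[L]_(x in cylinder lambda W) (prob_near B k x * g x) @[k --> \oo] -->
    gamma%:E * (lebesgue_rV n W * (lambda ^- n * total_exposure P eta)%:E))%E.
  rewrite -(integral_prob_exposed n_gt0 heta)// -integral_g//.
  - apply: mecke_limit => // x [_]; rewrite /= in_itv/= andbT => lx.
    congr (P _); apply/seteqP; split=> omega.
      by move=> /exposedE[i ix Bi]; exists i.
    by move=> [i [ix _] Bi]; apply/exposedE; exists i.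
  - exact: (measurable_prob_exposed heta).
rewrite -(cvg_lim _ limE)//; apply: lime_le; first by apply/cvg_ex; eexists; exact: limE.
apply: nearW => k; have [mk <-] := mecke_near k mC measurable_B Bfin.
apply: (ge0_le_integral_almost_surely mO PO mk) => omega; [exact: counting_ge0..|].
move=> Oo.
rewrite -(counting_image_inj (near_inj omega k)); apply: counting_le.
move=> _ [x /near_on[Xx Wx xX] <-]; split=> //.
exact: (exposed_tessellation_vertex n_gt0 (XH omega)
  (@finite_points_in_half_ball omega) (spreadO _ Oo) Xx xX).
Qed.

(** A vertex comes from a point x on an empty half-ball, and then the point
    [vscale rho x] is in an empty half-ball. So it suffices to count the x in
    the sets D i = {x | vscale rho x in the i-th half-ball} for which B i is
    empty. *)
Lemma integral_vertices_le (W : set 'rV[R]_n) (rho : R) : measurable W -> 0 < rho < 1 ->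
  (\int[P]_omega counting (vertices (tessellation (X omega)) `&` W) <=
   gamma%:E * (lebesgue_rV n W *
     (lambda ^- n * (total_exposure P eta + (1 - rho ^+ n) / n%:R))%:E))%E.
Proof.
move=> mW rho01; have /andP[rho0 rho1] := rho01.
have mC := measurable_cylinder lambda mW.
pose D i : set point := horoball lambda `&` vscale rho @^-1` half_ball (@rational_ball R n i).
have mD i : measurable (D i).
  apply: measurableI; first exact: measurable_horoball.
  by rewrite -[Z in measurable Z]setTI; apply: measurable_vscale => //; exact: measurable_half_ball.
have Dfin i : (hyp_vol (D i) < +oo)%E.
  apply: (hyp_vol_box_lty n_gt0 lambda_gt0) => p [lp hp]; split=> //.
  by apply: (sqdist_bounded_coord (p := vscale rho p)); exact: ltW hp.
apply: (@le_trans _ _ (\int[L]_(x in cylinder lambda W)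
    (prob_exposed P eta lambda (vscale rho x) * g x))%E); last first.
  rewrite (integral_g (h := fun x => prob_exposed P eta lambda (vscale rho x)))//.
  - apply: lee_wpmul2l; first by rewrite lee_fin ltW.
    exact: (integral_prob_exposed_vscale n_gt0 heta lambda_gt0 rho01 mW).
  - apply: (measurableT_comp (f := prob_exposed P eta lambda)).
      exact: (measurable_prob_exposed heta).
    exact: measurable_vscale.
have limE : (\int[L]_(x in cylinder lambda W) (prob_near D k x * g x) @[k --> \oo] -->
    \int[L]_(x in cylinder lambda W)
      (prob_exposed P eta lambda (vscale rho x) * g x))%E.
  apply: (mecke_limit (h := fun x => prob_exposed P eta lambda (vscale rho x))) => // x [_].
  rewrite /= in_itv/= andbT => lx.
  congr (P _); apply/seteqP; split=> omega.
    by move=> /exposedE[i ix Bi]; exists i.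
  by move=> [i [_ ix] Bi]; apply/exposedE; exists i.
have limN : (\int[P]_omega counting (near_points D (cylinder lambda W) k omega) @[k --> \oo] -->
    \int[P]_omega counting (\bigcup_k near_points D (cylinder lambda W) k omega))%E.
  have -> : (\int[P]_omega counting (\bigcup_k near_points D (cylinder lambda W) k omega) =
      \int[P]_omega limn (fun k => counting (near_points D (cylinder lambda W) k omega) : \bar R))%E.
    apply: eq_integral => omega _; apply/esym/cvg_lim => //.
    by apply: cvg_counting; exact: near_points_ndecr.
  apply: cvg_monotone_convergence => //.
  - by move=> k; have [] := mecke_near k mC mD Dfin.
  - by move=> omega _ k l kl; apply: counting_le; exact: near_points_ndecr.
have -> : (\int[L]_(x in cylinder lambda W)
      (prob_exposed P eta lambda (vscale rho x) * g x) =
    \int[P]_omega counting (\bigcup_k near_points D (cylinder lambda W) k omega))%E.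
  rewrite (funext (fun k => (mecke_near k mC mD Dfin).2)) in limN.
  exact: cvg_unique limE limN.
apply: ge0_le_integral_nonmeasurable => omega; first exact: counting_ge0.
apply: le_trans (counting_image_le fst _); apply: counting_le.
move=> _ [/tessellation_vertex_on_empty_ball[x [[ex lx] <-] xX] Wx].
exists x => //.
have : exposed eta lambda omega (vscale rho x).
  apply: on_empty_ball_vscale => //; first exact: lt_le_trans lx.
  by rewrite ltW.
move=> /exposedE[i ix Bi]; exists i.+1 => //; split=> //.
  by split=> //=; rewrite in_itv/= andbT.
exists i; first by rewrite mem_iota/= add0n.
by split=> //; rewrite Bi.
Qed.

Let hull_in omega W : set point := geodesic_hull (X omega) `&` cylinder lambda W.

Let unexposed W rho omega : set point :=
  cylinder lambda W `\` vscale rho @^-1` exposed eta lambda omega.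

Let X_halfspace omega : X omega `<=` halfspace.
Proof. by move=> p [_ lp]; exact: lt_le_trans lp. Qed.

Let hull_sub_unexposed W omega : hull_in omega W `<=` unexposed W 1 omega.
Proof.
move=> x [Kx Cx]; split=> // Ux; apply: (covered_notin_hull _ _ Kx) => //.
by move: Ux; rewrite /preimage/= /vscale mul1r -surjective_pairing.
Qed.

Let unexposed_sub_hull W rho omega : 0 <= rho < 1 -> spread (X omega) ->
  unexposed W rho omega `<=` hull_in omega W.
Proof.
move=> rho01 sX x [Cx nUx]; split=> //; apply: contrapT => nKx; apply: nUx.
have x0 : halfspace x.
  by case: Cx => _; rewrite /= in_itv/= andbT; exact: lt_le_trans.
apply: on_empty_ball_vscale => //.
exact: (on_empty_ball_notin_hull n_gt0 (@X_halfspace omega) sX x0 nKx).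
Qed.

(** By [mean_volume_random_set], as a point x is unexposed with probability one
    minus [prob_exposed]. *)
Let mean_unexposed W rho : measurable W ->
  measurable_fun setT (fun omega => hyp_vol (unexposed W rho omega)) /\
  (\int[P]_omega hyp_vol (unexposed W rho omega) +
   \int[L]_(x in cylinder lambda W)
     (prob_exposed P eta lambda (vscale rho x) * hyp_density x) =
   hyp_vol (cylinder lambda W))%E.
Proof.
move=> mW; have mC := measurable_cylinder lambda mW.
have mU : measurable [set z : point * Omega | exposed eta lambda z.2 (vscale rho z.1)].
  rewrite -[Z in measurable Z]setTI.
  apply: (measurable_fun_pair (f := fun z : point * Omega => vscale rho z.1)
    (g := snd) _ _ measurableT (measurable_exposed2 heta lambda)) => //.
  by apply: measurableT_comp; [exact: measurable_vscale|exact: measurable_fst].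
have mA : measurable [set z : point * Omega | unexposed W rho z.2 z.1].
  rewrite (_ : [set _ | _] = (cylinder lambda W `*` setT) `\`
      [set z : point * Omega | exposed eta lambda z.2 (vscale rho z.1)]).
    by apply: measurableD => //; exact: measurableX.
  by apply/seteqP; split=> -[x omega]; rewrite /unexposed /=; tauto.
have [mvol volE] := mean_volume_random_set (sigma_finite_productX (lebesgue_rV n) (@lebesgue_R R))
  P mA (@measurable_hyp_density R n) (@hyp_density_ge0 R n).
have hE : (fun omega => hyp_vol (unexposed W rho omega)) =
    (fun omega => \int[L]_(x in unexposed W rho omega) hyp_density x)%E.
  by apply/funext => omega; exact: hyp_volE.
rewrite hE; split=> //; rewrite hyp_volE.
have mp : measurable_fun setT (fun x => prob_exposed P eta lambda (vscale rho x)).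
  apply: (measurableT_comp (f := prob_exposed P eta lambda)).
    exact: (measurable_prob_exposed heta).
  exact: measurable_vscale.
transitivity (\int[L]_(x in cylinder lambda W)
    (P [set omega | unexposed W rho omega x] * hyp_density x) +
   \int[L]_(x in cylinder lambda W)
     (prob_exposed P eta lambda (vscale rho x) * hyp_density x))%E.
  congr (_ + _)%E; transitivity (\int[L]_x
    (P [set omega | unexposed W rho omega x] * hyp_density x))%E => //.
  rewrite [RHS]integral_mkcond; apply: eq_integral => x _; rewrite patchE.
  case: ifPn => // /negP Cx; rewrite (_ : [set _ | _] = set0) ?measure0 ?mul0e//.
  by apply/seteqP; split=> // omega [Cx' _]; apply: Cx; rewrite inE.
have pE x : cylinder lambda W x ->
    (P [set omega | unexposed W rho omega x] = 1 - prob_exposed P eta lambda (vscale rho x))%E.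
  move=> Cx; transitivity (P (~` [set omega | exposed eta lambda omega (vscale rho x)])).
    by congr (P _); apply/seteqP; split=> omega; [case|split].
  by rewrite probability_setC//; exact: (measurable_exposed heta).
have p1 x : (prob_exposed P eta lambda x <= 1)%E by exact: probability_le1 (measurable_exposed heta lambda x).
have pfin x : prob_exposed P eta lambda x \is a fin_num.
  by rewrite ge0_fin_numE ?measure_ge0// (le_lt_trans (p1 _))// ltry.
have q0 x : (0 <= 1 - prob_exposed P eta lambda x)%E.
  by move: (pfin x) (p1 x); case: (prob_exposed _ _ _ _) => // r _; rewrite -EFinB !lee_fin subr_ge0.
rewrite (eq_integral (fun x => (1 - prob_exposed P eta lambda (vscale rho x)) * hyp_density x)%E); last first.
  by move=> x /set_mem Cx; rewrite pE.
have d0 x := @hyp_density_ge0 R n x.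
have md := @measurable_hyp_density R n.
rewrite -ge0_integralD//; last first.
- by apply: measurable_funTS; exact: emeasurable_funM.
- by move=> x _; exact: mule_ge0.
- apply: measurable_funTS; apply: emeasurable_funM => //.
  exact: emeasurable_funB.
- by move=> x _; exact: mule_ge0.
by apply: eq_integral => x _; rewrite -ge0_muleDl// subeK// mul1e.
Qed.

Section volume_fraction.
Variable W : set 'rV[R]_n.
Hypotheses (mW : measurable W) (W_gt0 : (0 < lebesgue_rV n W)%E)
  (W_fin : (lebesgue_rV n W < +oo)%E).

Let w := fine (lebesgue_rV n W).

Let wE : lebesgue_rV n W = w%:E.
Proof. by rewrite /w fineK// ge0_fin_numE// measure_ge0. Qed.

Let w_gt0 : 0 < w.
Proof. by move: W_gt0; rewrite wE lte_fin. Qed.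

Let vol := w * (lambda ^- n / n%:R).

Let vol_gt0 : 0 < vol.
Proof. by rewrite mulr_gt0// divr_gt0 ?ltr0n// invr_gt0 exprn_gt0. Qed.

Let volE : hyp_vol (cylinder lambda W) = vol%:E.
Proof. by rewrite hyp_vol_cylinder// wE -EFinM. Qed.

Let fractionE omega : (hull_volume_fraction eta lambda W omega)%:E =
  (hyp_vol (hull_in omega W) * (vol^-1)%:E)%E.
Proof.
rewrite /hull_volume_fraction volE EFinM fineK// ge0_fin_numE ?hyp_vol_ge0//.
apply: (@le_lt_trans _ _ (hyp_vol (cylinder lambda W))).
  by apply: le_hyp_vol => x [].
by rewrite volE ltry.
Qed.

Let c := total_exposure P eta.

Let mean_fraction_unexposed rho : 
  (\int[P]_omega (hyp_vol (unexposed W rho omega) * (vol^-1)%:E) +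
   \int[L]_(x in cylinder lambda W)
     (prob_exposed P eta lambda (vscale rho x) * hyp_density x) * (vol^-1)%:E = 1)%E.
Proof.
have [mvol meanE] := mean_unexposed rho mW.
have v0 : (0 <= (vol^-1)%:E :> \bar R)%E by rewrite lee_fin invr_ge0 ltW.
rewrite ge0_integralZr//; last by move=> omega _; exact: hyp_vol_ge0.
rewrite -ge0_muleDl ?meanE ?volE -?EFinM ?divff ?gt_eqF//.
- by apply: integral_ge0 => omega _; exact: hyp_vol_ge0.
- by apply: integral_ge0 => x _; rewrite mule_ge0 ?hyp_density_ge0 ?measure_ge0.
Qed.

Lemma mean_hull_volume_fraction_le :
  (mean_hull_volume_fraction P eta lambda W <= (1 - n%:R * c)%:E)%E.
Proof.
rewrite /mean_hull_volume_fraction unlock.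
apply: (@le_trans _ _ (\int[P]_omega (hyp_vol (unexposed W 1 omega) * (vol^-1)%:E))%E).
  apply: ge0_le_integral_nonmeasurable => omega; rewrite fractionE.
    by rewrite mule_ge0 ?hyp_vol_ge0// lee_fin invr_ge0 ltW.
  rewrite lee_wpmul2r ?lee_fin ?invr_ge0 ?(ltW vol_gt0)//.
  by apply: le_hyp_vol; exact: hull_sub_unexposed.
have := mean_fraction_unexposed 1.
rewrite (_ : (fun x => _) = (fun x => prob_exposed P eta lambda x * hyp_density x)%E); last first.
  by apply/funext => x; rewrite /vscale mul1r -surjective_pairing.
rewrite (integral_prob_exposed n_gt0 heta)// wE -!EFinM.
case: (\int[P]_omega _)%E => // r; rewrite -EFinD => -[rE]; rewrite lee_fin.
have n0 : n%:R != 0 :> R by rewrite pnatr_eq0 -lt0n.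
have l0 : lambda ^+ n != 0 by rewrite expf_neq0// gt_eqF.
rewrite -(addrK (w * (lambda ^- n * c) / vol) r) rE lerD2l lerN2 le_eqVlt /vol.
by apply/orP; left; apply/eqP; field; rewrite n0 l0 gt_eqF.
Qed.

Lemma mean_hull_volume_fraction_ge (rho : R) : 0 < rho < 1 ->
  ((1 - n%:R * c - (1 - rho ^+ n))%:E <= mean_hull_volume_fraction P eta lambda W)%E.
Proof.
move=> rho01; have /andP[rho0 rho1] := rho01.
have [S0 [mS PS spreadS]] := almost_surely_spread.
rewrite /mean_hull_volume_fraction unlock.
apply: (@le_trans _ _ (\int[P]_omega (hyp_vol (unexposed W rho omega) * (vol^-1)%:E))%E); last first.
  have v0 : (0 <= (vol^-1)%:E :> \bar R)%E by rewrite lee_fin invr_ge0 ltW.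
  apply: (ge0_le_integral_almost_surely mS PS) => [|omega|omega|omega So].
  - by apply: emeasurable_funM => //; have [] := mean_unexposed rho mW.
  - by rewrite mule_ge0 ?hyp_vol_ge0.
  - by rewrite fractionE mule_ge0 ?hyp_vol_ge0.
  - rewrite fractionE lee_wpmul2r//; apply: le_hyp_vol.
    by apply: unexposed_sub_hull; [rewrite (ltW rho0)|exact: spreadS].
have := mean_fraction_unexposed rho.
have := integral_prob_exposed_vscale n_gt0 heta lambda_gt0 rho01 mW.
have : (0 <= \int[L]_(x in cylinder lambda W)
     (prob_exposed P eta lambda (vscale rho x) * hyp_density x))%E.
  by apply: integral_ge0 => x _; rewrite mule_ge0 ?hyp_density_ge0 ?measure_ge0.
rewrite wE -EFinM; case: (\int[L]_(x in _) _)%E => // p _; rewrite lee_fin => ple.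
rewrite -EFinM.
case: (\int[P]_omega _)%E => // r; rewrite -EFinD => -[rE]; rewrite lee_fin.
rewrite -(addrK (p / vol) r) rE -addrA -opprD lerD2l lerN2 ler_pdivrMr//.
apply: le_trans ple _; rewrite /vol /c le_eqVlt; apply/orP; left; apply/eqP.
have n0 : n%:R != 0 :> R by rewrite pnatr_eq0 -lt0n.
have l0 : lambda ^+ n != 0 by rewrite expf_neq0// gt_eqF.
by field; rewrite n0 l0.
Qed.

End volume_fraction.

End hyperbolic_mecke.

(** * The two intensities *)

Lemma cvg_one_minus_expr {R : realType} (n : nat) (a b : R) :
  (a + b * (1 - rho ^+ n))%:E @[rho --> 1^'-] --> a%:E.
Proof.
have lim : a + b * (1 - rho ^+ n) @[rho --> (1 : R)] --> a + b * (1 - 1 ^+ n).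
  apply: (@cvgD _ _ _ _ _ (fun=> a)); first exact: cvg_cst.
  apply: cvgMl_tmp; apply: (@cvgB R R _ _ _ (fun=> 1) (fun rho : R => rho ^+ n)); first exact: cvg_cst.
  exact: exprn_continuous.
rewrite expr1n subrr mulr0 addr0 in lim.
by apply: cvg_EFin; [exact: nearW|exact: cvg_at_left_filter].
Qed.

Section intensities.
Context {R : realType} {disp : measure_display} {Omega : measurableType disp}.
Variables (P : probability Omega R) (n : nat) (gamma lambda : R).
Variable eta : Omega -> set ('rV[R]_n * R).
Hypotheses (gamma_gt0 : 0 < gamma) (lambda_gt0 : 0 < lambda) (n_gt0 : (0 < n)%N).
Hypothesis heta : hyp_poisson_process P gamma eta.
Variable W : set 'rV[R]_n.
Hypotheses (mW : measurable W) (W_gt0 : (0 < lebesgue_rV n W)%E)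
  (W_fin : (lebesgue_rV n W < +oo)%E).

(** The bounds [le_integral_vertices] and [integral_vertices_le] meet as rho
    tends to 1. *)
Lemma vertex_intensityE : vertex_intensity P eta lambda W =
  (gamma * lambda ^- n * total_exposure P eta)%:E.
Proof.
have wfin : lebesgue_rV n W \is a fin_num by rewrite ge0_fin_numE// measure_ge0.
have n0 : n%:R != 0 :> R by rewrite pnatr_eq0 -lt0n.
have l0 : lambda ^+ n != 0 by rewrite expf_neq0// gt_eqF.
rewrite /vertex_intensity; set I := (\int[P]_omega _)%E.
have lower : (_ <= I)%E := le_integral_vertices gamma_gt0 n_gt0 heta lambda_gt0 mW.
have upper rho : 0 < rho < 1 -> (I <= _)%E :=
  integral_vertices_le gamma_gt0 n_gt0 heta lambda_gt0 mW.
move: lower upper W_gt0; rewrite -(fineK wfin); move: (fine _) => w lower upper.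
rewrite lte_fin => w0.
have IE : I = (gamma * (w * (lambda ^- n * total_exposure P eta)))%:E.
  apply/eqP; rewrite eq_le -!EFinM in lower *; rewrite lower andbT.
  have h := @cvg_one_minus_expr R n (gamma * (w * (lambda ^- n * total_exposure P eta))) (gamma * w * lambda ^- n / n%:R).
  apply: (cvge_ge _ h).
  near=> rho; apply: (le_trans (upper rho _)).
    by apply/andP; split; near: rho; [exact: nbhs_left_gt|exact: nbhs_left_lt].
  rewrite -!EFinM lee_fin le_eqVlt; apply/orP; left; apply/eqP.
  by field; rewrite n0 l0.
rewrite IE inver gt_eqF// -EFinM; congr EFin.
by field; rewrite l0 gt_eqF.
Unshelve. all: by end_near.
Qed.

Lemma mean_hull_volume_fractionE : mean_hull_volume_fraction P eta lambda W =
  (1 - n%:R * total_exposure P eta)%:E.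
Proof.
apply/eqP; rewrite eq_le.
rewrite (mean_hull_volume_fraction_le n_gt0 heta lambda_gt0 mW W_gt0 W_fin)/=.
have h := @cvg_one_minus_expr R n (1 - n%:R * total_exposure P eta) (-1).
apply: (cvge_le _ h); near=> rho; rewrite mulN1r.
apply: (mean_hull_volume_fraction_ge gamma_gt0 n_gt0 heta lambda_gt0 mW W_gt0 W_fin).
by apply/andP; split; near: rho; [exact: nbhs_left_gt|exact: nbhs_left_lt].
Unshelve. all: by end_near.
Qed.

End intensities.

Theorem corollary17 (R : realType) (disp : measure_display)
    (Omega : measurableType disp) (P : probability Omega R)
    (d : nat) (hd : (2 <= d)%N)
    (gamma lambda lambda' : R)
    (hgamma : 0 < gamma) (hlambda : 0 < lambda) (hlambda' : 0 < lambda')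
    (eta : Omega -> set ('rV[R]_d.-1 * R))
    (heta : hyp_poisson_process P gamma eta)
    (W W' : set 'rV[R]_d.-1)
    (mW : measurable W) (bW : bounded_set W)
    (W_gt0 : (0 < lebesgue_rV d.-1 W)%E) (W_fin : (lebesgue_rV d.-1 W < +oo)%E)
    (mW' : measurable W') (bW' : bounded_set W')
    (W'_gt0 : (0 < lebesgue_rV d.-1 W')%E)
    (W'_fin : (lebesgue_rV d.-1 W' < +oo)%E) :
  ((lambda ^+ d.-1)%:E * vertex_intensity P eta lambda W =
   (gamma / d.-1%:R)%:E * (1 - mean_hull_volume_fraction P eta lambda' W'))%E.
Proof.
have n_gt0 : (0 < d.-1)%N by rewrite -ltnS prednK// ltnW.
rewrite (vertex_intensityE hgamma hlambda n_gt0 heta mW W_gt0 W_fin).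
rewrite (mean_hull_volume_fractionE hgamma hlambda' n_gt0 heta mW' W'_gt0 W'_fin).
rewrite -EFinB -!EFinM; congr EFin.
have n0 : d.-1%:R != 0 :> R by rewrite pnatr_eq0 -lt0n.
have l0 : lambda ^+ d.-1 != 0 by rewrite expf_neq0// gt_eqF.
by field; rewrite n0 l0.
Qed.
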